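(* There is an algorithm that, given a Node Multiway Cut instance $I=(G,T,k)$, decides whether $I$ is a YES-instance in time $4^{\max(p(I),0)}\cdot |I|^{O(1)}$, i.e. in $O^*(4^{p(I)})$ time, where $p(I)=k-LP(I)$.
   Context: A Node Multiway Cut instance $I=(G,T,k)$ consists of a simple undirected graph $G=(V,E)$, a set $T\subseteq V$ of terminals and an integer $k$; it is a YES-instance iff there is a set $X\subseteq V\setminus T$ with $|X|\le k$ such that every path in $G$ between two distinct terminals contains a vertex of $X$. Let $\mathcal P(I)$ be the set of all simple paths in $G$ connecting two distinct terminals. The LP-relaxation of $I$ is: minimize $\sum_{v\in V\setminus T} d_v$ subject to $\sum_{v\in V(P)\setminus T} d_v\ge 1$ for every $P\in\mathcal P(I)$ and $d_v\ge 0$ for all $v\in V\setminus T$. $LP(I)$ denotes the optimum value of this LP, and $p(I)=k-LP(I)$. $O^*(\cdot)$ suppresses factors polynomial in the input size $|I|$. *)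

(* Defs.v *)
From HB Require Import structures.
From mathcomp Require Import all_boot all_order all_algebra.
From mathcomp Require Import boolp classical_sets reals ereal exp.
Unset Printing Implicit Defensive.
Import Order.TTheory GRing.Theory Num.Theory.
Local Open Scope ring_scope.

Record NMC := mkNMC {
  nv : nat;
  adj : rel 'I_nv;
  term : {set 'I_nv};
  budget : nat }.

Definition nmc_wf (I : NMC) : Prop :=
  (forall u v : 'I_(nv I), adj I u v = adj I v u) /\
  (forall v : 'I_(nv I), ~~ adj I v v).

Definition term_path (I : NMC) (x : 'I_(nv I)) (s : seq 'I_(nv I)) : Prop :=
  [/\ path (adj I) x s, uniq (x :: s), x \in term I, last x s \in term I
    & x != last x s].

Definition nmc_yes (I : NMC) : Prop :=
  exists X : {set 'I_(nv I)},
    [/\ [disjoint X & term I], #|X| <= budget I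
      & forall x s, term_path I x s -> has (fun v => v \in X) (x :: s)]%N.

(* Feasible LP solutions (the values of d on terminals are irrelevant). *)
Definition lp_feasible (R : realType) (I : NMC) (d : 'I_(nv I) -> R) : Prop :=
  (forall v, v \notin term I -> 0 <= d v) /\
  (forall x s, term_path I x s ->
     1 <= \sum_(v <- x :: s | v \notin term I) d v).

(* LP(I): optimum value (infimum), +oo if infeasible. *)
Definition LP (R : realType) (I : NMC) : \bar R :=
  ereal_inf [set (\sum_(v | v \notin term I) d v)%:E | d in lp_feasible R I]%classic.

Definition pI (R : realType) (I : NMC) : \bar R := ((budget I)%:R%:E - LP R I)%E.

(* the exponent max(p(I), 0) as a real number (0 when LP is infeasible) *)
Definition pexp (R : realType) (I : NMC) : R := fine (maxe (pI R I) 0%E).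

Definition bin_nat (k : nat) : seq bool :=
  [seq odd (k %/ 2 ^ i) | i <- iota 0 (trunc_log 2 k).+1].

Definition encode (I : NMC) : seq bool :=
  nseq (nv I) true ++ [:: false] ++
  [seq adj I u v | u <- enum 'I_(nv I), v <- enum 'I_(nv I)] ++
  [seq v \in term I | v <- enum 'I_(nv I)] ++
  bin_nat (budget I).

Definition isize (I : NMC) : nat := size (encode I).

Inductive dir := Dleft | Dright | Dstay.

Record TM := mkTM {
  tm_state : finType;
  tm_sym : finType;
  tm_blank : tm_sym;
  tm_in : bool -> tm_sym;
  tm_start : tm_state;
  tm_acc : tm_state;
  tm_rej : tm_state;
  tm_delta : tm_state -> tm_sym -> tm_state * tm_sym * dir }.

(* configuration: state, left tape (nearest cell first), head cell, right tape *)
Definition config (M : TM) := (tm_state M * seq (tm_sym M) * tm_sym M * seq (tm_sym M))%type.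

Definition tm_init (M : TM) (w : seq bool) : config M :=
  let t := map (tm_in M) w in
  (tm_start M, [::], head (tm_blank M) t, behead t).

Definition tm_step (M : TM) (c : config M) : config M :=
  let: (q, l, a, r) := c in
  if (q == tm_acc M) || (q == tm_rej M) then c else
  let: (q', b, d) := tm_delta M q a in
  match d with
  | Dstay => (q', l, b, r)
  | Dleft => (q', behead l, head (tm_blank M) l, b :: r)
  | Dright => (q', b :: l, head (tm_blank M) r, behead r)
  end.

Definition tm_run (M : TM) (t : nat) (w : seq bool) : config M :=
  iter t (tm_step M) (tm_init M w).

Definition cstate (M : TM) (c : config M) : tm_state M := c.1.1.1.

(* Main.v *)
(** A half-integral solution of the linear program is described by a labelling: a vertex is
    deleted, or connected to one terminal, or undecided; in half-units it costs 2, respectively 0,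
    respectively one for having a labelled neighbour plus one for having two differently labelled
    neighbours.  If [h] is the least cost of a labelling that extends the terminals, then half of
    it is feasible, so [LP <= h / 2].  By persistency, labels that can be given without raising
    the least cost may be given for good; once no more can be given, deleting a vertex next to a
    labelled one, or giving it that label, raises the least cost by a half-unit.  So a run started
    at the bound [h] branches at most once for each bound from [h] to [2k], and at most
    [2 ^ (2k + 1 - h) <= 2 * 4 ^ p] sequences of branching bits have to be tried.

    Whether a labelling of cost at most [B] exists is decided in polynomial time by correcting
    violated constraints of integer potentials one unit at a time: each correction decreases the
    squared distance to an exact solution, and potentials that violate nothing are rounded to a
    labelling by a threshold.  The whole algorithm is a program of a loop language whose variables
    saturate, compiled to registers that are marks on the single tape of the machine. *)

Require Import Defs.
From HB Require Import structures.
From mathcomp Require Import all_boot all_order all_algebra.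
From mathcomp Require Import zify ring lra.
Set Implicit Arguments.
Unset Strict Implicit.
Unset Printing Implicit Defensive.
Import Order.TTheory GRing.Theory Num.Theory.

(** * Register programs on a single tape *)

(** A factor 2 for each half-unit is what gives base 4: from [LP <= h/2] follows [2k - h <= 2p]. A
    recursive search would need a stack of labellings on the tape. Instead a run is a function of an
    array of bits indexed by the current bound, not by the depth. Branching raises the bound, so
    each bit decides at most one branching and the part of a run below a bound depends only on the
    bits below it. The search tree is thus explored by replaying the run from the start for each
    value of a binary counter.

    The feasibility test is the relaxation method for linear inequalities, a perceptron argument on
    a grid of mesh [1/Q]. A constraint on three coordinates is corrected only if it is violated by
    at least 2: three unit moves then change the squared distance by at most [-4 + 3]. Constraints
    that hold up to 1 remain, and [Q] is so large that averaging the rounding over [Q - 1] radii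
    absorbs the accumulated error.

    The budget is written in binary and may be exponential in the input size; capping it at [n]
    keeps all quantities polynomial, preserves the answer and can only shrink the number of runs. *)

Definition upd (A : Type) (f : nat -> A) (x : nat) (y : A) : nat -> A :=
  fun z => if z == x then y else f z.

Lemma updE A (f : nat -> A) x y z : upd f x y z = if z == x then y else f z.
Proof. by []. Qed.

(* The value of a register is also an address on the tape, for [AWr], [TIn], [TPres] and [TW]. *)
Inductive act := AInc of nat | ADec of nat | AWr of nat & bool.
Inductive test := TLt of nat & nat | TIn of nat | TPres of nat | TW of nat.
Inductive cmd :=
  | CSkip | CAct of act | CSeq of cmd & cmd | CIf of test & cmd & cmd
  | CWhile of test & cmd.

Definition lst := ((nat -> nat) * (nat -> bool))%type.

Definition do_act (a : act) (s : lst) : lst :=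
  match a with
  | AInc r => (upd s.1 r (s.1 r).+1, s.2)
  | ADec r => (upd s.1 r (s.1 r).-1, s.2)
  | AWr r b => (s.1, upd s.2 (s.1 r) b)
  end.

Definition do_test (inp : nat -> option bool) (t : test) (s : lst) : bool :=
  match t with
  | TLt r1 r2 => s.1 r1 < s.1 r2
  | TIn r => inp (s.1 r) == Some true
  | TPres r => inp (s.1 r) != None
  | TW r => s.2 (s.1 r)
  end.

Definition act_ok (B : nat) (a : act) (s : lst) : bool :=
  if a is AInc r then s.1 r < B else true.

(** The count bounds the executed jump-code instructions from above. [B] bounds every register that
    is incremented, hence how far the head has to travel. *)
Inductive ev (inp : nat -> option bool) (B : nat) :
    cmd -> lst -> nat -> lst -> Prop :=
  | EvSkip s : ev inp B CSkip s 0 s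
  | EvAct a s : act_ok B a s -> ev inp B (CAct a) s 1 (do_act a s)
  | EvSeq c1 c2 s1 s2 s3 n m :
      ev inp B c1 s1 n s2 -> ev inp B c2 s2 m s3 ->
      ev inp B (CSeq c1 c2) s1 (n + m) s3
  | EvIf t c1 c2 s s' n :
      ev inp B (if do_test inp t s then c1 else c2) s n s' ->
      ev inp B (CIf t c1 c2) s n.+2 s'
  | EvWhileT t c s1 s2 s3 n m :
      do_test inp t s1 -> ev inp B c s1 n s2 -> ev inp B (CWhile t c) s2 m s3 ->
      ev inp B (CWhile t c) s1 (n + m).+2 s3
  | EvWhileF t c s : ~~ do_test inp t s -> ev inp B (CWhile t c) s 1 s.

(** * Compilation of structured programs to jump code *)

Inductive instr := IAct of act | IBr of test & nat | IJmp of nat.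

(** Jump targets are absolute, so the code depends on the address [b] at which it is placed. *)
Fixpoint code_of (b : nat) (c : cmd) : seq instr :=
  match c with
  | CSkip => [::]
  | CAct a => [:: IAct a]
  | CSeq c1 c2 => let k1 := code_of b c1 in k1 ++ code_of (b + size k1) c2
  | CIf t c1 c2 =>
      let k1 := code_of b.+1 c1 in
      let k2 := code_of (b + size k1).+2 c2 in
      IBr t (b + size k1).+2 :: k1 ++
      IJmp ((b + size k1).+2 + size k2) :: k2
  | CWhile t c =>
      let k := code_of b.+1 c in
      IBr t (b + size k).+2 :: k ++ [:: IJmp b]
  end.

Definition fstep (inp : nat -> option bool) (code : seq instr)
    (x : nat * lst) : nat * lst :=
  match nth (IJmp x.1) code x.1 with
  | IAct a => (x.1.+1, do_act a x.2)
  | IBr t k => (if do_test inp t x.2 then x.1.+1 else k, x.2)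
  | IJmp k => (k, x.2)
  end.

Definition fok (B : nat) (code : seq instr) (x : nat * lst) : bool :=
  (x.1 < size code) &&
  (if nth (IJmp x.1) code x.1 is IAct a then act_ok B a x.2 else true).

Inductive fruns inp B code : nat -> nat * lst -> nat * lst -> Prop :=
  | FR0 x : fruns inp B code 0 x x
  | FRS n x y : fok B code x -> fruns inp B code n (fstep inp code x) y ->
      fruns inp B code n.+1 x y.

Lemma fruns_trans inp B code n m x y z :
  fruns inp B code n x y -> fruns inp B code m y z ->
  fruns inp B code (n + m) x z.
Proof.
elim=> [//|{}n {}x {}y ok _ IH] H; rewrite addSn.
exact: FRS (IH H).
Qed.

Lemma nth_pre (i0 : instr) pre i post :
  nth i0 (pre ++ i :: post) (size pre) = i.
Proof. by rewrite nth_cat ltnn subnn. Qed.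

Lemma size_pre_lt pre (i : instr) post : size pre < size (pre ++ i :: post).
Proof. by rewrite size_cat /= addnS ltnS leq_addr. Qed.

Lemma nth_preE (i0 : instr) code pre i post :
  code = pre ++ i :: post -> nth i0 code (size pre) = i.
Proof. by move=> ->; rewrite nth_pre. Qed.

(** The number of steps may be smaller than [n]: an [else] branch is entered by the test alone,
    while a [then] branch also executes the jump over its alternative. The surrounding code [pre]
    and [post] is arbitrary so that the induction can descend into subprograms. *)
Lemma code_of_correct inp B c s n s' : ev inp B c s n s' ->
  forall code pre post, code = pre ++ code_of (size pre) c ++ post ->
  exists2 n', n' <= n &
    fruns inp B code n' (size pre, s) (size pre + size (code_of (size pre) c), s').
Proof.
elim=> {c s n s'}.
- by move=> s code pre post ->; exists 0 => //; rewrite addn0; constructor.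
- move=> a s ok code pre post -> /=; exists 1 => //.
  apply: FRS; first by rewrite /fok size_pre_lt /= nth_pre.
  rewrite /fstep nth_pre /= addn1; exact: FR0.
- move=> c1 c2 s1 s2 s3 n m _ IH1 _ IH2 code pre post E.
  have [n1 le1 r1] := IH1 code pre (code_of (size pre + size (code_of (size pre) c1)) c2 ++ post)
     (etrans E (congr1 (cat pre) (esym (catA _ _ _)))).
  have [n2 le2 r2] := IH2 code (pre ++ code_of (size pre) c1) post
     ltac:(by rewrite E /= size_cat -!catA).
  exists (n1 + n2); first by lia.
  apply: fruns_trans r1 _; move: r2; rewrite /= !size_cat.
  by rewrite addnA.
- move=> t c1 c2 s s' n _ IH code pre post E.
  move: E => /=; set k1 := code_of _ c1; set k2 := code_of _ c2 => E.
  have ok0 : fok B code (size pre, s).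
    by rewrite /fok E size_pre_lt nth_pre.
  have E0 : fstep inp code (size pre, s) =
      (if do_test inp t s then (size pre).+1 else (size pre + size k1).+2, s).
    by rewrite /fstep E nth_pre.
  case: (do_test inp t s) IH E0 => IH E0.
  + have [|n1 le1 r1] := IH code (rcons pre (IBr t (size pre + size k1).+2))
      (IJmp ((size pre + size k1).+2 + size k2) :: k2 ++ post).
      by rewrite E size_rcons cat_rcons -/k1 /= -catA.
    exists n1.+2; first by lia.
    apply: FRS ok0 _; rewrite E0 -(addn1 n1).
    move: r1; rewrite size_rcons -/k1 => r1; apply: (fruns_trans r1).
    have szE : (size pre).+1 + size k1 = size (pre ++ IBr t (size pre + size k1).+2 :: k1).
      by rewrite size_cat /=; lia.
    have E' : code = (pre ++ IBr t (size pre + size k1).+2 :: k1) ++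
       IJmp ((size pre + size k1).+2 + size k2) :: (k2 ++ post).
      by rewrite E /= -!catA /= -?catA.
    apply: FRS; first by rewrite /fok /= szE E' size_pre_lt nth_pre.
    rewrite /fstep /= szE (nth_preE _ E').
    rewrite size_cat /=.
    have -> : (size pre + size k1).+2 + size k2 = size pre + (size k1 + (size k2).+1).+1 by lia.
    exact: FR0.
  + have szE : size (pre ++ IBr t (size pre + size k1).+2 :: k1 ++
       [:: IJmp ((size pre + size k1).+2 + size k2)]) = (size pre + size k1).+2.
      by rewrite size_cat /= size_cat /=; lia.
    have [|n1 le1 r1] := IH code (pre ++ IBr t (size pre + size k1).+2 :: k1 ++
       [:: IJmp ((size pre + size k1).+2 + size k2)]) post.
      by rewrite szE -/k2 E /= -!catA /= -?catA.
    exists n1.+1; first by lia.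
    apply: FRS ok0 _; rewrite E0; move: r1; rewrite szE -/k2.
    rewrite size_cat /=.
    suff -> : size pre + (size k1 + (size k2).+1).+1 =
      (size pre + size k1).+2 + size k2 by [].
    by lia.
- move=> t c s1 s2 s3 n m tt _ IH1 _ IH2 code pre post E.
  have [n2 le2 r2] := IH2 code pre post E.
  move: E r2 => /=; set k := code_of _ c => E r2.
  have ok0 : fok B code (size pre, s1).
    by rewrite /fok E size_pre_lt nth_pre.
  have E0 : fstep inp code (size pre, s1) = ((size pre).+1, s1).
    by rewrite /fstep E nth_pre /= tt.
  have [|n1 le1 r1] := IH1 code (rcons pre (IBr t (size pre + size k).+2))
      (IJmp (size pre) :: post).
    by rewrite E size_rcons cat_rcons -/k /= -catA.
  exists (n1 + n2).+2; first by lia.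
  apply: FRS ok0 _; rewrite E0 -addnS.
  move: r1; rewrite size_rcons -/k => r1; apply: (fruns_trans r1).
  have szE : (size pre).+1 + size k = size (pre ++ IBr t (size pre + size k).+2 :: k).
    by rewrite size_cat /=; lia.
  have E' : code = (pre ++ IBr t (size pre + size k).+2 :: k) ++
       IJmp (size pre) :: post.
    by rewrite E /= -!catA /=.
  apply: FRS; first by rewrite /fok /= szE E' size_pre_lt nth_pre.
  by rewrite /fstep /= szE (nth_preE _ E').
- move=> t c s nt code pre post E; exists 1 => //.
  move: E => /=; set k := code_of _ c => E.
  apply: FRS; first by rewrite /fok E size_pre_lt nth_pre.
  rewrite /fstep (nth_preE _ E) /= (negPf nt) size_cat /=.
  have -> : (size pre + size k).+2 = size pre + (size k + 1).+1 by lia.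
  exact: FR0.
Qed.

(** The left tape is stored nearest cell first, so [catrev] restores its order. The tape becomes a
    function on all positions, blank beyond the stored cells, with the head at [size l]. *)
Definition arep (M : TM) (c : config M) (q : tm_state M) (pos : nat)
    (tau : nat -> tm_sym M) : Prop :=
  let: (q0, l, a, r) := c in
  [/\ q0 = q, size l = pos
    & forall j, nth (tm_blank M) (catrev l (a :: r)) j = tau j].

Lemma nth_head_behead (T : Type) (x : T) (r : seq T) j :
  nth x (head x r :: behead r) j = nth x r j.
Proof. by case: r => [|y r] //=; case: j => [|j] //=; rewrite nth_nil. Qed.

Lemma nth_catrev (T : Type) (x : T) (y : T) (l r : seq T) j :
  nth x (catrev l (y :: r)) j =
  if j < size l then nth x (rev l) j else nth x (y :: r) (j - size l).
Proof. by rewrite catrevE nth_cat size_rev. Qed.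

Definition move (d : dir) (p : nat) :=
  match d with Dleft => p.-1 | Dright => p.+1 | Dstay => p end.

Lemma arep_ext M (c : config M) q pos tau tau' :
  tau =1 tau' -> arep c q pos tau -> arep c q pos tau'.
Proof.
by move=> E; case: c => [[[q0 l] a] r] [-> sz H]; split=> // j; rewrite H E.
Qed.

(** A left move from cell 0 would insert a fresh blank cell and shift the whole tape, hence the side
    condition. *)
Lemma arep_step M (c : config M) q pos tau q' b d :
  arep c q pos tau -> q != tm_acc M -> q != tm_rej M ->
  tm_delta M q (tau pos) = (q', b, d) -> (d = Dleft -> 0 < pos) ->
  arep (tm_step M c) q' (move d pos) (upd tau pos b).
Proof.
case: c => [[[q0 l] a] r] [-> sz H] nacc nrej.
have -> : tau pos = a by rewrite -H nth_catrev sz ltnn subnn.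
rewrite /tm_step (negPf nacc) (negPf nrej) /= => -> left.
have K j : nth (tm_blank M) (catrev l (b :: r)) j = upd tau pos b j.
  rewrite updE -H !nth_catrev sz.
  case: ltngtP => // [lt|->]; last by rewrite subnn.
  by case E: (j - pos) => [|k] //; lia.
case: d left => left; split=> //=; rewrite ?sz //.
- by rewrite size_behead sz.
- move=> j; rewrite -K; case: l sz {H K left} (left erefl) => [<- //|x l] _ _.
  by [].
- move=> j; rewrite -K !nth_catrev sz; case: ltnP => // le.
  by case: (j - pos) => [|k] //=; rewrite -[RHS]nth_head_behead.
Qed.

(** * The Turing machine that interprets a fixed jump code *)

Section Machine.
Variables (K : nat) (code : seq instr) (racc : nat).

(* A tape cell holds an input symbol, a work bit, the set of registers whose value is the
   position of this cell, and a flag that marks the home cell 0. *)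
Definition rset := {set 'I_K.+1}.
Definition sym := (option bool * bool * rset * bool)%type.
Definition st := (('I_(size code).+1 * option bool) + option bool)%type.

Definition hin (c : sym) (r : nat) := (inord r : 'I_K.+1) \in c.1.2.
Definition cadd (c : sym) r : sym := (c.1.1, inord r |: c.1.2, c.2).
Definition crem (c : sym) r : sym := (c.1.1, c.1.2 :\ inord r, c.2).
Definition cwr (c : sym) b : sym := (c.1.1.1, b, c.1.2, c.2).

(* Each instruction starts at the home cell: seek the mark of a register to the right, possibly
   put it back one cell further, then return home. *)
Definition sSeek pc : st := inl (inord pc, Some false).
Definition sPut pc : st := inl (inord pc, Some true).
Definition sRet pc : st := inl (inord pc, None).

Definition relevant (t : test) (c : sym) :=
  match t with
  | TLt r1 r2 => hin c r1 || hin c r2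
  | TIn r | TPres r | TW r => hin c r
  end.

(* For [TLt r1 r2] the head stops at the first of the two marks: the test fails exactly when
   this is already the mark of [r2]. *)
Definition outc (t : test) (c : sym) : bool :=
  match t with
  | TLt r1 r2 => ~~ hin c r2
  | TIn r => c.1.1.1 == Some true
  | TPres r => c.1.1.1 != None
  | TW r => c.1.1.2
  end.

(** The start state [inr None] flags the home cell and drops the marks of all registers there, so
    every register begins at 0. A decrement that finds its mark in the home cell leaves it in place,
    which is the truncated predecessor. *)
Definition delta (q : st) (c : sym) : st * sym * dir :=
  match q with
  | inr None => (sSeek 0, (c.1.1, setT, true), Dstay)
  | inr (Some b) => (q, c, Dstay)
  | inl (pc, None) => if c.2 then (sSeek pc, c, Dstay) else (q, c, Dleft)
  | inl (pc, Some false) =>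
      if pc < size code then
        match nth (IJmp 0) code pc with
        | IJmp t => (sSeek t, c, Dstay)
        | IBr t k =>
            if relevant t c then (sRet (if outc t c then pc.+1 else k), c, Dstay)
            else (q, c, Dright)
        | IAct (AInc r) =>
            if hin c r then (sPut pc, crem c r, Dright) else (q, c, Dright)
        | IAct (ADec r) =>
            if hin c r then
              if c.2 then (sRet pc.+1, c, Dstay) else (sPut pc, crem c r, Dleft)
            else (q, c, Dright)
        | IAct (AWr r b) =>
            if hin c r then (sRet pc.+1, cwr c b, Dstay) else (q, c, Dright)
        end
      else (inr (Some (~~ hin c racc)), c, Dstay)
  | inl (pc, Some true) =>
      if nth (IJmp 0) code pc is IAct (AInc r | ADec r) then
        (sRet pc.+1, cadd c r, Dstay)
      else (q, c, Dstay)
  end.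

Definition machine : TM :=
  {| tm_state := st; tm_sym := sym;
     tm_blank := (None, false, set0, false);
     tm_in := fun b => (Some b, false, set0, false);
     tm_start := inr None; tm_acc := inr (Some true); tm_rej := inr (Some false);
     tm_delta := delta |}.

Definition areach (n : nat) (q : st) (p : nat) (tau : nat -> sym)
    (q' : st) (p' : nat) (tau' : nat -> sym) : Prop :=
  forall c : config machine,
    arep c q p tau -> @arep machine (iter n (tm_step machine) c) q' p' tau'.

Lemma areach0 q p tau tau' : tau =1 tau' -> areach 0 q p tau q p tau'.
Proof. by move=> E c /= H; apply: arep_ext H. Qed.

Lemma areach_trans n m q p tau q1 p1 tau1 q2 p2 tau2 :
  areach n q p tau q1 p1 tau1 -> areach m q1 p1 tau1 q2 p2 tau2 ->
  areach (n + m) q p tau q2 p2 tau2.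
Proof. by move=> H1 H2 c H; rewrite addnC iterD; apply/H2/H1. Qed.

Lemma areach1 q p tau q' b d tau' p' :
  q != inr (Some true) -> q != inr (Some false) ->
  delta q (tau p) = (q', b, d) -> (d = Dleft -> 0 < p) ->
  p' = move d p -> upd tau p b =1 tau' ->
  areach 1 q p tau q' p' tau'.
Proof.
move=> n1 n2 E left -> E' c H /=; apply: (@arep_ext machine _ _ _ _ _ E').
exact: (@arep_step machine) H n1 n2 E left.
Qed.

Lemma areachS n q p tau q1 p1 tau1 q2 p2 tau2 :
  areach 1 q p tau q1 p1 tau1 -> areach n q1 p1 tau1 q2 p2 tau2 ->
  areach n.+1 q p tau q2 p2 tau2.
Proof. exact: areach_trans. Qed.

Variable inp : nat -> option bool.

Definition tape (s : lst) (j : nat) : sym :=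
  (inp j, s.2 j, [set i : 'I_K.+1 | s.1 i == j], j == 0).

Lemma upd_same (A : Type) (f : nat -> A) x : upd f x (f x) =1 f.
Proof. by move=> z; rewrite updE; case: eqP => // ->. Qed.

Lemma seek_right pc tau n p :
  (forall j, p <= j < p + n -> delta (sSeek pc) (tau j) = (sSeek pc, tau j, Dright)) ->
  areach n (sSeek pc) p tau (sSeek pc) (p + n) tau.
Proof.
elim: n p => [|n IH] p H; first by rewrite addn0; apply: areach0.
apply: (@areachS _ _ _ _ (sSeek pc) p.+1 tau).
  by apply: areach1 (H p _) _ _ (upd_same _ _) => //; lia.
by rewrite -addSnnS; apply: IH => j Hj; apply: H; lia.
Qed.

Lemma ret_left pc s p : pc <= size code ->
  areach p.+1 (sRet pc) p (tape s) (sSeek pc) 0 (tape s).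
Proof.
move=> pcle; elim: p => [|p IH].
  by apply: (@areach1 _ _ _ _ _ Dstay) (upd_same _ _) => //=; rewrite /sSeek inord_val.
apply: (@areachS _ _ _ _ (sRet pc) p (tape s)) IH.
by apply: (@areach1 _ _ _ _ _ Dleft) (upd_same _ _).
Qed.

Lemma hin_tape s j r : r <= K -> hin (tape s j) r = (s.1 r == j).
Proof. by move=> rK; rewrite /hin inE inordK. Qed.

Lemma crem_cadd_tape s r v j : r <= K -> s.1 r != v ->
  upd (upd (tape s) (s.1 r) (crem (tape s (s.1 r)) r)) v
     (cadd (upd (tape s) (s.1 r) (crem (tape s (s.1 r)) r) v) r) j =
  tape (upd s.1 r v, s.2) j.
Proof.
move=> rK ne; have ne' : (v == s.1 r) = false by rewrite eq_sym (negPf ne).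
rewrite !updE ne' /cadd /crem /tape /=.
have [->|jv] := eqVneq j v.
  congr (_, _, _, _); apply/setP => i; rewrite !inE updE -[i == inord r]val_eqE /= inordK //.
  by case: (val i == r); rewrite /= ?ne' ?eqxx.
have [->|jr] := eqVneq j (s.1 r).
  congr (_, _, _, _); apply/setP => i; rewrite !inE updE -[i == inord r]val_eqE /= inordK //.
  by case: (val i == r); rewrite /= ?ne' ?andbF ?orbF ?eqxx.
congr (_, _, _, _); apply/setP => i; rewrite !inE updE.
case: (eqVneq (val i) r) => [->|//].
by rewrite [s.1 r == j]eq_sym (negPf jr) eq_sym (negPf jv).
Qed.

Definition instr_ok (L : nat) (i : instr) : bool :=
  match i with
  | IAct (AInc r | ADec r | AWr r _) => r <= K
  | IBr t k => (match t with TLt r1 r2 => (r1 <= K) && (r2 <= K)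
                | TIn r | TPres r | TW r => r <= K end) && (k <= L)
  | IJmp k => k <= L
  end.

Definition bnd (B : nat) (s : lst) := forall r, r <= K -> s.1 r <= B.


(** One instruction is a round trip from the home cell to a register mark, at most about [B] moves
    each way, plus a constant for writing; the increment is the longest. *)
Lemma fstep_sim B x : bnd B x.2 -> fok B code x ->
  all (instr_ok (size code)) code ->
  exists2 n, n <= B.*2 + 6 &
    areach n (sSeek x.1) 0 (tape x.2)
      (sSeek (fstep inp code x).1) 0 (tape (fstep inp code x).2)
    /\ (fstep inp code x).1 <= size code.
Proof.
case: x => pc s /= bs /andP[/= lt ok] /(all_nthP (IJmp pc)) /(_ pc lt).
have pcK : (inord pc : 'I_(size code).+1) = pc :> nat by rewrite inordK // ltnS ltnW.
have E0 : nth (IJmp 0) code pc = nth (IJmp pc) code pc by apply: set_nth_default.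
have D c : delta (sSeek pc) c = match nth (IJmp pc) code pc with
        | IJmp t => (sSeek t, c, Dstay)
        | IBr t k =>
            if relevant t c then (sRet (if outc t c then pc.+1 else k), c, Dstay)
            else (sSeek pc, c, Dright)
        | IAct (AInc r) =>
            if hin c r then (sPut pc, crem c r, Dright) else (sSeek pc, c, Dright)
        | IAct (ADec r) =>
            if hin c r then
              if c.2 then (sRet pc.+1, c, Dstay) else (sPut pc, crem c r, Dleft)
            else (sSeek pc, c, Dright)
        | IAct (AWr r b) =>
            if hin c r then (sRet pc.+1, cwr c b, Dstay) else (sSeek pc, c, Dright)
        end.
  by rewrite /= pcK lt E0.
rewrite /fstep /=; case: (nth (IJmp pc) code pc) D E0 ok => [[r|r|r b]|t k|k] D E0 ok /=.
- move=> rK; have rB := bs r rK.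
  exists (s.1 r + (1 + (1 + (s.1 r).+2))); first by lia.
  split; last by [].
  apply: areach_trans (seek_right (n := s.1 r) (p := 0) (tau := tape s) _) _.
    by move=> j Hj; rewrite D hin_tape //; case: eqP => // ?; lia.
  rewrite add0n; apply: areach_trans.
    apply: (@areach1 _ _ _ (sPut pc) _ Dright) => //.
    by rewrite D hin_tape // eqxx.
  apply: areach_trans; last exact: ret_left.
  apply: (@areach1 _ _ _ (sRet pc.+1) _ Dstay) => //.
    by rewrite /= pcK E0.
  move=> j; apply: crem_cadd_tape => //; rewrite /=; lia.
- move=> rK; have rB := bs r rK.
  case E: (s.1 r) => [|p].
    exists (0 + (1 + 1)); first by lia.
    split; last by [].
    apply: areach_trans (seek_right (n := 0) (p := 0) (tau := tape s) _) _ => //.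
    apply: areach_trans; last exact: ret_left.
    apply: (@areach1 _ _ _ _ _ Dstay); rewrite ?D ?hin_tape ?E //=.
    by move=> j; rewrite upd_same /tape; congr (_, _, _, _); apply/setP=> i;
      rewrite !inE /= updE; case: (eqVneq (val i) r) => [->|//]; rewrite E.
  exists (s.1 r + (1 + (1 + p.+1))); first by lia.
  split; last by [].
  apply: areach_trans (seek_right (n := s.1 r) (p := 0) (tau := tape s) _) _.
    by move=> j Hj; rewrite D hin_tape //; case: eqP => // ?; lia.
  rewrite add0n; apply: areach_trans.
    apply: (@areach1 _ _ _ (sPut pc) _ Dleft) => //; last by rewrite E.
    by rewrite D hin_tape // eqxx /tape /= E.
  apply: areach_trans; last exact: ret_left.
  apply: (@areach1 _ _ _ (sRet pc.+1) _ Dstay) => //.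
    by rewrite /= pcK E0.
    by rewrite E.
  rewrite /= [p in tape (upd _ _ p, _)](_ : _ = move Dleft (s.1 r)); last by rewrite E.
  by move=> j; rewrite -E; apply: crem_cadd_tape => //; rewrite /= E; lia.
- move=> rK; have rB := bs r rK.
  exists (s.1 r + (1 + (s.1 r).+1)); first by lia.
  split; last by [].
  apply: areach_trans (seek_right (n := s.1 r) (p := 0) (tau := tape s) _) _.
    by move=> j Hj; rewrite D hin_tape //; case: eqP => // ?; lia.
  rewrite add0n; apply: areach_trans; last exact: ret_left.
  apply: (@areach1 _ _ _ (sRet pc.+1) _ Dstay) => //.
    by rewrite D hin_tape // eqxx.
  by move=> j; rewrite /tape /= !updE; case: eqP => // ->.
- move=> /andP[tK kL].
  (* A comparison is decided at the nearer of the two marks, so the head stops at the minimum of the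
     two values. *)
  pose p := match t with TLt r1 r2 => minn (s.1 r1) (s.1 r2)
            | TIn r | TPres r | TW r => s.1 r end.
  have pB : p <= B.
    by rewrite /p; case: t tK {D E0 p} => [r1 r2|r|r|r]; try exact: bs;
      move=> /andP[/bs h1 /bs h2]; lia.
  have rel j : j <= p -> relevant t (tape s j) = (j == p).
    rewrite /p; case: t tK {D E0 p pB} => [r1 r2|r|r|r] /= tK jp; last 3 first.
    + by rewrite hin_tape // eq_sym.
    + by rewrite hin_tape // eq_sym.
    + by rewrite hin_tape // eq_sym.
    by case/andP: tK => k1 k2; rewrite !hin_tape //; lia.
  have out : outc t (tape s p) = do_test inp t s.
    rewrite /p; case: t tK {D E0 p pB rel} => [r1 r2|r|r|r] //= /andP[k1 k2].
    by rewrite hin_tape //; lia.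
  exists (p + (1 + p.+1)); first by lia.
  split; last by case: ifP.
  apply: areach_trans (seek_right (n := p) (p := 0) (tau := tape s) _) _.
    by move=> j Hj; rewrite D rel; [case: eqP => // ?; lia | lia].
  rewrite add0n; apply: areach_trans; last by apply: ret_left; case: ifP.
  apply: (@areach1 _ _ _ _ _ Dstay); rewrite ?D ?rel ?eqxx ?out //.
  exact: upd_same.
- move=> kL; exists 1; first by lia.
  split=> //; apply: (@areach1 _ _ _ _ _ Dstay); rewrite ?D //.
  exact: upd_same.
Qed.

Lemma bnd_fstep B x : bnd B x.2 -> fok B code x -> bnd B (fstep inp code x).2.
Proof.
case: x => pc s /= bs /andP[/= lt]; rewrite /fstep /=.
case: nth => [[r|r|r b]|t k|k] //= ok q qK; have := bs q qK; rewrite /upd /=;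
  by case: ifP => // /eqP ->; lia.
Qed.

Lemma fruns_sim B n x y : fruns inp B code n x y -> bnd B x.2 ->
  all (instr_ok (size code)) code -> x.1 <= size code ->
  bnd B y.2 /\ y.1 <= size code /\ exists2 m, m <= n * (B.*2 + 6) &
    areach m (sSeek x.1) 0 (tape x.2) (sSeek y.1) 0 (tape y.2).
Proof.
elim=> {n x y} [x|n x y ok _ IH] bx cok xle.
  by do 2![split=> //]; exists 0 => //; apply: areach0.
have [m1 le1 [r1 le2]] := fstep_sim bx ok cok.
have [by_ [yle [m2 le3 r2]]] := IH (bnd_fstep bx ok) cok le2.
do 2![split=> //]; exists (m1 + m2); first by rewrite mulSn leq_add.
exact: areach_trans r1 r2.
Qed.

End Machine.

Fixpoint cmd_ok (K : nat) (c : cmd) : bool :=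
  match c with
  | CSkip => true
  | CAct (AInc r | ADec r | AWr r _) => r <= K
  | CSeq c1 c2 => cmd_ok K c1 && cmd_ok K c2
  | CIf t c1 c2 =>
    [&& instr_ok K 0 (IBr t 0), cmd_ok K c1 & cmd_ok K c2]
  | CWhile t c1 => instr_ok K 0 (IBr t 0) && cmd_ok K c1
  end.

Lemma instr_ok_br K L t k : instr_ok K 0 (IBr t 0) -> k <= L -> instr_ok K L (IBr t k).
Proof. by rewrite /= andbT => -> ->. Qed.

Lemma code_of_ok K c b L : cmd_ok K c -> b + size (code_of b c) <= L ->
  all (instr_ok K L) (code_of b c).
Proof.
elim: c b => //=.
- by move=> [r|r|r v] b -> //.
- move=> c1 IH1 c2 IH2 b /andP[o1 o2]; rewrite size_cat all_cat addnA => le.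
  by rewrite IH1 ?IH2 //; lia.
- move=> t c1 IH1 c2 IH2 b /and3P[ot o1 o2]; rewrite size_cat all_cat /= => le.
  rewrite IH1 //; last by lia.
  rewrite IH2 //; last by lia.
  rewrite andbT /=; apply/andP; split; last by lia.
  by apply: (instr_ok_br (t := t)) => //; lia.
- move=> t c IH b /andP[ot o]; rewrite size_cat all_cat /= => le.
  rewrite IH //; last by lia.
  rewrite !andbT /=; apply/andP; split; last by lia.
  by apply: (instr_ok_br (t := t)) => //; lia.
Qed.

Definition tape_of (w : seq bool) (j : nat) : option bool := nth None (map Some w) j.

(* Acceptance is read off the register [racc]: it is nonzero iff its mark is not in the home cell. *)
Theorem machine_correct (K racc : nat) (c : cmd) (B : nat) (w : seq bool) n s' :
  cmd_ok K c -> racc <= K ->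
  ev (tape_of w) B c (fun=> 0, fun=> false) n s' ->
  let M := machine K (code_of 0 c) racc in
  forall t, n * (B.*2 + 6) + 2 <= t ->
  cstate M (tm_run M t w) = if s'.1 racc == 0 then tm_rej M else tm_acc M.
Proof.
move=> cok rK Hev M t tle.
set code := code_of 0 c; set inp := tape_of w.
have [n' le1 R] := code_of_correct (code := code) (pre := [::]) (post := [::]) Hev
   (esym (cats0 _)).
have ok := code_of_ok (b := 0) (L := size code) cok (leqnn _).
have [|by_ [_ [m le2 r]]] := fruns_sim racc R _ ok (leq0n _).
  by [].
have init : @arep M (tm_init M w) (inr None) 0 (fun j => (inp j, false, set0, false)).
  split=> // j; rewrite /= nth_head_behead /inp /tape_of.
  have [lt|le] := ltnP j (size w); first by rewrite !(nth_map true).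
  by rewrite !nth_default ?size_map.
have r0 : areach racc 1 (inr None : st code) 0 (fun j => (inp j, false, set0, false))
   (sSeek code 0) 0 (@tape K inp (fun=> 0, fun=> false)).
  apply: (@areach1 K code racc _ _ _ _ _ Dstay) => // j; rewrite updE /tape /=.
  case: eqP => [->|/eqP jn].
    by congr (_, _, _, _); apply/setP=> i; rewrite !inE.
  by congr (_, _, _, _); apply/setP=> i; rewrite !inE eq_sym (negPf jn).
have r1 : areach racc 1 (sSeek code (size code)) 0 (@tape K inp s')
   (inr (Some (s'.1 racc != 0))) 0 (@tape K inp s').
  apply: (@areach1 K code racc _ _ _ _ _ Dstay) (upd_same _ _) => //.
  by rewrite /= inordK // ltnn hin_tape.
have := areach_trans (areach_trans r0 r) r1 init.
have halt k (x : config M) : cstate M x = inr (Some (s'.1 racc != 0)) ->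
    cstate M (iter k (tm_step M) x) = inr (Some (s'.1 racc != 0)).
  move=> Ex; elim: k => //= k; case: (iter k _ _) => [[[q l] a] r'] /=.
  by rewrite /cstate /= => ->; case: (s'.1 racc != 0).
have le3 := leq_trans le2 (leq_mul le1 (leqnn _)).
(* One step to start, [m] for the code, one to decide; afterwards the configuration no longer
   changes, so every later time shows the same state. *)
set N := 1 + m + 1; have -> : t = (t - N) + N by lia.
rewrite /tm_run iterD; case E: (iter N _ _) => [[[q l] a] r'] [Eq _ _].
rewrite halt /cstate //=; by case: (s'.1 racc == 0).
Qed.

(** * Timed triples for register programs *)

Definition tr inp B (c : cmd) (t : nat) (s : lst) (Q : lst -> Prop) : Prop :=
  exists n s', [/\ n <= t, ev inp B c s n s' & Q s'].

Section Triples.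
Variables (inp : nat -> option bool) (B : nat).
Local Notation tr := (tr inp B).

Lemma tr_weak c t t' s (Q Q' : lst -> Prop) :
  tr c t s Q -> t <= t' -> (forall s', Q s' -> Q' s') -> tr c t' s Q'.
Proof.
move=> [n [s' [le e q]]] le' QQ; exists n, s'; split=> //; [lia|exact: QQ].
Qed.

Lemma tr_le c t t' s (Q : lst -> Prop) : tr c t s Q -> t <= t' -> tr c t' s Q.
Proof. by move=> H le; apply: tr_weak H le _. Qed.

Lemma tr_skip s (Q : lst -> Prop) : Q s -> tr CSkip 0 s Q.
Proof. by move=> q; exists 0, s; split=> //; constructor. Qed.

Lemma tr_act a s (Q : lst -> Prop) :
  act_ok B a s -> Q (do_act a s) -> tr (CAct a) 1 s Q.
Proof. by move=> ok q; exists 1, (do_act a s); split=> //; constructor. Qed.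

Lemma tr_seq c1 c2 t1 t2 s (Q1 Q : lst -> Prop) :
  tr c1 t1 s Q1 -> (forall s', Q1 s' -> tr c2 t2 s' Q) ->
  tr (CSeq c1 c2) (t1 + t2) s Q.
Proof.
move=> [n [s1 [le1 e1 q1]]] /(_ _ q1)[m [s2 [le2 e2 q2]]].
by exists (n + m), s2; split=> //; [exact: leq_add | exact: EvSeq e1 e2].
Qed.

Lemma tr_if t c1 c2 t1 s (Q : lst -> Prop) :
  tr (if do_test inp t s then c1 else c2) t1 s Q -> tr (CIf t c1 c2) t1.+2 s Q.
Proof.
by move=> [n [s1 [le1 e1 q1]]]; exists n.+2, s1; split=> //; apply: EvIf.
Qed.

(** [I j] describes the state after [j] rounds and [N] is the exact number of rounds. Each round
    pays two extra instructions, the test and the jump back; the failing test pays one. *)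
Lemma tr_while (I : nat -> lst -> Prop) t c N t0 s :
  (forall j s, j < N -> I j s -> do_test inp t s /\ tr c t0 s (I j.+1)) ->
  (forall s, I N s -> ~~ do_test inp t s) ->
  I 0 s -> tr (CWhile t c) (N * t0.+2).+1 s (I N).
Proof.
move=> step fin I0.
have H k : forall j s, j + k = N -> I j s -> tr (CWhile t c) (k * t0.+2).+1 s (I N).
  elim: k => [|k IH] j s' E Ij.
    by move: E Ij; rewrite addn0 => -> Ij; exists 1, s'; split=> //; apply/EvWhileF/fin.
  have [|tt [n [s1 [le1 e1 q1]]]] := step j s' _ Ij; first by lia.
  have [|m [s2 [le2 e2 q2]]] := IH j.+1 s1 _ q1; first by lia.
  by exists (n + m).+2, s2; split=> //; [lia|exact: EvWhileT e1 e2].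
exact: (H N 0).
Qed.

Definition frame (D : seq nat) (s s' : lst) :=
  s'.2 = s.2 /\ forall r, r \notin D -> s'.1 r = s.1 r.

(* Register 0 is never written and plays the constant 0. *)
Definition lclr r := CWhile (TLt 0 r) (CAct (ADec r)).

Lemma tr_clr r s m : r != 0 -> s.1 0 = 0 -> s.1 r <= m ->
  tr (lclr r) (3 * m).+1 s (fun s' => s'.1 r = 0 /\ frame [:: r] s s').
Proof.
move=> r0 z0 le.
apply: tr_weak (tr_while (N := s.1 r) (t0 := 1)
  (I := fun j s' => [/\ j <= s.1 r, s'.1 r = s.1 r - j & frame [:: r] s s']) _ _ _) _ _ => [j s' lt|s'|||s'].
- case=> jl E F; have [Fw Fr] := F.
  rewrite /= E Fr ?inE 1?eq_sym // z0; split; first by lia.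
  apply: tr_act => //; split=> //=; first by rewrite updE eqxx E; lia.
  by split=> //= q; rewrite inE => qr; rewrite updE (negPf qr) Fr // inE.
- case=> _ E [Fw Fr]; rewrite /= E Fr ?inE 1?eq_sym // z0; lia.
- by split=> //; lia.
- by lia.
- by case=> _ E F; split=> //; lia.
Qed.

Definition ladd r b :=
  CSeq (lclr 4) (CWhile (TLt 4 b) (CSeq (CAct (AInc r)) (CAct (AInc 4)))).

Lemma tr_add r b s : r != 4 -> b != 4 -> r != b -> r != 0 -> s.1 0 = 0 ->
  s.1 4 <= B -> s.1 r + s.1 b <= B ->
  tr (ladd r b) (8 * B.+1) s
    (fun s' => [/\ s'.1 r = s.1 r + s.1 b, s'.1 4 = s.1 b & frame [:: r; 4] s s']).
Proof.
move=> r4 b4 rb r0 z0 l4 lr.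
apply: (@tr_le _ ((3 * B).+1 + (s.1 b * 4).+1)); last by lia.
apply: tr_seq (tr_clr (m := B) _ _ _) _ => // s1 [E1 [w1 F1]].
have Eb : s1.1 b = s.1 b by rewrite F1 ?inE.
have Er : s1.1 r = s.1 r by rewrite F1 ?inE.
apply: tr_weak (tr_while (N := s.1 b) (t0 := 2)
  (I := fun j s' => [/\ s'.1 4 = j, s'.1 r = s.1 r + j & frame [:: r; 4] s s']) _ _ _) _ _ => [j s' lt|s'|||s'].
- case=> E4 E [Fw Fr]; have Eb' : s'.1 b = s.1 b by rewrite Fr // !inE negb_or eq_sym rb.
  rewrite /= E4 Eb'; split=> //.
  apply: (@tr_seq _ _ 1 1); first by apply: tr_act; [rewrite /= E; lia|exact: erefl].
  move=> _ <-; apply: tr_act => /=; first by rewrite updE eq_sym (negPf r4) E4; lia.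
  split; first by rewrite updE eqxx updE eq_sym (negPf r4) E4.
    by rewrite updE (negPf r4) updE eqxx E addnS.
  split=> //= q; rewrite !inE negb_or => /andP[q1 q2].
  by rewrite updE (negPf q2) updE (negPf q1) Fr // !inE negb_or q1.
- case=> E4 E [Fw Fr]; have Eb' : s'.1 b = s.1 b by rewrite Fr // !inE negb_or eq_sym rb.
  by rewrite /= E4 Eb' ltnn.
- split=> //; first by rewrite Er addn0.
  by split=> // q; rewrite !inE negb_or => /andP[_ q2]; rewrite F1 // inE.
- by lia.
- by case.
Qed.

(** One step of Horner's rule in base register 1, accumulated in register 2 with registers 3 and 4
    as scratch. *)
Definition lmuladd x :=
  CSeq (lclr 3) (CSeq (CWhile (TLt 0 2) (CSeq (CAct (ADec 2)) (ladd 3 1)))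
    (CSeq (ladd 3 x) (ladd 2 3))).

Lemma tr_muladd x s : x \notin [:: 2; 3; 4] -> s.1 0 = 0 -> s.1 4 <= B -> s.1 3 <= B ->
  s.1 2 <= B -> s.1 2 * s.1 1 + s.1 x <= B ->
  tr (lmuladd x) (50 * (B.+1 * B.+1)) s
    (fun s' => [/\ s'.1 2 = s.1 2 * s.1 1 + s.1 x, s'.1 4 <= B, s'.1 3 <= B & frame [:: 2; 3; 4] s s']).
Proof.
rewrite !inE !negb_or => /and3P[x2 x3 x4] z0 l4 l3 l2 lB.
apply: (@tr_le _ ((3 * B).+1 + ((s.1 2 * (1 + 8 * B.+1).+2).+1 + (8 * B.+1 + 8 * B.+1)))); last by nia.
apply: tr_seq (tr_clr (m := B) _ _ _) _ => // s1 [E1 [w1 F1]].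
have F1' : forall r, r != 3 -> s1.1 r = s.1 r by move=> r r3; rewrite F1 // inE.
apply: tr_seq (tr_while (N := s.1 2) (t0 := 1 + 8 * B.+1)
  (I := fun j s' => [/\ j <= s.1 2, s'.1 2 = s.1 2 - j, s'.1 3 = j * s.1 1, s'.1 4 <= B
       & frame [:: 2; 3; 4] s s']) _ _ _) _ => [j s' lt|s'||s'].
- case=> jl E2 E3 b4 [Fw Fr].
  have z' : s'.1 0 = 0 by rewrite Fr.
  have p' : s'.1 1 = s.1 1 by rewrite Fr.
  have nb : j.+1 * s.1 1 <= s.1 2 * s.1 1 by rewrite leq_mul2r lt orbT.
  rewrite /= z' E2; split; first by lia.
  apply: tr_seq; first by apply: tr_act; [by []|exact: erefl].
  move=> _ <-; apply: tr_weak (tr_add _ _ _ _ _ _ _) (leqnn _) _ => //=.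
    by rewrite ?updE /= E3 p'; lia.
  move=> s2; rewrite ?updE /= E3 p' => -[G3 G4 [Gw Gr]]; split.
  + by [].
  + by rewrite Gr //= E2 updE eqxx; lia.
  + by rewrite G3; lia.
  + by rewrite G4; case: (s.1 2) lt lB => // k _; lia.
  + split; first by rewrite Gw.
    move=> q; rewrite !inE !negb_or => /and3P[q2 q3 q4].
    by rewrite Gr ?inE ?negb_or ?q3 //= ?updE (negPf q2) Fr // !inE !negb_or q2 q3.
- by case=> _ E2 _ _ [Fw Fr]; rewrite /= E2 subnn Fr.
- split=> //; rewrite ?subn0 ?F1' //.
  by split=> // q; rewrite !inE !negb_or => /and3P[_ q3 _]; rewrite F1'.
case=> _ E2 E3 b4 [Fw Fr].
have z' : s'.1 0 = 0 by rewrite Fr.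
have x' : s'.1 x = s.1 x by rewrite Fr // !inE !negb_or x2 x3.
rewrite subnn in E2.
apply: tr_seq; first by apply: tr_add => //; [rewrite eq_sym | rewrite E3 x'].
move=> s2 [G3 G4 [Gw Gr]].
have z2 : s2.1 0 = 0 by rewrite Gr.
have h2 : s2.1 2 = 0 by rewrite Gr.
apply: tr_weak (tr_add _ _ _ _ _ _ _) (leqnn _) _ => //.
- by rewrite G4 x'; lia.
- by rewrite G3 h2 E3 x'; lia.
move=> s3 [H2 H4 [Hw Hr]]; split.
- by rewrite H2 h2 G3 E3 x'.
- by rewrite H4 G3 E3 x'.
- by rewrite Hr // G3 E3 x'.
split; first by rewrite Hw Gw.
move=> q; rewrite !inE !negb_or => /and3P[q2 q3 q4].
by rewrite Hr ?inE ?negb_or ?q2 //= Gr ?inE ?negb_or ?q3 //= Fr // !inE !negb_or q2 q3.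
Qed.

Definition linc (a : nat) (r : nat) := iter a (fun c => CSeq c (CAct (AInc r))) CSkip.

Lemma tr_inc a r s : s.1 r + a <= B ->
  tr (linc a r) a s (fun s' => s'.1 r = s.1 r + a /\ frame [:: r] s s').
Proof.
elim: a => [|a IH] le; first by apply: tr_skip; rewrite addn0.
rewrite -addn1 addn1 /= -[a.+1]addn1; apply: tr_seq; first by apply: IH; lia.
move=> s' [E [Fw Fr]]; apply: tr_act => /=; first by rewrite E; lia.
split; first by rewrite updE eqxx E; lia.
by split=> //= q; rewrite inE => qr; rewrite ?updE (negPf qr) Fr // inE.
Qed.

(** The Horner scheme of [addr] in base [T + 1]. The last step only multiplies by the block length,
    since register 0 is zero. *)
Definition laddr a x y :=
  CSeq (lclr 2) (CSeq (linc a 2) (CSeq (lmuladd x) (CSeq (lmuladd y) (lmuladd 0)))).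

Lemma tr_addr a x y s : x \notin [:: 2; 3; 4] -> y \notin [:: 2; 3; 4] ->
  s.1 0 = 0 -> s.1 4 <= B -> s.1 3 <= B -> s.1 2 <= B ->
  0 < s.1 1 -> ((a * s.1 1 + s.1 x) * s.1 1 + s.1 y) * s.1 1 <= B ->
  tr (laddr a x y) (160 * (B.+1 * B.+1)) s
    (fun s' => [/\ s'.1 2 = ((a * s.1 1 + s.1 x) * s.1 1 + s.1 y) * s.1 1,
      s'.1 4 <= B, s'.1 3 <= B & frame [:: 2; 3; 4] s s']).
Proof.
move=> nx ny z0 l4 l3 l2 p0 lB.
have lB1 : (a * s.1 1 + s.1 x) * s.1 1 + s.1 y <= B.
  by apply: leq_trans lB; apply: leq_pmulr.
have lB2 : a * s.1 1 + s.1 x <= B.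
  by apply: leq_trans lB1; apply: (leq_trans (leq_pmulr _ p0)); rewrite leq_addr.
have lB3 : a <= B.
  by apply: leq_trans lB2; apply: (leq_trans (leq_pmulr _ p0)); rewrite leq_addr.
apply: (@tr_le _ ((3 * B).+1 + (a + (50 * (B.+1 * B.+1) + (50 * (B.+1 * B.+1) +
   50 * (B.+1 * B.+1)))))); last by nia.
move: nx ny; rewrite !inE !negb_or => nx ny.
have [x2 x3 x4] := and3P nx; have [y2 y3 y4] := and3P ny.
apply: tr_seq (tr_clr (m := B) _ _ _) _ => // s1 [E1 [w1 F1]].
apply: tr_seq; first by apply: tr_inc; rewrite E1.
rewrite E1 add0n => s2 [E2 [w2 F2]].
have G2 q : q != 2 -> s2.1 q = s.1 q by move=> q2; rewrite F2 ?F1 // inE.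
apply: tr_seq; first by apply: tr_muladd; rewrite ?E2 ?G2 // !inE !negb_or x2 x3.
rewrite E2 !G2 // => s3 [E3 l43 l33 [w3 F3]].
have G3 q : q \notin [:: 2; 3; 4] -> s3.1 q = s.1 q.
  by move=> q2; rewrite F3 ?G2 //; apply: contra q2 => /eqP ->.
have Gy : s3.1 y = s.1 y by rewrite G3 // !inE !negb_or y2 y3.
have G1 : s3.1 1 = s.1 1 by rewrite G3.
have G0 : s3.1 0 = 0 by rewrite G3.
apply: tr_seq.
  by apply: tr_muladd; rewrite ?E3 ?G1 ?Gy ?inE ?negb_or ?y2 ?y3 ?y4.
rewrite E3 G1 Gy => s4 [E4 l44 l34 [w4 F4]].
have G4 q : q \notin [:: 2; 3; 4] -> s4.1 q = s.1 q.
  by move=> q2; rewrite F4 ?G3.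
have H1 : s4.1 1 = s.1 1 by rewrite G4.
have H0 : s4.1 0 = 0 by rewrite G4.
apply: tr_weak (tr_muladd _ _ _ _ _ _) (leqnn _) _; rewrite ?E4 ?H1 ?H0 ?addn0 //.
move=> s5 [E5 l45 l35 [w5 F5]]; split=> //.
split; first by rewrite w5 w4 w3 w2 w1.
by move=> q q2; rewrite F5 ?G4.
Qed.
End Triples.
Arguments tr_clr {inp B r s m} _ _ _.
Arguments tr_add {inp B r b s} _ _ _ _ _ _ _.
Arguments tr_muladd {inp B x s} _ _ _ _ _ _.
Arguments tr_inc {inp B a r s} _.
Arguments tr_addr {inp B a x y s} _ _ _ _ _ _ _ _.
Arguments tr_weak {inp B c t t' s Q Q'} _ _ _.
Arguments tr_le {inp B c t t' s Q} _ _.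
Arguments tr_skip {inp B s Q} _.
Arguments tr_act {inp B a s Q} _ _.
Arguments tr_seq {inp B c1 c2 t1 t2 s Q1 Q} _ _.
Arguments tr_if {inp B t c1 c2 t1 s Q} _.
Arguments tr_while {inp B I t c N t0 s} _ _ _.

(** * A loop language with saturating variables and arrays *)

Inductive hl :=
  | HSkip | HInc of nat | HDec of nat | HZero of nat
  | HRd of nat & nat & nat & nat | HWr of nat & nat & nat & nat
  | HSeq of hl & hl | HLt of nat & nat & hl & hl | HIn of nat & hl & hl
  | HFor of nat & nat & hl.

(* Variable 0 holds a bound at which [HInc] saturates; hence all loops are bounded and every
   program runs in time polynomial in that bound. *)
Record hst := HS { hv : nat -> nat; hm : nat -> nat -> nat -> nat }.

Definition setv s x n := HS (upd (hv s) x n) (hm s).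
Definition setm s a x y z :=
  HS (hv s) (upd (hm s) a (upd (hm s a) x (upd (hm s a x) y z))).

Section Exec.
Variable inp : nat -> option bool.

(** A total function, since the number of rounds of a loop is read once before it starts. The
    compiled [while] agrees with it because [wfh] forbids the body to change the loop variable or
    the bound. *)
Fixpoint exec (p : hl) (s : hst) : hst :=
  match p with
  | HSkip => s
  | HInc x => if hv s x < hv s 0 then setv s x (hv s x).+1 else s
  | HDec x => setv s x (hv s x).-1
  | HZero x => setv s x 0
  | HRd z a x y => setv s z (hm s a (hv s x) (hv s y))
  | HWr a x y z => setm s a (hv s x) (hv s y) (hv s z)
  | HSeq p q => exec q (exec p s)
  | HLt x y p q => if hv s x < hv s y then exec p s else exec q s
  | HIn x p q => if inp (hv s x) == Some true then exec p s else exec q s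
  | HFor x b p =>
      setv (foldl (fun s i => exec p (setv s x i)) s (iota 0 (hv s b))) x (hv s b)
  end.

Fixpoint mods (p : hl) : seq nat :=
  match p with
  | HSkip | HWr _ _ _ _ => [::]
  | HInc x | HDec x | HZero x | HRd x _ _ _ => [:: x]
  | HSeq p q | HLt _ _ p q | HIn _ p q => mods p ++ mods q
  | HFor x _ p => x :: mods p
  end.

Fixpoint amods (p : hl) : seq nat :=
  match p with
  | HWr a _ _ _ => [:: a]
  | HSeq p q | HLt _ _ p q | HIn _ p q => amods p ++ amods q
  | HFor _ _ p => amods p
  | _ => [::]
  end.

Lemma exec_mods p s y : y \notin mods p -> hv (exec p s) y = hv s y.
Proof.
elim: p s => //=; rewrite /=.
- by move=> x s; rewrite inE => /negPf E; case: ifP => //= _; rewrite updE E.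
- by move=> x s; rewrite inE => /negPf E; rewrite updE E.
- by move=> x s; rewrite inE => /negPf E; rewrite updE E.
- by move=> x a b c s; rewrite inE => /negPf E; rewrite updE E.
- move=> p IHp q IHq s; rewrite mem_cat negb_or => /andP[n1 n2].
  by rewrite IHq ?IHp.
- move=> a b p IHp q IHq s; rewrite mem_cat negb_or => /andP[n1 n2].
  by case: ifP => _; [rewrite IHp | rewrite IHq].
- move=> a p IHp q IHq s; rewrite mem_cat negb_or => /andP[n1 n2].
  by case: ifP => _; [rewrite IHp | rewrite IHq].
- move=> x b p IH s; rewrite inE negb_or => /andP[n1 n2].
  rewrite updE (negPf n1); move: (iota 0 _) => l; elim: l s => //= i l IHl s.
  by rewrite IHl IH //= updE (negPf n1).
Qed.

Lemma exec_amods p s a : a \notin amods p -> hm (exec p s) a = hm s a.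
Proof.
elim: p s => //=; rewrite /=.
- by move=> x s; case: ifP.
- by move=> b x y z s; rewrite inE => /negPf E; rewrite updE E.
- move=> p IHp q IHq s; rewrite mem_cat negb_or => /andP[n1 n2].
  by rewrite IHq ?IHp.
- move=> b c p IHp q IHq s; rewrite mem_cat negb_or => /andP[n1 n2].
  by case: ifP => _; [rewrite IHp | rewrite IHq].
- move=> b p IHp q IHq s; rewrite mem_cat negb_or => /andP[n1 n2].
  by case: ifP => _; [rewrite IHp | rewrite IHq].
- move=> x b p IH s n2.
  move: (iota 0 _) => l; elim: l s => //= i l IHl s.
  by rewrite IHl IH.
Qed.

Fixpoint wfh (K : nat) (p : hl) : bool :=
  match p with
  | HSkip => true
  | HInc x | HDec x | HZero x => (0 < x) && (x <= K)
  | HRd z a x y => [&& 0 < z, z <= K, a < 10, x <= K & y <= K]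
  | HWr a x y z => [&& z <= K, a < 10, x <= K & y <= K]
  | HSeq p q => wfh K p && wfh K q
  | HLt x y p q => [&& x <= K, y <= K, wfh K p & wfh K q]
  | HIn x p q => [&& x <= K, wfh K p & wfh K q]
  | HFor x b p => [&& 0 < x, x <= K, b <= K, x != b, x \notin mods p, b \notin mods p
                    & wfh K p]
  end.

(* Register 0 is zero, register 1 holds [T + 1], registers 2, 3, 4 are scratch; the variable [x]
   lives in register [x + 5]. *)
Local Notation V x := (x.+4.+1).

Fixpoint hc (p : hl) : cmd :=
  match p with
  | HSkip => CSkip
  | HInc x => CIf (TLt (V x) (V 0)) (CAct (AInc (V x))) CSkip
  | HDec x => CAct (ADec (V x))
  | HZero x => lclr (V x)
  | HRd z a x y => CSeq (laddr a (V x) (V y)) (CSeq (lclr (V z))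
      (CWhile (TW 2) (CSeq (CAct (AInc 2)) (CAct (AInc (V z))))))
  | HWr a x y z => CSeq (laddr a (V x) (V y)) (CSeq (lclr 3)
      (CWhile (TLt 3 1) (CSeq (CIf (TLt 3 (V z)) (CAct (AWr 2 true)) (CAct (AWr 2 false)))
         (CSeq (CAct (AInc 2)) (CAct (AInc 3))))))
  | HSeq p q => CSeq (hc p) (hc q)
  | HLt x y p q => CIf (TLt (V x) (V y)) (hc p) (hc q)
  | HIn x p q => CIf (TIn (V x)) (hc p) (hc q)
  | HFor x b p => CSeq (lclr (V x))
      (CWhile (TLt (V x) (V b)) (CSeq (hc p) (CAct (AInc (V x)))))
  end.

(** The exponent of [B + 1] in the time bound: a sequence or test gains 1 to absorb constants, a
    loop gains 3 for its number of rounds and for constants. *)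
Fixpoint hexp (p : hl) : nat :=
  match p with
  | HSkip => 0
  | HInc _ | HDec _ => 1
  | HZero _ => 2
  | HRd _ _ _ _ | HWr _ _ _ _ => 4
  | HSeq p q | HLt _ _ p q | HIn _ p q => (hexp p + hexp q).+1
  | HFor _ _ p => (hexp p).+3
  end.

#[local] Opaque laddr.

(** * Simulation of the loop language by registers *)

Section Sim.
Variables (K T : nat).
Hypothesis T_large : 200 <= T.
Let P := T.+1.
(** An address has four digits in base [P]: array, row, column and position in the unary block. *)
Definition hbound := P ^ 4.
Let B := hbound.

(* The entry [y] of row [x] of array [a] is stored in unary in a block of [T + 1] work bits. *)
Definition addr a x y := ((a * P + x) * P + y) * P.

Record simrel (hs : hst) (ls : lst) : Prop := Rel {
  rel0 : ls.1 0 = 0;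
  rel1 : ls.1 1 = P;
  rels : forall r, r < 5 -> ls.1 r <= B;
  relv : forall x, x <= K -> ls.1 (V x) = hv hs x;
  relT : hv hs 0 = T;
  relb : forall x, x <= K -> hv hs x <= T;
  relm : forall a x y, hm hs a x y <= T;
  relw : forall a x y i, x <= T -> y <= T -> i <= T ->
     ls.2 (addr a x y + i) = (i < hm hs a x y) }.

Lemma addr_inj a x y i a' x' y' i' : x <= T -> y <= T -> i <= T ->
  x' <= T -> y' <= T -> i' <= T ->
  addr a x y + i = addr a' x' y' + i' -> [/\ a = a', x = x', y = y' & i = i'].
Proof.
have E u v j k : j <= T -> k <= T -> u * P + j = v * P + k -> u = v /\ j = k.
  move=> jT kT H; suff uv : u = v by split=> //; rewrite uv in H; lia.
  have := congr1 (fun z => z %/ P) H; rewrite /= !divnMDl //.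
  by rewrite !divn_small ?ltnS // !addn0.
by move=> xT yT iT xT' yT' iT' /E[] // /E[] // /E[] // -> -> -> ->.
Qed.

Lemma addr_bound a x y : a < 10 -> x <= T -> y <= T -> addr a x y + P <= B.
Proof.
move=> a10 xT yT; rewrite /addr /B /hbound -/P.
have h1 : a * P + x + 1 <= P * P by rewrite /P; nia.
have h2 : (a * P + x) * P + y + 1 <= P * P * P by rewrite /P in h1 *; nia.
have -> : P ^ 4 = P * P * P * P by rewrite !expnS expn0; lia.
have := leq_mul h2 (leqnn P); rewrite !mulnDl mul1n; lia.
Qed.

Lemma PB : P <= B.
Proof.
rewrite /B /hbound -/P -[X in X <= _]expn1; apply: leq_pexp2l => //.
Qed.

Lemma rel_setv hs ls ls' x n : simrel hs ls -> 0 < x <= K -> n <= T ->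
  ls'.1 (V x) = n -> (forall r, r != V x -> r \notin [:: 2; 3; 4] -> ls'.1 r = ls.1 r) ->
  (forall r, r < 5 -> ls'.1 r <= B) -> ls'.2 = ls.2 ->
  simrel (setv hs x n) ls'.
Proof.
move=> [h0 h1 hs_ hv_ hT hb hm_ hw] /andP[x0 xK] nT E F S W; split=> //=.
- by rewrite F // h0.
- by rewrite F // h1.
- move=> y yK; rewrite updE; case: (eqVneq y x) => [->|yx] //.
  by rewrite F ?hv_.
- by rewrite updE; case: eqP => // e; lia.
- by move=> y yK; rewrite updE; case: eqP => // _; apply: hb.
- by move=> a y z i *; rewrite W hw.
Qed.

Lemma rel_weak hs ls ls' : simrel hs ls ->
  (forall r, r \notin [:: 2; 3; 4] -> ls'.1 r = ls.1 r) ->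
  (forall r, r < 5 -> ls'.1 r <= B) -> ls'.2 = ls.2 ->
  simrel hs ls'.
Proof.
move=> [h0 h1 hs_ hv_ hT hb hm_ hw] F S W; split=> //=.
- by rewrite F // h0.
- by rewrite F // h1.
- by move=> y yK; rewrite F ?hv_.
- by move=> a y z i *; rewrite W hw.
Qed.

Local Notation X := (B.+1).

(** One spare factor [X] absorbs all constants up to 200, because [X > T >= 200]. *)
Lemma X_ge e f c : c <= 200 -> e < f -> c * X ^ e <= X ^ f.
Proof.
move=> c2 ef; apply: (@leq_trans (X * X ^ e)); last first.
  by rewrite -expnS; apply: leq_pexp2l.
by rewrite leq_mul2r; apply/orP; right; have := PB; lia.
Qed.

Local Notation tr := (tr inp B).

Lemma hl_addr a x y hs ls : a < 10 -> x <= K -> y <= K -> simrel hs ls ->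
  tr (laddr a (V x) (V y)) (160 * (X * X)) ls
   (fun ls' => simrel hs ls' /\ ls'.1 2 = addr a (hv hs x) (hv hs y)).
Proof.
move=> a10 xK yK R; have [h0 h1 hs_ hv_ hT hb hm_ hw] := R.
have le := addr_bound a10 (hb _ xK) (hb _ yK).
apply: tr_weak; [apply: tr_addr; rewrite ?hs_ ?h1 ?hv_ // | exact: leqnn | ].
  by rewrite /addr in le; lia.
move=> s' [E2 l4 l3 [w F]]; rewrite h1 !hv_ // -/(addr _ _ _) in E2; split=> //.
apply: rel_weak R _ _ _ => // r r5; case: (boolP (r \in [:: 2; 3; 4])); last by move=> n; rewrite F ?hs_.
by rewrite !inE => /or3P[] /eqP -> //; rewrite E2; lia.
Qed.

(** Induction on the program. Saturation keeps variables and entries at most [T < X], so no loop has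
    more than [X] rounds and each construct raises the exponent by a constant. *)
Lemma hl_sim p : wfh K p -> forall hs ls, simrel hs ls ->
  tr (hc p) (X ^ hexp p) ls (simrel (exec p hs)).
Proof.
elim: p => /=.
- move=> _ hs ls R; by apply: tr_le (leq0n _); apply: tr_skip.
- move=> x /andP[x0 xK] hs ls R; have [h0 h1 hs_ hv_ hT hb hm_ hw] := R.
  apply: (@tr_le _ _ _ 3); last by rewrite expn1; have := PB; lia.
  apply: tr_if => /=; rewrite !hv_ //; case: ltnP => lt; last first.
    by apply: tr_le (leq0n _); apply: tr_skip.
  have := hb _ xK; have := PB; rewrite hT in lt => PB_ xb.
  apply: tr_act => /=; first by rewrite hv_ //; lia.
  apply: rel_setv R _ _ _ _ _ _ => //=; rewrite ?x0 //.
  + by rewrite updE eqxx hv_.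
  + by move=> r rx _; rewrite updE (negPf rx).
  + by move=> r r5; rewrite updE; case: eqP => [e|_]; [lia|exact: hs_].
- move=> x /andP[x0 xK] hs ls R; have [h0 h1 hs_ hv_ hT hb hm_ hw] := R.
  apply: (@tr_le _ _ _ 1); last by rewrite expn1; have := PB; lia.
  have := hb _ xK => xb.
  apply: tr_act => //=.
  apply: rel_setv R _ _ _ _ _ _ => //=; rewrite ?x0 //; first by lia.
  + by rewrite updE eqxx hv_.
  + by move=> r rx _; rewrite updE (negPf rx).
  + by move=> r r5; rewrite updE; case: eqP => [e|_]; [lia|exact: hs_].
- move=> x /andP[x0 xK] hs ls R; have [h0 h1 hs_ hv_ hT hb hm_ hw] := R.
  have xb := hb _ xK.
  apply: tr_weak; [apply: (tr_clr (m := B)) => // | | ].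
  + by rewrite hv_ //; have := PB; lia.
  + by rewrite expnS expn1; nia.
  move=> s' [E [Fw F]]; apply: rel_setv R _ _ _ _ _ _ => //=; rewrite ?x0 //.
    by move=> r rx _; rewrite F // inE.
  by move=> r r5; rewrite F ?hs_ // inE; lia.
- move=> z a x y /and5P[z0 zK a10 xK yK] hs ls R.
  have [h0 h1 hs_ hv_ hT hb hm_ hw] := R.
  have le := addr_bound a10 (hb _ xK) (hb _ yK).
  have xT := hb _ xK; have yT := hb _ yK; have zT := hb _ zK.
  have PB_ := PB.
  set N := hm hs a (hv hs x) (hv hs y); have NT : N <= T by apply: hm_.
  apply: (@tr_le _ _ _ (160 * (X * X) + ((3 * B).+1 + (N * 4).+1))); last first.
    by have := @X_ge 2 4 200 isT isT; rewrite {1}expnS expn1; nia.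
  apply: tr_seq (hl_addr a10 xK yK R) _ => s1 [R1 E1].
  have [g0 g1 gs gv gT gb gm gw] := R1.
  apply: tr_seq; first by apply: (tr_clr (m := B)); rewrite ?gv //; lia.
  move=> s2 [E2 [w2 F2]].
  (* Reading counts true bits up to the first false one; a block has [T + 1] cells and an entry is
     at most [T], so a false bit is always met inside the block. *)
  apply: tr_weak; [apply: (tr_while (N := N) (t0 := 2)
    (I := fun j s' => [/\ j <= N, s'.1 2 = addr a (hv hs x) (hv hs y) + j, s'.1 (V z) = j,
       s'.2 = s1.2 & forall r, r != V z -> r != 2 -> s'.1 r = s1.1 r])) | exact: leqnn | ]; [move=> j s' | move=> s' | | move=> s'].
  + move=> lt [_ E E3 w F]; rewrite /= E w gw //; last by lia.
    split; first by rewrite lt.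
    apply: (@tr_seq _ _ _ _ 1 1); first by apply: tr_act; [rewrite /= E; lia|exact: erefl].
    move=> _ <-; apply: tr_act => /=; first by rewrite updE /= E3; lia.
    split=> //; first by rewrite updE /= updE /= E; lia.
      by rewrite updE eqxx updE /= E3.
    by move=> r rz r2; rewrite updE (negPf rz) updE (negPf r2) F.
  + by move=> [_ E E3 w F]; rewrite /= E w gw // ltnn.
  + split=> //; first by rewrite F2 // E1 addn0.
    by move=> r rz _; rewrite F2 // inE.
  move=> [_ E E3 w F]; apply: rel_setv R1 _ _ _ _ _ _ => //; rewrite ?z0 //.
  + by move=> r rz; rewrite !inE !negb_or => /and3P[r2 _ _]; rewrite F.
  + move=> r r5; case: (eqVneq r 2) => [->|r2]; first by rewrite E; lia.
    by rewrite F ?gs //; lia.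
- move=> a x y z /and4P[zK a10 xK yK] hs ls R.
  have [h0 h1 hs_ hv_ hT hb hm_ hw] := R.
  have le := addr_bound a10 (hb _ xK) (hb _ yK).
  have xT := hb _ xK; have yT := hb _ yK; have zT := hb _ zK.
  have PB_ := PB.
  set A := addr _ _ _ in le.
  apply: (@tr_le _ _ _ (160 * (X * X) + ((3 * B).+1 + (P * 7).+1))); last first.
    by have := @X_ge 2 4 200 isT isT; rewrite {1}expnS expn1; nia.
  apply: tr_seq (hl_addr a10 xK yK R) _ => s1 [R1 E1].
  have [g0 g1 gs gv gT gb gm gw] := R1.
  apply: tr_seq; first by apply: (tr_clr (m := B)); rewrite ?gv //; exact: gs.
  move=> s2 [E2 [w2 F2]].
  (* All [P] cells of the block are rewritten, which also erases what remains of a larger old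
     entry. *)
  apply: tr_weak; [apply: (tr_while (N := P) (t0 := 3 + (1 + 1))
    (I := fun j s' => [/\ j <= P, s'.1 2 = A + j, s'.1 3 = j,
       forall q, s'.2 q = if A <= q < A + j then q - A < hv hs z else s1.2 q
       & forall r, r != 3 -> r != 2 -> s'.1 r = s1.1 r])) | exact: leqnn | ]; [move=> j s' | move=> s' | | move=> s'].
  + move=> lt [_ E E3 w F].
    have p' : s'.1 1 = P by rewrite F.
    have z' : s'.1 (V z) = hv hs z by rewrite F ?gv.
    rewrite /= E3 p'; split=> //.
    apply: (@tr_seq _ _ _ _ 3 2 _ (fun s3 => s3 = (s'.1, upd s'.2 (A + j) (j < hv hs z)))).
      apply: tr_if => /=; rewrite E3 z'; case: ifP => _; apply: tr_act => //=; by rewrite E.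
    move=> _ ->.
    apply: (@tr_seq _ _ _ _ 1 1); first by apply: tr_act; [rewrite /= E; lia|exact: erefl].
    move=> _ <-; apply: tr_act => /=; first by rewrite updE /= E3; lia.
    split=> //; first by rewrite updE /= updE /= E; lia.
      by rewrite updE /= updE /= E3.
    * move=> q; rewrite updE w; case: eqVneq => [->|ne].
        by rewrite addKn ifT //; lia.
      by rewrite (_ : (A <= q < A + j.+1) = (A <= q < A + j)) //; lia.
    * by move=> r r3 r2; rewrite updE (negPf r3) updE (negPf r2) F.
  + by move=> [_ E E3 w F]; rewrite /= E3 F // g1 ltnn.
  + split=> //; first by rewrite F2 // E1 addn0.
      by move=> q; rewrite w2 addn0 ifF //; lia.
    by move=> r rz _; rewrite F2 // inE.
  move=> [_ E E3 w F]; split=> //=.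
  + by rewrite F.
  + by rewrite F.
  + move=> r r5; case: (eqVneq r 2) => [->|r2]; first by rewrite E; lia.
    case: (eqVneq r 3) => [->|r3]; first by rewrite E3.
    by rewrite F ?gs //.
  + by move=> q qK; rewrite F ?gv.
  + move=> a' x' y'; rewrite updE; case: eqP => // _; rewrite updE; case: eqP => // _.
    by rewrite updE; case: eqP.
  + move=> a' x' y' i xT' yT' iT; rewrite w gw //.
    (* A cell in the rewritten window can only belong to the written entry, since blocks of
       different entries are disjoint by [addr_inj]. *)
    case: ifP => [H|H].
      have [E5 E6 E7 E8]: [/\ a' = a, x' = hv hs x, y' = hv hs y & i = (addr a' x' y' + i - A)].
        apply: addr_inj => //; last by rewrite -/A; lia.
        by lia.
      by rewrite -E8 updE E5 eqxx updE E6 eqxx updE E7 eqxx.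
    suff -> : upd (hm hs) a (upd (hm hs a) (hv hs x) (upd (hm hs a (hv hs x)) (hv hs y) (hv hs z))) a' x' y' = hm hs a' x' y' by [].
    rewrite updE; case: eqP => // ea; rewrite updE; case: eqP => [ex|_]; last by rewrite ea.
    rewrite updE; case: eqP => [ey|_]; last by rewrite ea ex.
    by move: H; rewrite ea ex ey -/A; lia.
- move=> p IHp q IHq /andP[/IHp H1 /IHq H2].
  move=> hs ls R; set e1 := hexp p in H1 *; set e2 := hexp q in H2 *.
  apply: (@tr_le _ _ _ (X ^ e1 + X ^ e2)); last first.
    have h1 : X ^ e1 <= X ^ (e1 + e2) by rewrite leq_pexp2l // leq_addr.
    have h2 : X ^ e2 <= X ^ (e1 + e2) by rewrite leq_pexp2l // leq_addl.
    by have := @X_ge (e1 + e2) (e1 + e2).+1 200 isT (ltnSn _); lia.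
  apply: tr_seq (H1 _ _ R) _ => s1 R1; exact: H2.
- move=> x y p IHp q IHq /and4P[xK yK /IHp H1 /IHq H2].
  move=> hs ls R; set e1 := hexp p in H1 *; set e2 := hexp q in H2 *.
  have h1 : X ^ e1 <= X ^ (e1 + e2) by rewrite leq_pexp2l // leq_addr.
  have h2 : X ^ e2 <= X ^ (e1 + e2) by rewrite leq_pexp2l // leq_addl.
  have h3 : 0 < X ^ (e1 + e2) by rewrite expn_gt0.
  have h4 := @X_ge (e1 + e2) (e1 + e2).+1 200 isT (ltnSn _).
  apply: (@tr_le _ _ _ (X ^ (e1 + e2)).+2); last by lia.
  apply: tr_if => /=; rewrite !(relv R) //; case: ifP => _.
    exact: tr_le (H1 _ _ R) h1.
  exact: tr_le (H2 _ _ R) h2.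
- move=> x p IHp q IHq /and3P[xK /IHp H1 /IHq H2].
  move=> hs ls R; set e1 := hexp p in H1 *; set e2 := hexp q in H2 *.
  have h1 : X ^ e1 <= X ^ (e1 + e2) by rewrite leq_pexp2l // leq_addr.
  have h2 : X ^ e2 <= X ^ (e1 + e2) by rewrite leq_pexp2l // leq_addl.
  have h3 : 0 < X ^ (e1 + e2) by rewrite expn_gt0.
  have h4 := @X_ge (e1 + e2) (e1 + e2).+1 200 isT (ltnSn _).
  apply: (@tr_le _ _ _ (X ^ (e1 + e2)).+2); last by lia.
  apply: tr_if => /=; rewrite !(relv R) //; case: ifP => _.
    exact: tr_le (H1 _ _ R) h1.
  exact: tr_le (H2 _ _ R) h2.
- move=> x b p IH /and5P[x0 xK bK xb /and3P[xm bm wp]]; have H := IH wp.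
  move=> hs ls R; set e := hexp p in H *; have [h0 h1 hs_ hv_ hT hb hm_ hw] := R.
  have PB_ := PB; have bT := hb _ bK; have xT := hb _ xK.
  pose F j := foldl (fun s i => exec p (setv s x i)) hs (iota 0 j).
  have FS j : F j.+1 = exec p (setv (F j) x j).
    by rewrite /F -(addn1 j) iotaD foldl_cat.
  have Fb j : hv (F j) b = hv hs b.
    by elim: j => //= j IHj; rewrite FS exec_mods //= updE eq_sym (negPf xb).
  apply: (@tr_le _ _ _ ((3 * B).+1 + (hv hs b * (X ^ e + 1).+2).+1)); last first.
    have h2 := @X_ge e.+2 e.+3 200 isT (ltnSn _).
    have h3 : X ^ e.+2 = X * (X * X ^ e) by rewrite !expnS.
    have h4 : 0 < X ^ e by rewrite expn_gt0.
    have h5 : X * X <= X ^ e.+2 by rewrite h3 mulnA leq_pmulr.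
    have h6 : hv hs b * (X ^ e + 1).+2 <= X * (4 * X ^ e) by apply: leq_mul; lia.
    have h7 : X * (4 * X ^ e) <= 4 * X ^ e.+2.
      by rewrite h3 [X * (4 * _)]mulnCA leq_mul2l leq_mul2l leq_pmull // !orbT.
    by nia.
  apply: tr_seq; first by apply: (tr_clr (m := B)); rewrite ?hv_ //; lia.
  move=> s1 [E1 [w1 F1]].
  apply: tr_weak; [apply: (tr_while (N := hv hs b) (t0 := X ^ e + 1)
     (I := fun j s' => j <= hv hs b /\ simrel (setv (F j) x j) s')) | exact: leqnn | ]; [move=> j s' lt | move=> s' | | move=> s'].
  + move=> [_ Rj]; split.
      by rewrite /= !(relv Rj) //= !updE eqxx eq_sym (negPf xb) Fb.
    apply: tr_seq (H _ _ Rj) _ => s2; rewrite -FS => R2.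
    have rs2 := rels R2.
    have x2 : s2.1 (V x) = j by rewrite (relv R2) // FS exec_mods //= updE eqxx.
    apply: tr_act => /=; first by rewrite x2; lia.
    split=> //; apply: rel_setv R2 _ _ _ _ _ _ => //=; rewrite ?x0 //.
    * by lia.
    * by rewrite updE eqxx x2.
    * by move=> r rx _; rewrite updE (negPf rx).
    * by move=> r r5; rewrite updE; case: eqP => [e'|_]; [lia|exact: rs2].
  + by move=> [_ Rj]; rewrite /= !(relv Rj) //= !updE eqxx eq_sym (negPf xb) Fb ltnn.
  + split=> //; apply: rel_setv R _ _ _ _ _ _ => //=; rewrite ?x0 //.
    * by move=> r rx _; rewrite F1 // inE.
    * by move=> r r5; rewrite F1 ?hs_ // inE; lia.
  + by case.
Qed.

End Sim.
End Exec.

(** * Half-integral labellings *)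

Section Labelling.
Variables (n : nat) (e : rel nat).
Hypothesis e_sym : forall u v, e u v = e v u.
Hypothesis e_irr : forall v, e v v = false.

(* Label 0 is undecided, the proper label [t + 1] means connected to terminal [t], and [n + 1]
   means deleted. *)
Definition prp (l : nat) := 0 < l <= n.
Definition del := n.+1.

Definition valid (lam : nat -> nat) : Prop :=
  forall u v, u < n -> v < n -> e u v -> prp (lam u) -> prp (lam v) -> lam u = lam v.

Definition nb1 (lam : nat -> nat) (v : nat) : bool :=
  [exists u : 'I_n, e u v && prp (lam u)].

Definition nb2 (lam : nat -> nat) (v : nat) : bool :=
  [exists u : 'I_n, [exists w : 'I_n,
    [&& e u v, e w v, prp (lam u), prp (lam w) & lam u != lam w]]].

(* Costs are counted in half-units: [cost / 2] is a feasible solution of the linear program. *)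
Definition cost (lam : nat -> nat) (v : nat) : nat :=
  if lam v == del then 2 else if lam v == 0 then nb1 lam v + nb2 lam v else 0.

Definition tcost (lam : nat -> nat) : nat := \sum_(v < n) cost lam v.

Definition rng (lam : nat -> nat) : Prop := forall v, v < n -> lam v <= n.+1.

Definition ext (lab lam : nat -> nat) : Prop :=
  forall v, v < n -> lab v != 0 -> lam v = lab v.

Definition feas (lab : nat -> nat) (B : nat) : Prop :=
  exists lam, [/\ rng lam, ext lab lam, valid lam & tcost lam <= B].

(** Here 0 counts as a label too: undecided vertices are separated from all labelled ones by deleted
    vertices. *)
Definition integral (nu : nat -> nat) : Prop :=
  forall u v, u < n -> v < n -> e u v -> nu u != del -> nu v != del -> nu u = nu v.

Definition isol (lab : nat -> nat) (k : nat) : Prop :=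
  exists nu, [/\ rng nu, ext lab nu, integral nu & \sum_(v < n) (nu v == del) <= k].

Lemma prp_del : prp del = false.
Proof. by rewrite /prp /del; lia. Qed.

Lemma prp_cases l : l <= n.+1 -> [\/ l = 0, l = del | prp l].
Proof.
rewrite /prp /del => le; case: (eqVneq l 0) => [->|l0]; first by constructor 1.
case: (eqVneq l n.+1) => [->|l1]; first by constructor 2.
by constructor 3; lia.
Qed.

Lemma prp_neq l : prp l -> (l != 0) * (l != del) * ((l == del) = false) * ((l == 0) = false).
Proof. by rewrite /prp /del => H; split; [split; [split|]|]; lia. Qed.

Lemma nb1P lam v : reflect (exists u, [/\ u < n, e u v & prp (lam u)]) (nb1 lam v).
Proof.
apply: (iffP existsP) => [[u /andP[a b]]|[u [lt a b]]]; first by exists u.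
by exists (Ordinal lt); rewrite a.
Qed.

Lemma nb2P lam v : reflect (exists u w, [/\ u < n /\ w < n, e u v, e w v,
   prp (lam u) /\ prp (lam w) & lam u != lam w]) (nb2 lam v).
Proof.
apply: (iffP existsP) => [[u /existsP[w /and5P[a b c d f]]]|[u [w [[lt1 lt2] a b [c d] f]]]].
  by exists u, w; split.
by exists (Ordinal lt1); apply/existsP; exists (Ordinal lt2); apply/and5P.
Qed.

Lemma nb2_nb1 lam v : nb2 lam v -> nb1 lam v.
Proof. by move=> /nb2P[u [w [[lt1 lt2] a b [c d] f]]]; apply/nb1P; exists u. Qed.

Lemma cost_le2 lam v : cost lam v <= 2.
Proof. by rewrite /cost; case: ifP => // _; case: ifP => // _; case: nb1; case: nb2. Qed.

Lemma cost_prp lam v : prp (lam v) -> cost lam v = 0.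
Proof. by move=> p; rewrite /cost !(prp_neq p). Qed.

Lemma valid_integral nu : integral nu -> valid nu.
Proof. by move=> H u v un vn euv pu pv; apply: H => //; rewrite (prp_neq _). Qed.

(** In an integral solution an undecided vertex has no labelled neighbour, so only the deleted
    vertices cost something, two half-units each. *)
Lemma isol_feas lab k : isol lab k -> feas lab k.*2.
Proof.
move=> [nu [r x i le]]; exists nu; split=> //; first exact: valid_integral.
apply: leq_trans (_ : \sum_(v < n) (nu v == del).*2 <= _).
  apply: leq_sum => v _; rewrite /cost; case: eqP => [//|/eqP nd].
  case: eqP => // v0.
  have E : nb1 nu v = false.
    apply/negbTE/negP => /nb1P[u [un euv pu]].
    have := i u v un (ltn_ord v) euv; rewrite (prp_neq pu) => /(_ isT nd) E.
    by move: pu; rewrite E v0.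
  by rewrite E; case h : (nb2 nu v) => //; move/nb2_nb1: h; rewrite E.
by rewrite -(big_morph double doubleD double0) leq_double.
Qed.

Lemma feas_ext lab lab' B : ext lab lab' -> feas lab' B -> feas lab B.
Proof.
move=> x [lam [r x' v c]]; exists lam; split=> // u un u0.
by rewrite x' ?x.
Qed.

Lemma ext_upd lab v l : lab v = 0 -> ext lab (upd lab v l).
Proof.
by move=> v0 u un u0; rewrite updE; case: eqP => // e'; rewrite e' v0 in u0.
Qed.

Lemma feas_le lab B B' : B <= B' -> feas lab B -> feas lab B'.
Proof. by move=> le [lam [r x v c]]; exists lam; split=> //; apply: leq_trans le. Qed.

Lemma nb1_sub lam lam' v : (forall u, u < n -> prp (lam' u) -> lam u = lam' u) ->
  nb1 lam' v -> nb1 lam v.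
Proof.
by move=> H /nb1P[u [un euv pu]]; apply/nb1P; exists u; rewrite H.
Qed.

Lemma nb2_sub lam lam' v : (forall u, u < n -> prp (lam' u) -> lam u = lam' u) ->
  nb2 lam' v -> nb2 lam v.
Proof.
move=> H /nb2P[u [w [[un wn] eu ew [pu pw] ne]]]; apply/nb2P; exists u, w.
by split=> //; rewrite (H u) // (H w).
Qed.

Lemma nb2_same lam v s : (forall u, u < n -> e u v -> prp (lam u) -> lam u = s) ->
  nb2 lam v = false.
Proof.
move=> H; apply/negbTE/negP => /nb2P[u [w [[un wn] eu ew [pu pw] ne]]].
by move: ne; rewrite (H u) // (H w) // eqxx.
Qed.

(* The exchange argument: [Y] is the set of vertices that must be added to the
   solution when the region labelled by [lam] is kept; optimality of [lam]
   against its restriction to the vertices on which [nu] agrees shows that [Y]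
   is at most as large as the part of the solution that is freed. *)
Lemma persistency lab v l k B :
  lab v = 0 -> prp l -> v < n -> isol lab k ->
  (forall B', B' < B -> ~ feas lab B') -> feas (upd lab v l) B ->
  isol (upd lab v l) k.
Proof.
move=> v0 pl vn [nu [nur nux nui nuk]] nfeas [lam [lamr lamx' lamv lamB]].
have lamx : ext lab lam by move=> u un u0; rewrite lamx' ?ext_upd // -(ext_upd l v0).
pose Y u := [&& ~~ prp (lam u), nu u != del &
  [exists w : 'I_n, [&& e w u, prp (lam w) & lam w != nu u]]].
(* A vertex deleted by [lab] stays deleted, so that [lam'] still extends [lab] and can be compared
   with the minimum [B]. *)
pose lam' u := if prp (lam u) && (nu u == lam u) then lam u
  else if lab u == del then del else 0.
have lam'lam u : prp (lam' u) -> [/\ lam' u = lam u, nu u = lam u & prp (lam u)].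
  rewrite /lam'; case: ifP => [/andP[p /eqP ->] //|_].
  by case: ifP; rewrite ?prp_del.
have lam'r : rng lam'.
  move=> u un; rewrite /lam'; case: ifP => [_|_]; first exact: lamr.
  by case: ifP => // _; rewrite /del.
have lam'x : ext lab lam'.
  move=> u un u0; rewrite /lam' lamx // nux // eqxx andbT.
  have := lamr u un; rewrite lamx // => /prp_cases[E|->|->] //; last by rewrite prp_del eqxx.
  by rewrite E in u0.
have lam'v : valid lam'.
  move=> u w un wn euw /lam'lam[-> _ pu] /lam'lam[-> _ pw]; exact: lamv.
(* Local form of the exchange. A vertex of [Y] becomes cheaper by at least one half-unit, as all its
   neighbours labelled by [lam'] carry the label [nu u] while [lam] shows it another one. A vertex
   that loses its own label pays at most 1, and nothing unless [nu] deletes it. *)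
have ptw u : u < n -> cost lam' u + Y u <= cost lam u + (prp (lam u) && (nu u == del)).
  move=> un.
  have sub w : w < n -> prp (lam' w) -> lam w = lam' w.
    by move=> _ /lam'lam[->].
  case: (boolP (prp (lam u))) => pu; rewrite ?(cost_prp pu) /Y ?pu /= ?addn0.
    rewrite /cost /lam' pu /=; case: (eqVneq (nu u) (lam u)) => [|ne]; first by rewrite !(prp_neq pu).
    have ud : (lab u == del) = false.
      apply/negbTE/negP => /eqP E; have u0 : lab u != 0 by rewrite E.
      by move: pu; rewrite lamx // E prp_del.
    rewrite ud /= -/lam'.
    rewrite (@nb2_same lam' u (lam u)) ?addn0; last first.
      by move=> w wn ewu /lam'lam[-> _ pw]; apply: lamv.
    case: (eqVneq (nu u) del) => [//|nd]; first by case: nb1.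
    rewrite leqn0 eqb0; apply/negP => /nb1P[w [wn ewu /lam'lam[_ E pw]]].
    move: ne; rewrite -(lamv w u) // -E -(nui w u) ?eqxx //.
    by rewrite E (prp_neq pw).
  have l'u : lam' u = if lab u == del then del else 0 by rewrite /lam' (negPf pu).
  case: (boolP (Y u)) => Yu; last first.
    rewrite /Y pu /= in Yu; rewrite (negPf Yu) addn0.
    rewrite /cost l'u; case: (eqVneq (lab u) del) => [E|_].
      by rewrite eqxx lamx ?E ?eqxx.
    rewrite /=; have := lamr u un => /prp_cases[->|->|p]; last by rewrite p in pu.
      rewrite /=; apply: leq_add; first by case: nb1 (@nb1_sub lam lam' u sub) => // ->.
      by case: nb2 (@nb2_sub lam lam' u sub) => // ->.
    by rewrite eqxx; case: nb1; case: nb2.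
  have /and3P[_ nd /existsP[w /and3P[ewu pw ne]]] := Yu.
  have ld : (lab u == del) = false.
    by apply/negbTE/negP => /eqP E; move: nd; rewrite nux ?E ?eqxx.
  have nuu x : x < n -> e x u -> prp (lam' x) -> lam' x = nu u.
    by move=> xn exu /lam'lam[-> E px]; rewrite -E; apply: nui; rewrite ?E ?(prp_neq px).
  have -> : (nu u != del) && [exists w0 : 'I_n, [&& e w0 u, prp (lam w0) & lam w0 != nu u]] = true.
    by rewrite nd /=; apply/existsP; exists w; rewrite ewu pw.
  rewrite /cost l'u ld /= (nb2_same nuu) addn0.
  have nb1u : nb1 lam u by apply/nb1P; exists w.
  have /prp_cases[->|->|p] := lamr u un; last by rewrite p in pu.
    rewrite /= nb1u; case: (boolP (nb1 lam' u)) => [|_]; last by case: nb2.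
    move=> /nb1P[x [xn exu px]]; suff -> : nb2 lam u by [].
    have [E _ px'] := lam'lam _ px; apply/nb2P; exists w, x; split=> //.
    by rewrite -E nuu.
  by rewrite eqxx; case: nb1.
(* The spliced solution: [lam] inside its labelled region, [nu] outside, with [Y] deleted along the
   seam. *)
pose nu' u := if prp (lam u) then lam u else if (nu u == del) || Y u then del else nu u.
have sumY : \sum_(u < n) Y u <= \sum_(u < n) (prp (lam u) && (nu u == del)).
  have S : tcost lam' + \sum_(u < n) Y u <= tcost lam + \sum_(u < n) (prp (lam u) && (nu u == del)).
    by rewrite /tcost -!big_split /=; apply: leq_sum => u _; apply: ptw.
  (* Minimality of [B] enters here: [lam'] is a competitor among the extensions of [lab]. *)
  have : B <= tcost lam'.
    by rewrite leqNgt; apply/negP => lt; apply: (nfeas _ lt); exists lam'.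
  lia.
exists nu'; split.
- move=> u un; rewrite /nu'; case: ifP => _; first exact: lamr.
  by case: ifP => _; [rewrite /del | exact: nur].
- move=> u un u0; rewrite /nu'; have := u0; have El := lamx' u un u0; rewrite El => _.
  case: ifP => // np; have : upd lab v l u <= n.+1 by rewrite -El; apply: lamr.
  case/prp_cases=> [E|E|E]; [by rewrite E in u0| |by rewrite E in np].
  have Eu : lab u = del.
    by move: E; rewrite updE; case: eqP => // _ E; rewrite E prp_del in pl.
  have -> : nu u = del by rewrite nux // Eu.
  by rewrite eqxx E.
- move=> u w un wn euw; rewrite /nu'.
  have key a b : a < n -> b < n -> e a b -> prp (lam a) -> ~~ prp (lam b) ->
      ~~ ((nu b == del) || Y b) -> lam a = nu b.
    move=> an bn eab pa pb; rewrite negb_or => /andP[nd nY].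
    apply/eqP/negPn/negP => ne; case/negP: nY; rewrite /Y pb nd /=.
    by apply/existsP; exists (Ordinal an); rewrite eab pa.
  case: (boolP (prp (lam u))) => pu; case: (boolP (prp (lam w))) => pw.
  + by move=> _ _; apply: lamv.
  + case: ifP => [|/negbT yw]; first by rewrite eqxx.
    by move=> _ _; apply: key.
  + case: ifP => [|/negbT yu]; first by rewrite eqxx.
    by move=> _ _; apply/esym; apply: key => //; rewrite e_sym.
  + case: ifP => [|/negbT yu]; first by rewrite eqxx.
    case: ifP => [|/negbT yw]; first by rewrite eqxx.
    exact: nui.
- suff : \sum_(u < n) (nu' u == del) + \sum_(u < n) (prp (lam u) && (nu u == del)) <=
     \sum_(u < n) (nu u == del) + \sum_(u < n) Y u by lia.
  rewrite -!big_split /=; apply: leq_sum => u _; rewrite /nu'.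
  case: (boolP (prp (lam u))) => pu; first by rewrite !(prp_neq pu) /= leq_addr.
  by case E: (nu u == del) => /=; rewrite ?eqxx ?leq_addr //; case: (Y u); rewrite ?E ?eqxx.
Qed.

(* If no border vertex can be labelled at the current bound, then [lab] itself is
   an optimal half-integral labelling, so deleting a border vertex of cost 1 raises
   the bound. *)
Lemma branching lab w u0 B :
  rng lab -> w < n -> u0 < n -> lab w = 0 -> e u0 w -> prp (lab u0) ->
  ~~ nb2 lab w ->
  (forall B', B' < B -> ~ feas lab B') ->
  (forall u v, u < n -> v < n -> lab v = 0 -> e u v -> prp (lab u) ->
     ~ feas (upd lab v (lab u)) B) ->
  ~ feas (upd lab w del) B.
Proof.
move=> labr wn un w0 ew pu0 nw2 nfeas nb [lam [lamr lamx' lamv lamB]].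
have lamx : ext lab lam by move=> u un' u1; rewrite lamx' ?ext_upd // -(ext_upd del w0).
have sub u : u < n -> prp (lab u) -> lam u = lab u.
  by move=> un' pu; rewrite lamx // (prp_neq pu).
have lw : lam w = del by rewrite lamx' // updE eqxx.
(* If [lam] labelled a border vertex, validity would force the label of its neighbour, and [lam]
   would witness that this label is available at bound [B]. *)
have bord v : v < n -> lab v = 0 -> nb1 lab v -> ~~ prp (lam v).
  move=> vn v0 /nb1P[u [un' euv pu]]; apply/negP => pv.
  apply: (nb u v) => //; exists lam; split=> // x xn; rewrite updE.
  have := lamx x xn; case: (eqVneq x v) => [-> _ _|//].
  by rewrite -(sub u) //; apply/esym; apply: lamv; rewrite ?(sub u).
(* At [w] the labelling [lab] pays at most 1 and [lam] pays 2; elsewhere [lab] is no dearer, since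
   [lam] sees all labels of [lab]. Summing up, [lab] itself would be cheaper than [B]. *)
have ptw v : v < n -> cost lab v + (v == w) <= cost lam v.
  move=> vn; have [vw|vw] /= := eqVneq v w.
    by rewrite vw /cost lw eqxx w0 /= (negPf nw2); case: nb1.
  rewrite addn0; have /prp_cases[v0|vd|pv] := labr v vn; last by rewrite (cost_prp pv).
    case: (boolP (nb1 lab v)) => b1; last first.
      rewrite /cost v0 /= (negPf b1); case E: (nb2 lab v) => //.
      by move/nb2_nb1: E b1 => ->.
    have := bord v vn v0 b1; have /prp_cases[l0|ld|->] := lamr v vn => // _; last first.
      by rewrite [X in _ <= X]/cost ld eqxx cost_le2.
    rewrite /cost v0 l0 /=; apply: leq_add.
      by rewrite b1 (nb1_sub sub b1).
    by case E: (nb2 lab v) => //; rewrite (nb2_sub sub E).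
  by rewrite /cost vd lamx ?vd.
have S : tcost lab + 1 <= tcost lam.
  rewrite /tcost.
  have <- : \sum_(v < n) ((v : nat) == w) = 1.
    rewrite (bigD1 (Ordinal wn)) //= eqxx big1 // => i /eqP ne.
    by case: eqP => // E; case: ne; apply: val_inj.
  by rewrite -big_split /=; apply: leq_sum => v _; apply: ptw.
apply: (nfeas (tcost lab)); first by lia.
exists lab; split=> // u v un' vn euv pu pv; rewrite -(sub u) // -(sub v) //.
by apply: lamv; rewrite // (sub u, sub v).
Qed.

(** Without border vertices the labelled regions are already closed off by deleted vertices, so
    [lab] is a solution as it stands. Feasibility only has to bound the number of vertices deleted
    by [lab], each of which costs 2 in every extension. *)
Lemma feas_final lab k : rng lab ->
  (forall u v, u < n -> v < n -> lab v = 0 -> e u v -> ~~ prp (lab u)) ->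
  feas lab k.*2 -> isol lab k.
Proof.
move=> labr nb [lam [lamr lamx lamv lamB]].
exists lab; split=> // [u v un vn euv ud vd|].
  have /prp_cases[u0|uD|pu] := labr u un; last 2 first.
  - by rewrite uD eqxx in ud.
  - have /prp_cases[v0|vD|pv] := labr v vn; last 2 first.
    + by rewrite vD eqxx in vd.
    + have u0 := prp_neq pu; have v0 := prp_neq pv.
      rewrite -(lamx u) ?u0 // -(lamx v) ?v0 //.
      by apply: lamv => //; [rewrite (lamx u) ?u0 | rewrite (lamx v) ?v0].
    + by move: (nb u v un vn v0 euv); rewrite pu.
  have /prp_cases[v0|vD|pv] := labr v vn.
  - by rewrite u0 v0.
  - by rewrite vD eqxx in vd.
  - by move: (nb v u vn un u0); rewrite e_sym euv pv => /(_ isT).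
rewrite -leq_double (big_morph double doubleD double0); apply: leq_trans lamB.
apply: leq_sum => v _; case: eqP => // E; rewrite /cost lamx //; first by rewrite E eqxx.
by rewrite E.
Qed.

(** Neighbours with two different labels force the vertex between them into every solution. *)
Lemma isol_del lab v k : v < n -> lab v = 0 -> nb2 lab v -> isol lab k ->
  isol (upd lab v del) k.
Proof.
move=> vn v0 /nb2P[u [w [[un wn] eu ew [pu pw] ne]]] [nu [r x i s]].
have vd : nu v = del.
  apply/eqP/negP => nd; have u0 := prp_neq pu; have w0 := prp_neq pw.
  have eu' : nu u = lab u by rewrite x ?u0.
  have ew' : nu w = lab w by rewrite x ?w0.
  move/negP: nd => nd; move: ne; rewrite -eu' -ew' (i u v) ?eu' ?u0 //.
  by rewrite (i w v) ?ew' ?w0 ?eqxx.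
exists nu; split=> // y yn; rewrite updE.
by have := x y yn; case: (eqVneq y v) => [-> _ _|//].
Qed.

Lemma isol_branch lab u v k : u < n -> v < n -> lab v = 0 -> e u v -> prp (lab u) ->
  isol lab k -> isol (upd lab v del) k \/ isol (upd lab v (lab u)) k.
Proof.
move=> un vn v0 euv pu [nu [r x i s]].
case: (eqVneq (nu v) del) => vd; [left|right]; exists nu; split=> // y yn; rewrite updE;
  have := x y yn; case: (eqVneq y v) => [-> _ _|//] //.
have u0 := prp_neq pu; have eu' : nu u = lab u by rewrite x ?u0.
by rewrite -(i u v) ?eu' ?u0.
Qed.
End Labelling.

(** * Rounding integer potentials to labellings *)

Lemma sum_interval N lo hi : \sum_(i < N) (lo <= i < hi) <= minn hi N - lo.
Proof.
elim: N => [|N IH]; rewrite ?big_ord0 // big_ord_recr /=.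
apply: leq_trans (leq_add IH (leqnn _)) _.
by case: (boolP (lo <= N < hi)) => h /=; lia.
Qed.

Section Rounding.
Variables (n : nat) (e : rel nat) (lab : nat -> nat) (Z : nat -> nat -> nat) (B Q : nat).
Hypothesis labr : rng n lab.
Local Notation del := (del n).
Local Notation prp := (prp n).

(* [Z l v] approximates [Q] times the distance from label [l] to [v], capped at 2, and [Z del v]
   approximates [Q] times the cost of [v]. *)
Record approx : Prop := Approx {
  ap_lab : forall v, v < n -> lab v != 0 -> Z (lab v) v = if lab v == del then Q.*2 else 0;
  ap_arc : forall l u v, l < n.+1 -> u < n -> v < n -> e u v ->
    Z l v <= Z l u + Z del v + 1;
  ap_pair : forall l l' v, l < l' -> l' < n.+1 -> v < n ->
    Q.*2 + Z del v <= Z l v + Z l' v + 1;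
  ap_sum : \sum_(v < n) Z del v <= B * Q + n }.

(* Averaging the cost of these labellings over the radii [th] yields one that is cheap enough. *)
Definition ball (th v : nat) : nat :=
  if lab v == del then del else
  if [pick l : 'I_n.+1 | (0 < l) && (Z l v <= th)] is Some l then l : nat else 0.

Hypothesis ap : approx.

Lemma ap_pair' l l' v : l != l' -> prp l -> prp l' -> v < n ->
  Q.*2 + Z del v <= Z l v + Z l' v + 1.
Proof.
rewrite /prp => ne p p' vn; case: (ltngtP l l') ne => // lt _.
  by apply: ap_pair => //; lia.
by rewrite [Z l v + _]addnC; apply: ap_pair => //; lia.
Qed.

Lemma ball_prp th v : prp (ball th v) -> Z (ball th v) v <= th /\ lab v != del.
Proof.
rewrite /ball; case: eqP => [_|_]; first by rewrite prp_del.
by case: pickP => [l /andP[_ le]|].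
Qed.

(** For radii below [Q] the pair constraint makes the balls of different labels disjoint, so the
    choice in [ball] is unique. *)
Lemma ball_eq th v l : th < Q -> v < n -> lab v != del -> prp l -> Z l v <= th ->
  ball th v = l.
Proof.
move=> thQ vn nd pl le; rewrite /ball (negPf nd).
have ln : l < n.+1 by move: pl; rewrite /prp; lia.
case: pickP => [l' /andP[p' le']|/(_ (Ordinal ln))]; last first.
  by rewrite /= le andbT; move: pl; rewrite /prp; lia.
apply/eqP/negPn/negP => ne.
have := @ap_pair' l' l v ne _ pl vn; rewrite /prp p' -ltnS ltn_ord => /(_ isT).
lia.
Qed.

Lemma ball0 th v l : ball th v = 0 -> prp l -> th < Z l v.
Proof.
rewrite /ball; case: eqP => [_|_]; first by rewrite /del.
case: pickP => [l' /andP[p' _] E|H _ pl]; first by rewrite E in p'.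
have ln : l < n.+1 by move: pl; rewrite /prp; lia.
have := H (Ordinal ln); rewrite /=; move: pl; rewrite /prp; lia.
Qed.

Lemma ball_rng th : rng n (ball th).
Proof.
move=> v vn; rewrite /ball; case: ifP => // _; case: pickP => // l _.
by rewrite ltnW.
Qed.

Lemma ball_ext th : th < Q -> ext n lab (ball th).
Proof.
move=> thQ v vn v0; case: (eqVneq (lab v) del) => [E|nd].
  by rewrite /ball E eqxx.
have := labr vn => /prp_cases[E|E|p]; [by rewrite E in v0|by rewrite E eqxx in nd|].
by apply: ball_eq => //; rewrite (ap_lab ap) // (negPf nd).
Qed.

(** The arc constraint brings the label of [u] within [th + Z del v + 1] of [v]. If [v] has another
    label, the pair constraint then yields [2Q <= 2 th + 2], which fails for [th < Q - 1]. *)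
Lemma ball_valid th : th < Q.-1 -> valid n e (ball th).
Proof.
move=> thQ u v un vn euv pu pv; apply/eqP/negPn/negP => ne.
have [le1 _] := ball_prp pu; have [le2 _] := ball_prp pv.
have h1 := ap_pair' ne pu pv vn.
have h2 : Z (ball th u) v <= Z (ball th u) u + Z del v + 1.
  by apply: ap_arc => //; move: pu; rewrite /prp; lia.
lia.
Qed.

(** Let [a] be the distance of an undecided vertex to its nearest label and [d] its potential cost.
    It pays only for radii below [a]: a first half-unit from [a - d - 1] on, a second one from
    [2Q - a - 2] on, by the pair constraint. The latter number and [a] are symmetric about [Q - 1],
    where the radii stop, so what the second interval gains the first has lost, and [d] plus a
    constant remains. *)
Lemma ball_cost v : v < n -> \sum_(th < Q.-1) cost n e (ball th) v <= Z del v + 3.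
Proof.
move=> vn; have := labr vn => /prp_cases[E|E|p].
- have n0 : 0 < n by lia.
  pose l1 : 'I_n := [arg min_(l < Ordinal n0) Z l.+1 v].
  have min1 l : prp l -> Z l1.+1 v <= Z l v.
    rewrite /l1; case: arg_minnP => // i _ H; rewrite /prp => pl.
    have ln : l.-1 < n by lia.
    by have := H (Ordinal ln) isT; rewrite /= prednK //; lia.
  have p1 : prp l1.+1 by rewrite /prp ltn_ord.
  set a := Z l1.+1 v in min1; set d := Z del v.
  (* The second half-unit has a maximum as its lower end because it presupposes the first. *)
  apply: (@leq_trans (\sum_(th < Q.-1) ((a - d.+1 <= th < a) +
       (maxn (a - d.+1) (Q.*2 - a.+2) <= th < a)))); last first.
    rewrite big_split /=; apply: leq_trans (leq_add (sum_interval _ _ _) (sum_interval _ _ _)) _.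
    lia.
  apply: leq_sum => th _; have thQ := ltn_ord th.
  rewrite /cost; case: eqP => [Ed|_].
    by have := @ball_rng th v vn; move: Ed; rewrite /ball E /=; case: pickP => // l _ El;
      have := ltn_ord l; rewrite El /del ltnn.
  case: eqP => // b0.
  have tha : th < a by apply: (ball0 b0).
  have near u : u < n -> e u v -> prp (ball th u) -> Z (ball th u) v <= th + d + 1.
    move=> un euv pu; have [le1 _] := ball_prp pu.
    have : Z (ball th u) v <= Z (ball th u) u + Z del v + 1.
      by apply: ap_arc => //; move: pu; rewrite /prp; lia.
    by rewrite -/d; lia.
  apply: leq_add.
    case: nb1P => // -[u [un euv pu]].
    have := near u un euv pu; have := min1 _ pu; lia.
  case: nb2P => // -[u [w [[un wn] eu ew [pu pw] ne]]].
  have [x [xn ex px nx]] : exists x, [/\ x < n, e x v, prp (ball th x) & ball th x != l1.+1].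
    case: (eqVneq (ball th u) l1.+1) => [E1|]; last by exists u.
    by exists w; split=> //; rewrite -E1 eq_sym.
  have := near x xn ex px; have := min1 _ px; have := ap_pair' nx px p1 vn.
  by rewrite -/a -/d; lia.
- apply: (@leq_trans (\sum_(th < Q.-1) 2)); first by apply: leq_sum => th _; apply: cost_le2.
  rewrite sum_nat_const card_ord; have := ap_lab ap vn; rewrite E eqxx => -> //; lia.
- rewrite big1 // => th _; apply: cost_prp.
  by rewrite ball_ext ?(prp_neq p) //; have := ltn_ord th; lia.
Qed.

(** If each of the [Q - 1] radii cost at least [B + 1], the total would be at least
    [(B + 1)(Q - 1)]. By [ball_cost] it is at most [BQ + 4n]: the tolerance [n] of [ap_sum] and 3
    for each vertex. The hypothesis on [Q] is exactly what separates the two. *)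
Lemma rounding : 4 * n + B + 1 < Q -> feas n e lab B.
Proof.
move=> Qbig.
suff [th le] : exists th : 'I_Q.-1, tcost n e (ball th) <= B.
  have thQ := ltn_ord th; exists (ball th); split=> //.
  - exact: ball_rng.
  - by apply: ball_ext; lia.
  - exact: ball_valid.
case: (boolP [exists th : 'I_Q.-1, tcost n e (ball th) <= B]) => [/existsP //|].
rewrite negb_exists => /forallP H; exfalso.
have S1 : \sum_(th < Q.-1) B.+1 <= \sum_(th < Q.-1) tcost n e (ball th).
  by apply: leq_sum => th _; rewrite ltnNge; apply: H.
have S2 : \sum_(th < Q.-1) tcost n e (ball th) <= \sum_(v < n) (Z del v + 3).
  by rewrite /tcost exchange_big /=; apply: leq_sum => v _; apply: ball_cost.
move: (leq_trans S1 S2) (ap_sum ap); rewrite big_split /= !sum_nat_const !card_ord.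
by case: Q Qbig => // q Qbig; move: (\sum_(v < n) _) => S; nia.
Qed.
End Rounding.

(** * Exact potentials of a labelling and the squared distance to them *)

Section Potential.
Variables (n : nat) (e : rel nat) (Q : nat).
Hypothesis e_sym : forall u v, e u v = e v u.
Local Notation del := (del n).
Local Notation prp := (prp n).

Definition other (lam : nat -> nat) (l v : nat) : bool :=
  [exists u : 'I_n, [&& e u v, prp (lam u) & lam u != l]].

(* The exact solution, in units of [Q], that a labelling induces for the constraints [approx]. *)
Definition zs (lam : nat -> nat) (l v : nat) : nat :=
  if l == del then cost n e lam v else
  if prp l && (lam v == l) then 0 else
  if (lam v == 0) && ~~ other lam l v then 1 else 2.

Lemma zs_le2 lam l v : zs lam l v <= 2.
Proof. by rewrite /zs; case: ifP => _; [exact: cost_le2|case: ifP => // _; case: ifP]. Qed.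

(** The triangle inequality for distances in which entering a vertex costs its weight. For [l = 0]
    the distance is to a label that no vertex carries, so the loops of the program may start at row
    0. *)
Lemma zs_arc lam l u v : rng n lam -> valid n e lam -> l < n.+1 -> u < n -> v < n -> e u v ->
  zs lam l v <= zs lam l u + zs lam del v.
Proof.
move=> lamr lamv ln un vn euv; rewrite /zs eqxx.
have -> : (l == del) = false by rewrite /del; lia.
case: ifP => [//|Hv].
have [/andP[pl /eqP lu]|Hu] := boolP (prp l && (lam u == l)).
  have nv1 : nb1 n e lam v by apply/nb1P; exists u; split=> //; rewrite lu.
  have /prp_cases[v0|vd|pv] := lamr v vn.
  - rewrite /cost v0 /= nv1.
    case: (boolP (other lam l v)) => [/existsP[w /and3P[ew pw nw]]|]; last by [].
    have -> : nb2 n e lam v.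
      by apply/nb2P; exists u, w; split; rewrite ?lu //; rewrite eq_sym.
    by [].
  - by rewrite /cost vd eqxx; case: (_ && _).
  - by move: Hv; rewrite (lamv v u) ?lu // 1?e_sym // pl eqxx.
have [/andP[/eqP v0 ov]|Hv2] := ifP; first by case: ifP => _; lia.
case: ifP => [/andP[/eqP u0 ou]|_]; last by lia.
have /prp_cases[v0|vd|pv] := lamr v vn.
- move: Hv2; rewrite v0 /= => /negbFE /existsP[w /and3P[ew pw _]].
  have -> : cost n e lam v = nb1 n e lam v + nb2 n e lam v by rewrite /cost v0.
  have -> : nb1 n e lam v by apply/nb1P; exists w.
  by [].
- by rewrite /cost vd eqxx.
- case/negP: ou; apply/existsP; exists (Ordinal vn); rewrite /= e_sym euv pv /=.
  by apply/negP => /eqP E; rewrite -E pv eqxx in Hv.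
Qed.

(** Each half-unit paid by an undecided vertex means that one more of the two labels is blocked by a
    differently labelled neighbour, and a blocked label is at distance 2 instead of 1. *)
Lemma zs_pair lam l l' v : rng n lam -> l < l' -> l' < n.+1 -> v < n ->
  2 + zs lam del v <= zs lam l v + zs lam l' v.
Proof.
move=> lamr ll ln vn; rewrite /zs eqxx.
have -> : (l == del) = false by rewrite /del; lia.
have -> : (l' == del) = false by rewrite /del; lia.
have /prp_cases[v0|vd|pv] := lamr v vn.
- have pn m : prp m && (lam v == m) = false by rewrite v0 /prp; lia.
  rewrite !pn v0 /= /cost v0 /=.
  case: nb1P => [[u [un eu pu]]|nn1]; last first.
    have -> : nb2 n e lam v = false by apply/negbTE/negP => /nb2_nb1 /nb1P.
    by case: ifP; case: ifP.
  case: nb2P => [[x [w [[xn wn] ex ew [px pw] ne]]]|nn2].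
    have ot m : other lam m v.
      case: (eqVneq (lam x) m) => [E|ne']; apply/existsP.
        by exists (Ordinal wn); rewrite /= ew pw eq_sym -E.
      by exists (Ordinal xn); rewrite /= ex px.
    by rewrite !ot.
  case: (eqVneq (lam u) l) => [E|ne].
    have -> : other lam l' v.
      by apply/existsP; exists (Ordinal un); rewrite /= eu pu E; lia.
    by case: ifP.
  have -> : other lam l v by apply/existsP; exists (Ordinal un); rewrite /= eu pu.
  by case: ifP.
- have pn m : prp m && (lam v == m) = false.
    by case: (eqVneq (lam v) m) => [<-|_]; rewrite ?andbF // vd prp_del.
  have d0 : (del == 0) = false by [].
  by rewrite !pn vd d0 /= /cost vd eqxx.
- rewrite (cost_prp _ pv) !(prp_neq pv) /=.
  case: (eqVneq (lam v) l) => [E|_]; first by rewrite -E pv /=; case: ifP; lia.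
  by rewrite andbF; case: ifP.
Qed.

Open Scope ring_scope.

(* Every correction of a violated constraint decreases this squared distance, which bounds the
   number of sweeps of the feasibility test. *)
Definition phi (lam : nat -> nat) (Z : nat -> nat -> nat) : int :=
  \sum_(l < n.+2) \sum_(v < n) ((Z l v)%:Z - (Q * zs lam l v)%N%:Z) ^+ 2.

Definition upd2 (Z : nat -> nat -> nat) l v x := upd Z l (upd (Z l) v x).

Lemma sum_upd N (F : nat -> nat -> int) (f : nat -> nat) j y : (j < N)%N ->
  \sum_(i < N) F i (upd f j y i) = \sum_(i < N) F i (f i) - F j (f j) + F j y.
Proof.
move=> jN; rewrite (bigD1 (Ordinal jN)) //= [in RHS](bigD1 (Ordinal jN)) //= updE eqxx.
rewrite (eq_bigr (fun i : 'I_N => F i (f i))); first by ring.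
by move=> i /eqP ne; rewrite updE; case: eqP => // E; case: ne; apply: val_inj.
Qed.

Lemma phi_upd lam Z l v x : (l < n.+2)%N -> (v < n)%N ->
  phi lam (upd2 Z l v x) = phi lam Z - ((Z l v)%:Z - (Q * zs lam l v)%N%:Z) ^+ 2
     + (x%:Z - (Q * zs lam l v)%N%:Z) ^+ 2.
Proof.
move=> ln vn; rewrite /phi (bigD1 (Ordinal ln)) //= [in RHS](bigD1 (Ordinal ln)) //=.
rewrite {1}/upd2.
under eq_bigr => w _ do rewrite updE eqxx.
rewrite (sum_upd (fun w y => (y%:Z - (Q * zs lam l w)%N%:Z) ^+ 2) _ _ vn).
rewrite (eq_bigr (fun i : 'I_n.+2 => \sum_(v0 < n) ((Z i v0)%:Z - (Q * zs lam i v0)%N%:Z) ^+ 2)).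
  by ring.
move=> i /eqP ne; apply: eq_bigr => w _; rewrite /upd2 updE.
by case: eqP => // E; case: ne; apply: val_inj.
Qed.

(** A unit move changes a square by its linear term plus 1. At the cap nothing moves, but the target
    is at most [2Q], so the linear term is nonnegative there and the bound persists; [phi_dec]
    treats 0 in the same way. *)
Lemma phi_inc lam Z l v : (l < n.+2)%N -> (v < n)%N -> (Z l v <= Q.*2)%N ->
  phi lam (upd2 Z l v (if (Z l v < Q.*2)%N then (Z l v).+1 else Z l v)) <=
  phi lam Z + 2 * ((Z l v)%:Z - (Q * zs lam l v)%N%:Z) + 1.
Proof.
move=> ln vn zl; rewrite phi_upd //; have := zs_le2 lam l v.
move: (zs _ _ _) => z z2; have : (Q * z <= Q.*2)%N by rewrite -muln2 leq_mul2l z2 orbT.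
move: (Q * z)%N => t tl; set p := phi _ _; move: p => p; case: ltnP => lt; last by lia.
move: (Z l v) lt {zl} => a lt; rewrite -[a.+1]addn1 PoszD; nia.
Qed.

Lemma phi_dec lam Z l v : (l < n.+2)%N -> (v < n)%N ->
  phi lam (upd2 Z l v (Z l v).-1) <=
  phi lam Z - 2 * ((Z l v)%:Z - (Q * zs lam l v)%N%:Z) + 1.
Proof.
move=> ln vn; rewrite phi_upd //; move: (Q * zs _ _ _)%N => t.
case: (Z l v) => [|a] /=; first by lia.
rewrite -[a.+1]addn1 PoszD; nia.
Qed.

Lemma phi_ge0 lam Z : 0 <= phi lam Z.
Proof. by apply: sumr_ge0 => l _; apply: sumr_ge0 => v _; apply: sqr_ge0. Qed.

Lemma phi_le lam Z : (forall l v, (l < n.+2)%N -> (v < n)%N -> (Z l v <= Q.*2)%N) ->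
  phi lam Z <= (n.+2 * (n * (Q.*2 * Q.*2)))%N%:Z.
Proof.
move=> zb; have -> : (n.+2 * (n * (Q.*2 * Q.*2)))%N%:Z =
    \sum_(l < n.+2) \sum_(v < n) (Q.*2 * Q.*2)%N%:Z :> int.
  by rewrite !sumr_const !card_ord -mulrnA -mulr_natr natz -PoszM; congr Posz; ring.
apply: ler_sum => l _; apply: ler_sum => v _.
have := zb l v (ltn_ord l) (ltn_ord v); have := zs_le2 lam l v.
move: (zs _ _ _) (Z l v) => z a z2 al.
have : (Q * z <= Q.*2)%N by rewrite -muln2 leq_mul2l z2 orbT.
by move: (Q * z)%N => t tl; nia.
Qed.
End Potential.

(** * The feasibility test *)

Declare Scope hl_scope.
Delimit Scope hl_scope with hl.
Notation "p ;; q" := (HSeq p q) (at level 61, right associativity) : hl_scope.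
Bind Scope hl_scope with hl.
Open Scope hl_scope.

(* Arrays: 0 is the adjacency matrix, 1 the initial labels, 2 the current labels, 3 the potentials
   (row [n + 1] holds the costs), 4 the branching bits. *)
Notation vT := 0 (only parsing).
Notation vm := 1 (only parsing).
Notation v0 := 2 (only parsing).
Notation vn := 3 (only parsing).
Notation vn1 := 4 (only parsing).
Notation vn2 := 5 (only parsing).
Notation vk1 := 6 (only parsing).
Notation vq2 := 7 (only parsing).
Notation vq := 8 (only parsing).
Notation vh := 9 (only parsing).
Notation v1 := 10 (only parsing).
Notation vB := 11 (only parsing).
Notation vfd := 12 (only parsing).
Notation vo := 13 (only parsing).
Notation vl := 14 (only parsing).
Notation vu := 15 (only parsing).
Notation vv := 16 (only parsing).
Notation vl' := 17 (only parsing).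
Notation vi1 := 18 (only parsing).
Notation vi2 := 19 (only parsing).
Notation vx := 20 (only parsing).
Notation vy := 21 (only parsing).
Notation vz := 22 (only parsing).
Notation va := 23 (only parsing).
Notation vs := 24 (only parsing).
Notation vc := 25 (only parsing).
Notation vi := 26 (only parsing).
Notation vj := 27 (only parsing).

Definition hadd x y t := HFor t y (HInc x).
Definition hif x p := HLt v0 x p HSkip.
Definition hone x := HZero x ;; HInc x.
Definition hdec l v := HRd va 3 l v ;; HDec va ;; HWr 3 l v va.
Definition hinc l v := HRd va 3 l v ;; HLt va vq2 (HInc va) HSkip ;; HWr 3 l v va.

Definition Proj := HFor vv vn (HRd va 2 vv v0 ;;
  hif va (HLt va vn1 (HWr 3 va vv v0) (HWr 3 vn1 vv vq2))).

(** The two increments of [vy] set the tolerance: only violations by at least 2 are corrected.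
    [pair_body] uses the same margin. *)
Definition arc_body := HRd vx 0 vu vv ;;
  hif vx (HRd vx 3 vl vv ;; HRd vy 3 vl vu ;; HRd vz 3 vn1 vv ;; hadd vy vz vi ;;
    HInc vy ;; HInc vy ;;
    HLt vx vy HSkip (hdec vl vv ;; hinc vl vu ;; hinc vn1 vv ;; HZero vo)).

Definition Arc := HFor vl vn1 (HFor vu vn (HFor vv vn arc_body)).

Definition pair_body :=
  HLt vl vl' (HRd vx 3 vl vv ;; HRd vy 3 vl' vv ;; HRd vz 3 vn1 vv ;; hadd vx vy vi ;;
    HInc vx ;; HInc vx ;; hadd vz vq2 vi ;;
    HLt vz vx HSkip (hinc vl vv ;; hinc vl' vv ;; hdec vn1 vv ;; HZero vo))
      HSkip.

Definition Pair := HFor vl vn1 (HFor vl' vn1 (HFor vv vn pair_body)).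

(** Its correction lowers [n] entries at once and so pays [n] for the squares; hence the tolerance
    [n] instead of 1. *)
Definition Sum := HZero vs ;; HFor vv vn (HRd vz 3 vn1 vv ;; hadd vs vz vi) ;;
  HZero vc ;; HFor vi vB (hadd vc vq vj) ;; hadd vc vn vi ;; HInc vc ;;
  HLt vs vc HSkip (HFor vv vn (hdec vn1 vv) ;; HZero vo).

Definition Sweep := hone vo ;; Proj ;; Arc ;; Pair ;; Sum ;; hif vo (hone vfd).

(** The number of sweeps needed exceeds what one saturating variable can count, hence two nested
    loops for [T * T] sweeps. *)
Definition Oracle := HZero vfd ;; HFor vl vn2 (HFor vv vn (HWr 3 vl vv v0)) ;;
  HFor vi1 vT (HFor vi2 vT Sweep).

Section ExecLemmas.
Variable inp : nat -> option bool.
Local Notation exec := (exec inp).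

(** The frame conditions of the body are supplied here once and for all, so that an invariant has to
    mention only what the body changes. *)
Lemma exec_for_ind (I : nat -> hst -> Prop) x b p s :
  x \notin mods p -> b \notin x :: mods p -> I 0 s ->
  (forall i s', i < hv s b -> I i s' ->
     (forall y, y \notin x :: mods p -> hv s' y = hv s y) ->
     (forall a, a \notin amods p -> hm s' a = hm s a) ->
     I i.+1 (exec p (setv s' x i))) ->
  (forall i s' j, I i s' -> I i (setv s' x j)) ->
  I (hv s b) (exec (HFor x b p) s).
Proof.
move=> xp; rewrite inE negb_or => /andP[bx bp] I0 IS Iset; rewrite /=; apply: (Iset).
set F := foldl _ s; suff H k : k <= hv s b -> [/\ I k (F (iota 0 k)),
    (forall y, y \notin x :: mods p -> hv (F (iota 0 k)) y = hv s y) &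
    (forall a, a \notin amods p -> hm (F (iota 0 k)) a = hm s a)].
  by case: (H _ (leqnn _)).
elim: k => [|k IH] le; first by split.
have [Ik Fv Fm] := IH (ltnW le).
have -> : F (iota 0 k.+1) = exec p (setv (F (iota 0 k)) x k).
  by rewrite /F -(addn1 k) iotaD foldl_cat.
split; first exact: IS.
- move=> y; rewrite inE negb_or => /andP[yx yp].
  by rewrite exec_mods //= updE (negPf yx) Fv // inE negb_or yx.
- by move=> a ap; rewrite exec_amods //= Fm.
Qed.

Lemma exec_hadd x y t s : x != t -> y != t -> y != x -> x != 0 -> t != 0 ->
  hv s x <= hv s 0 ->
  hv (exec (hadd x y t) s) x = minn (hv s 0) (hv s x + hv s y).
Proof.
move=> xt yt yx x0 t0 le.
have x0' : (0 == x) = false by rewrite eq_sym (negPf x0).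
have t0' : (0 == t) = false by rewrite eq_sym (negPf t0).
suff [] : hv (exec (hadd x y t) s) x = minn (hv s 0) (hv s x + hv s y) /\
   hv (exec (hadd x y t) s) 0 = hv s 0 by [].
apply: (exec_for_ind (I := fun i s' => hv s' x = minn (hv s 0) (hv s x + i) /\
   hv s' 0 = hv s 0)).
- by rewrite inE eq_sym.
- by rewrite !inE negb_or yt.
- by split=> //; lia.
- move=> i s' _ [E E0] _ _; rewrite /= !updE (negPf xt) t0' E E0.
  case: ifP => lt /=; rewrite ?updE ?eqxx ?x0' ?updE ?t0' ?(negPf xt) E0 ?E;
    by split=> //; lia.
- by move=> i s' j [E E0]; rewrite /= !updE (negPf xt) t0'.
Qed.
End ExecLemmas.

Lemma execS inp p q s : exec inp (p ;; q) s = exec inp q (exec inp p s).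
Proof. by []. Qed.
Lemma execLt inp x y p q s :
  exec inp (HLt x y p q) s = if hv s x < hv s y then exec inp p s else exec inp q s.
Proof. by []. Qed.
Lemma execIf inp x p s :
  exec inp (hif x p) s = if hv s v0 < hv s x then exec inp p s else s.
Proof. by []. Qed.
Lemma execRd inp z a x y s : exec inp (HRd z a x y) s = setv s z (hm s a (hv s x) (hv s y)).
Proof. by []. Qed.
Lemma execWr inp a x y z s : exec inp (HWr a x y z) s = setm s a (hv s x) (hv s y) (hv s z).
Proof. by []. Qed.
Lemma execZero inp x s : exec inp (HZero x) s = setv s x 0.
Proof. by []. Qed.
Lemma execDec inp x s : exec inp (HDec x) s = setv s x (hv s x).-1.
Proof. by []. Qed.
Lemma execInc inp x s : exec inp (HInc x) s =
  if hv s x < hv s 0 then setv s x (hv s x).+1 else s.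
Proof. by []. Qed.
Lemma execIn inp x p q s : exec inp (HIn x p q) s =
  if inp (hv s x) == Some true then exec inp p s else exec inp q s.
Proof. by []. Qed.
Lemma execSkip inp s : exec inp HSkip s = s.
Proof. by []. Qed.
#[global] Opaque exec.
Definition execE := (execS, execLt, execIf, execRd, execWr, execZero, execDec, execInc, execSkip).

Lemma hv_setv s x i y : hv (setv s x i) y = if y == x then i else hv s y.
Proof. by []. Qed.
Lemma hm_setv s x i : hm (setv s x i) = hm s.
Proof. by []. Qed.
Lemma hv_setm s a x y z : hv (setm s a x y z) = hv s.
Proof. by []. Qed.
Lemma hm_setm s a x y z b : hm (setm s a x y z) b =
  if b == a then upd2 (hm s a) x y z else hm s b.
Proof. by []. Qed.
Definition stE := (hv_setv, hm_setv, hv_setm, hm_setm).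

Lemma exec_hone inp x s : x != 0 -> 0 < hv s 0 ->
  hv (exec inp (hone x) s) x = 1.
Proof.
move=> x0 p; have x0' : (0 == x) = false by rewrite eq_sym (negPf x0).
by rewrite /hone !execE !stE eqxx x0' p !stE eqxx.
Qed.

(** * Correctness of the feasibility test *)

Section Oracle.
Variables (inp : nat -> option bool) (n : nat) (e : rel nat) (Q B T : nat) (lab : nat -> nat).
Hypothesis e_sym : forall u v, e u v = e v u.
Hypothesis e_irr : forall v, e v v = false.
Hypothesis labr : rng n lab.
Hypothesis Q_large : 4 * n + B + 1 < Q.
Hypothesis T_six : 6 * Q + 2 <= T.
Hypothesis T_sum : n * Q.*2 <= T.
Hypothesis T_bud : B * Q + n + 1 <= T.
Hypothesis T_iter : n.+2 * (n * (Q.*2 * Q.*2)) < T * T.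
Local Notation exec := (exec inp).
Local Notation del := (del n).

(* [Q] scales the potentials; the bounds on [T] keep all sums below saturation. *)
Record okc (s : hst) : Prop := Okc {
  okT : hv s vT = T; ok0 : hv s v0 = 0; okn : hv s vn = n; okn1 : hv s vn1 = n.+1;
  okn2 : hv s vn2 = n.+2; okq2 : hv s vq2 = Q.*2; okq : hv s vq = Q; okB : hv s vB = B;
  okadj : forall u v, u < n -> v < n -> (0 < hm s 0 u v) = e u v;
  oklab : forall v, v < n -> hm s 2 v 0 = lab v }.

Definition keeps (p : hl) : bool :=
  [&& all (fun y => y \notin mods p) [:: vT; v0; vn; vn1; vn2; vq2; vq; vB],
      0 \notin amods p & 2 \notin amods p].

Lemma okc_exec p s : keeps p -> okc s -> okc (exec p s).
Proof.
case/and3P=> /allP kv k0 k2 [*]; split; rewrite ?exec_mods ?kv //.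
  by move=> u v un vn; rewrite exec_amods //; auto.
by move=> v vn; rewrite exec_amods //; auto.
Qed.

Lemma okc_setv x i s : x \notin [:: vT; v0; vn; vn1; vn2; vq2; vq; vB] -> okc s -> okc (setv s x i).
Proof.
rewrite !inE !negb_or => nx [*].
by split; rewrite ?stE //; case: eqP => // E; rewrite -E in nx.
Qed.

Definition box (s : hst) := forall l v, l < n.+2 -> v < n -> hm s 3 l v <= Q.*2.

Definition good (lam : nat -> nat) :=
  [/\ rng n lam, ext n lab lam, valid n e lam & tcost n e lam <= B].

Local Notation phi := (phi n e Q).

(* [vo] is reset to 0 whenever a correction is made, so it stays 1 exactly if no constraint was
   violated. *)
Definition improves (s s' : hst) : Prop :=
  [/\ hv s' vo <= hv s vo, hv s' vo = 1 -> hm s' 3 = hm s 3, box s' &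
    forall lam, good lam ->
     (phi lam (hm s' 3) + (hv s vo - hv s' vo)%N%:Z <= phi lam (hm s 3))%R].

(** [gv] pins the enclosing loop variables. [C] is the constraint that the piece [p] checks; it is
    claimed only if nothing had to be corrected. *)
Definition sweeps (gv : seq (nat * nat)) (p : hl) (C : (nat -> nat -> nat) -> Prop) : Prop :=
  forall s, okc s -> box s -> hv s vo <= 1 -> all (fun q => hv s q.1 == q.2) gv ->
  improves s (exec p s) /\ (hv (exec p s) vo = 1 -> C (hm (exec p s) 3)).

Lemma improves_refl s : box s -> improves s s.
Proof. by move=> b; split=> // lam _; rewrite subnn addr0. Qed.

Lemma improves_trans s1 s2 s3 : hv s1 vo <= 1 -> improves s1 s2 -> improves s2 s3 -> improves s1 s3.
Proof.
move=> o1 [a1 b1 c1 d1] [a2 b2 c2 d2]; split=> //; first exact: leq_trans a1.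
  by move=> E; rewrite b2 // b1 //; lia.
move=> lam g; have := d1 lam g; have := d2 lam g; lia.
Qed.

Lemma gv_exec gv p s : all (fun q => q.1 \notin mods p) gv ->
  all (fun q : nat * nat => hv s q.1 == q.2) gv -> all (fun q => hv (exec p s) q.1 == q.2) gv.
Proof.
move=> /allP h1 /allP h2; apply/allP => q qin; rewrite exec_mods ?h2 //; exact: h1.
Qed.

(** If the flag is still 1 at the end, the second piece left the potentials alone, so what the first
    piece verified holds for the final array as well. *)
Lemma sweeps_seq gv p q (C D : (nat -> nat -> nat) -> Prop) :
  keeps p -> all (fun q => q.1 \notin mods p) gv ->
  sweeps gv p C -> sweeps gv q D -> sweeps gv (p ;; q) (fun Z => C Z /\ D Z).
Proof.
move=> kp gp Hp Hq s ok b o1 g; rewrite execS.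
have [R1 c1] := Hp s ok b o1 g; have [a1 b1 x1 d1] := R1.
have [|R2 c2] := Hq (exec p s) (okc_exec kp ok) x1 _ (gv_exec gp g).
  exact: leq_trans o1.
split; first exact: improves_trans R1 R2.
move=> o3; split; last exact: c2.
have [a2 b2 x2 d2] := R2; rewrite b2 //; apply: c1; lia.
Qed.

Lemma sweeps_for gv x b N p (C : nat -> (nat -> nat -> nat) -> Prop) :
  x \notin [:: vT; v0; vn; vn1; vn2; vq2; vq; vB; vo] ->
  x \notin mods p -> b \notin x :: mods p -> keeps p ->
  all (fun q => q.1 \notin x :: mods p) gv ->
  (forall s, okc s -> hv s b = N) ->
  (forall i, i < N -> sweeps ((x, i) :: gv) p (C i)) ->
  sweeps gv (HFor x b p) (fun Z => forall i, i < N -> C i Z).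
Proof.
move=> xk xp bp kp gp EN H s ok bs o1 g.
have [ok' [R' C']] : okc (exec (HFor x b p) s) /\ improves s (exec (HFor x b p) s) /\
  (hv (exec (HFor x b p) s) vo = 1 -> forall i, i < hv s b -> C i (hm (exec (HFor x b p) s) 3)).
  have xk' : x \notin [:: vT; v0; vn; vn1; vn2; vq2; vq; vB].
    by apply: contra xk; rewrite !inE; do !case/orP=> [->|]; rewrite ?orbT //; move=> ->; rewrite ?orbT.
  have xo : (vo == x) = false.
    by apply/negbTE; apply: contra xk => /eqP <-.
  apply: (exec_for_ind (I := fun i s' => okc s' /\ improves s s' /\
    (hv s' vo = 1 -> forall j, j < i -> C j (hm s' 3)))) => //.
  - by split=> //; split; [exact: improves_refl|].
  - move=> i s' iN [ok1 [R1 C1]] Fv Fm; rewrite EN // in iN.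
    have [a1 b1 c1 d1] := R1.
    have [||||R2 C2] := H i iN (setv s' x i).
    + exact: okc_setv.
    + exact: c1.
    + by rewrite stE xo; exact: leq_trans o1.
    + rewrite /= updE !eqxx /=; apply/allP => q qin; have := allP gp q qin.
      rewrite inE negb_or => /andP[qx qp]; rewrite updE (negPf qx) Fv ?inE ?negb_or ?qx //.
      exact: (allP g).
    have R1' : improves s (setv s' x i) by split; rewrite ?stE ?xo.
    split; first by apply: okc_exec => //; apply: okc_setv.
    split; first exact: improves_trans R1' R2.
    move=> o3 j; rewrite ltnS leq_eqVlt => /orP[/eqP ->|ji]; first exact: C2.
    have [a2 b2 c2 d2] := R2; rewrite b2 // stE; apply: C1 => //.
    by rewrite stE xo in a2; lia.
  - move=> i s' j [ok1 [R1 C1]]; split; first exact: okc_setv.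
    by have [a1 b1 c1 d1] := R1; split; [split|]; rewrite ?stE ?xo.
by split=> // o3 i iN; apply: C' => //; rewrite EN.
Qed.

Definition decz (Z : nat -> nat -> nat) l v := upd2 Z l v (Z l v).-1.
Definition incz (Z : nat -> nat -> nat) l v :=
  upd2 Z l v (if Z l v < Q.*2 then (Z l v).+1 else Z l v).
Definition boxz (Z : nat -> nat -> nat) := forall l v, l < n.+2 -> v < n -> Z l v <= Q.*2.

Lemma upd2E Z l v x l' v' : upd2 Z l v x l' v' =
  if (l' == l) && (v' == v) then x else Z l' v'.
Proof. by rewrite /upd2 updE; case: eqP => [->|] //; rewrite updE. Qed.

Lemma boxz_upd Z l v x : boxz Z -> x <= Q.*2 -> boxz (upd2 Z l v x).
Proof. by move=> b xl l' v' ln vn; rewrite upd2E; case: ifP => // _; apply: b. Qed.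

Lemma boxz_decz Z l v : boxz Z -> l < n.+2 -> v < n -> boxz (decz Z l v).
Proof. by move=> b ln vn; apply: boxz_upd => //; have := b l v ln vn; lia. Qed.

Lemma boxz_incz Z l v : boxz Z -> l < n.+2 -> v < n -> boxz (incz Z l v).
Proof. by move=> b ln vn; apply: boxz_upd => //; case: ifP => // _; apply: b. Qed.

(** The three entries are distinct, by irreflexivity and [l < del], so the moves add up. The exact
    solution satisfies the constraint without error, so the linear terms give at most [-4] and the
    squares at most 3. *)
Lemma arc_phi Z l u v lam : boxz Z -> l < n.+1 -> u < n -> v < n -> e u v -> good lam ->
  Z l u + Z del v + 2 <= Z l v ->
  (phi lam (incz (incz (decz Z l v) l u) del v) + 1 <= phi lam Z)%R.
Proof.
move=> bz ln un vn euv [lr lx lv lB] viol.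
have ln2 : l < n.+2 by rewrite ltnW.
have dn2 : del < n.+2 by [].
have b1 := boxz_decz bz ln2 vn.
have b2 := boxz_incz b1 ln2 un.
have uv : (u == v) = false by apply/negbTE/negP => /eqP E; rewrite E e_irr in euv.
have ld : (del == l) = false by rewrite /del; lia.
have e1 : decz Z l v l u = Z l u by rewrite /decz upd2E uv andbF.
have e2 : incz (decz Z l v) l u del v = Z del v by rewrite /incz /decz !upd2E ld.
have h1 := phi_dec e Q lam Z ln2 vn.
have h2 := phi_inc e lam ln2 un (b1 _ _ ln2 un).
have h3 := phi_inc e lam dn2 vn (b2 _ _ dn2 vn).
rewrite -/(decz Z l v) in h1; rewrite -/(incz _ l u) e1 in h2; rewrite -/(incz _ del v) e2 in h3.
have hz := zs_arc e_sym lr lv ln un vn euv.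
have : Q * zs n e lam l v <= Q * zs n e lam l u + Q * zs n e lam del v.
  by rewrite -mulnDr leq_mul2l hz orbT.
lia.
Qed.

Lemma pair_phi Z l l' v lam : boxz Z -> l < l' -> l' < n.+1 -> v < n -> good lam ->
  Z l v + Z l' v + 2 <= Z del v + Q.*2 ->
  (phi lam (decz (incz (incz Z l v) l' v) del v) + 1 <= phi lam Z)%R.
Proof.
move=> bz ll ln vn [lr lx lv lB] viol.
have ln2 : l' < n.+2 by rewrite ltnW.
have ln2' : l < n.+2 by lia.
have dn2 : del < n.+2 by [].
have b1 := boxz_incz bz ln2' vn.
have ll' : (l' == l) = false by lia.
have ld : (del == l) = false by rewrite /del; lia.
have ld' : (del == l') = false by rewrite /del; lia.
have e1 : incz Z l v l' v = Z l' v by rewrite /incz upd2E ll'.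
have e2 : incz (incz Z l v) l' v del v = Z del v.
  by rewrite /incz upd2E ld' /= upd2E ld.
have h1 := phi_inc e lam ln2' vn (bz _ _ ln2' vn).
have h2 := phi_inc e lam ln2 vn (b1 _ _ ln2 vn).
have h3 := phi_dec e Q lam (incz (incz Z l v) l' v) dn2 vn.
rewrite -/(incz Z l v) in h1; rewrite -/(incz _ l' v) e1 in h2; rewrite -/(decz _ del v) e2 in h3.
have hz := zs_pair e lr ll ln vn.
have : Q * 2 + Q * zs n e lam del v <= Q * zs n e lam l v + Q * zs n e lam l' v.
  by rewrite -!mulnDr leq_mul2l hz orbT.
lia.
Qed.

Lemma hm_hdec l v s : v != va -> l != va ->
  hm (exec (hdec l v) s) 3 = decz (hm s 3) (hv s l) (hv s v).
Proof.
move=> nv nl; rewrite /hdec !execE !stE !eqxx.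
by rewrite (negPf nv) (negPf nl).
Qed.

Lemma hm_hinc l v s : okc s -> box s -> v != va -> l != va -> hv s l < n.+2 -> hv s v < n ->
  hm (exec (hinc l v) s) 3 = incz (hm s 3) (hv s l) (hv s v).
Proof.
rewrite /incz.
move=> ok b nv nl ln vn'; have le := b _ _ ln vn'.
rewrite /hinc execS execRd execS execLt execWr; set X := hm s 3 _ _ in le *.
have -> : hv (setv s va X) va = X by [].
have -> : hv (setv s va X) vq2 = Q.*2 by rewrite stE /= (okq2 ok).
case: ifP => lt; last by rewrite execSkip !stE !eqxx (negPf nv) (negPf nl).
have -> : exec (HInc va) (setv s va X) = setv (setv s va X) va X.+1.
  rewrite execInc.
  have -> : hv (setv s va X) va = X by [].
  have -> : hv (setv s va X) 0 = T by rewrite stE /= (okT ok).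
  by rewrite ifT //; lia.
by rewrite !stE !eqxx (negPf nv) (negPf nl).
Qed.

Lemma exec_Inc x s : hv s x < hv s 0 -> exec (HInc x) s = setv s x (hv s x).+1.
Proof. by move=> lt; rewrite execInc lt. Qed.

Lemma box_boxz s : box s = boxz (hm s 3). Proof. by []. Qed.

Lemma improves_same s s' : box s -> hm s' 3 = hm s 3 -> hv s' vo = hv s vo -> improves s s'.
Proof.
move=> b E Eo; split; rewrite ?Eo //; first by rewrite box_boxz E.
by move=> lam _; rewrite subnn addr0 E.
Qed.

Lemma improves_viol s s' : hv s vo <= 1 -> hv s' vo = 0 -> box s' ->
  (forall lam, good lam -> (phi lam (hm s' 3) + 1 <= phi lam (hm s 3))%R) -> improves s s'.
Proof.
move=> o1 o0 b H; split=> //; rewrite ?o0 //.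
move=> lam g; have := H lam g; lia.
Qed.

Lemma gv3 s a x a' x' a'' x'' :
  all (fun q => hv s q.1 == q.2) [:: (a, x); (a', x'); (a'', x'')] ->
  [/\ hv s a = x, hv s a' = x' & hv s a'' = x''].
Proof. by case/and4P => /eqP ? /eqP ? /eqP ? _. Qed.

Lemma sweeps_arc l u v : l < n.+1 -> u < n -> v < n ->
  sweeps [:: (vv, v); (vu, u); (vl, l)] arc_body
    (fun Z => e u v -> Z l v <= Z l u + Z del v + 1).
Proof.
move=> ln un vn' s ok b o1 /gv3[Ev Eu El].
have ln2 : l < n.+2 by rewrite ltnW.
rewrite /arc_body execS execRd execIf.
set s1 := setv s vx _.
have ok1 : okc s1 by apply: okc_setv.
rewrite (ok0 ok1); have -> : hv s1 vx = hm s 0 u v by rewrite /s1 stE Ev Eu.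
rewrite (okadj ok) //; case: ifP => euv; last by split=> //; apply: improves_same.
rewrite execS execRd; set s2 := setv s1 vx _.
have ok2 : okc s2 by apply: okc_setv.
rewrite execS execRd; set s3 := setv s2 vy _.
have ok3 : okc s3 by apply: okc_setv.
rewrite execS execRd; set s4 := setv s3 vz _.
have ok4 : okc s4 by apply: okc_setv.
have b_lu := b l u ln2 un. have b_lv := b l v ln2 vn'. have b_dv := b del v (ltnSn _) vn'.
have x4 : hv s4 vx = hm s 3 l v by rewrite -El -Ev.
have y4 : hv s4 vy = hm s 3 l u by rewrite -El -Eu.
have dE : del = hv s vn1 := esym (okn1 ok).
have z4 : hv s4 vz = hm s 3 del v by rewrite dE -Ev.
have m4 : hm s4 3 = hm s 3 by [].
have l4 : hv s4 vl = l := El.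
have u4 : hv s4 vu = u := Eu.
have w4 : hv s4 vv = v := Ev.
have o4 : hv s4 vo = hv s vo by [].
clearbody s4.
rewrite execS; have y5 := @exec_hadd inp vy vz vi s4 isT isT isT isT isT.
set s5 := exec (hadd vy vz vi) s4 in y5 *.
have ok5 : okc s5 by apply: okc_exec.
have F5 q : q \notin [:: vy; vi] -> hv s5 q = hv s4 q.
  by rewrite !inE negb_or => /andP[q1 q2]; rewrite /s5 exec_mods // !inE negb_or q1 q2.
have m5 : hm s5 3 = hm s4 3 by rewrite /s5 exec_amods.
clearbody s5.
rewrite (okT ok4) y4 z4 in y5.
have {}y5 : hv s5 vy = hm s 3 l u + hm s 3 del v by rewrite y5; lia.
rewrite execS exec_Inc; last by rewrite y5 (okT ok5); lia.
set s6 := setv s5 vy _.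
have y6 : hv s6 vy = (hm s 3 l u + hm s 3 del v).+1 by rewrite -y5.
have ok6 : okc s6 by apply: okc_setv.
rewrite execS exec_Inc; last by rewrite y6 (okT ok6); lia.
set s7 := setv s6 vy _.
have ok7 : okc s7 by apply: okc_setv.
have y7 : hv s7 vy = (hm s 3 l u + hm s 3 del v).+2 by rewrite -y6.
have F q : q \notin [:: vy; vi] -> hv s7 q = hv s4 q.
  rewrite !inE negb_or => /andP[q1 q2].
  by rewrite /s7 /s6 !hv_setv (negPf q1) F5 // !inE negb_or q1 q2.
have m7 : hm s7 3 = hm s 3 by rewrite /s7 /s6 !hm_setv m5 m4.
clearbody s7.
rewrite execLt y7 F // x4; case: ltnP => viol.
  by split; [apply: improves_same => //; rewrite execSkip F|move=> _ _; rewrite execSkip m7; lia].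
rewrite execS execS execS execZero.
set s8 := exec (hdec vl vv) s7; set s9 := exec (hinc vl vu) s8; set s10 := exec (hinc vn1 vv) s9.
have l7 : hv s7 vl = l by rewrite F.
have u7 : hv s7 vu = u by rewrite F.
have w7 : hv s7 vv = v by rewrite F.
have m8 : hm s8 3 = decz (hm s 3) l v by rewrite hm_hdec // l7 w7 m7.
have ok8 : okc s8 by apply: okc_exec.
have ok9 : okc s9 by apply: okc_exec.
have b8 : box s8 by rewrite box_boxz m8; apply: boxz_decz.
have l8 : hv s8 vl = l by rewrite exec_mods.
have u8 : hv s8 vu = u by rewrite exec_mods.
have w9 : hv s9 vv = v by rewrite exec_mods // exec_mods.
have m9 : hm s9 3 = incz (decz (hm s 3) l v) l u by rewrite hm_hinc // ?l8 ?u8 ?m8.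
have b9 : box s9 by rewrite box_boxz m9; apply: boxz_incz => //; apply: boxz_decz.
have m10 : hm s10 3 = incz (incz (decz (hm s 3) l v) l u) del v.
  by rewrite hm_hinc // ?w9 ?(okn1 ok9) ?m9.
split; last by [].
apply: improves_viol => //.
  by rewrite box_boxz stE m10; apply: boxz_incz => //; rewrite -m9.
move=> lam g; rewrite stE m10; apply: arc_phi => //; lia.
Qed.

Lemma sweeps_pair l l' v : l < n.+1 -> l' < n.+1 -> v < n ->
  sweeps [:: (vv, v); (vl', l'); (vl, l)] pair_body
    (fun Z => l < l' -> Q.*2 + Z del v <= Z l v + Z l' v + 1).
Proof.
move=> ln ln' vn' s ok b o1 /gv3[Ev Eu El].
have ln2 : l < n.+2 by rewrite ltnW.
have ln2' : l' < n.+2 by rewrite ltnW.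
rewrite /pair_body execLt El Eu; case: ifP => ll; last by split=> //; apply: improves_same.
rewrite execS execRd; set s2 := setv s vx _.
have ok2 : okc s2 by apply: okc_setv.
rewrite execS execRd; set s3 := setv s2 vy _.
have ok3 : okc s3 by apply: okc_setv.
rewrite execS execRd; set s4 := setv s3 vz _.
have ok4 : okc s4 by apply: okc_setv.
have b_lu := b l' v ln2' vn'. have b_lv := b l v ln2 vn'. have b_dv := b del v (ltnSn _) vn'.
have x4 : hv s4 vx = hm s 3 l v by rewrite -El -Ev.
have y4 : hv s4 vy = hm s 3 l' v by rewrite -Eu -Ev.
have dE : del = hv s vn1 := esym (okn1 ok).
have z4 : hv s4 vz = hm s 3 del v by rewrite dE -Ev.
have m4 : hm s4 3 = hm s 3 by [].
have l4 : hv s4 vl = l := El.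
have u4 : hv s4 vl' = l' := Eu.
have w4 : hv s4 vv = v := Ev.
have o4 : hv s4 vo = hv s vo by [].
clearbody s4.
rewrite execS; have y5 := @exec_hadd inp vx vy vi s4 isT isT isT isT isT.
set s5 := exec (hadd vx vy vi) s4 in y5 *.
have ok5 : okc s5 by apply: okc_exec.
have F5 q : q \notin [:: vx; vi] -> hv s5 q = hv s4 q.
  by rewrite !inE negb_or => /andP[q1 q2]; rewrite /s5 exec_mods // !inE negb_or q1 q2.
have m5 : hm s5 3 = hm s4 3 by rewrite /s5 exec_amods.
clearbody s5.
rewrite (okT ok4) x4 y4 in y5.
have {}y5 : hv s5 vx = hm s 3 l v + hm s 3 l' v by rewrite y5; lia.
rewrite execS exec_Inc; last by rewrite y5 (okT ok5); lia.
set s6 := setv s5 vx _.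
have y6 : hv s6 vx = (hm s 3 l v + hm s 3 l' v).+1 by rewrite -y5.
have ok6 : okc s6 by apply: okc_setv.
rewrite execS exec_Inc; last by rewrite y6 (okT ok6); lia.
set s7 := setv s6 vx _.
have ok7 : okc s7 by apply: okc_setv.
have y7 : hv s7 vx = (hm s 3 l v + hm s 3 l' v).+2 by rewrite -y6.
have F q : q \notin [:: vx; vi] -> hv s7 q = hv s4 q.
  rewrite !inE negb_or => /andP[q1 q2].
  by rewrite /s7 /s6 !hv_setv (negPf q1) F5 // !inE negb_or q1 q2.
have m7 : hm s7 3 = hm s 3 by rewrite /s7 /s6 !hm_setv m5 m4.
clearbody s7.
have z7 : hv s7 vz = hm s 3 del v by rewrite F.
rewrite execS; have zt := @exec_hadd inp vz vq2 vi s7 isT isT isT isT isT.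
set t := exec (hadd vz vq2 vi) s7 in zt *.
have okt : okc t by apply: okc_exec.
rewrite (okT ok7) z7 (okq2 ok7) in zt.
have {}zt : hv t vz = hm s 3 del v + Q.*2 by rewrite zt; lia.
have xt : hv t vx = (hm s 3 l v + hm s 3 l' v).+2 by rewrite exec_mods.
have mt : hm t 3 = hm s 3 by rewrite exec_amods.
have Ft q : q \notin [:: vx; vi; vz] -> hv t q = hv s4 q.
  rewrite !inE !negb_or => /and3P[q1 q2 q3].
  by rewrite /t exec_mods ?F // !inE !negb_or ?q1 ?q2 ?q3.
clearbody t.
rewrite execLt xt zt; case: ltnP => viol.
  by split; [apply: improves_same => //; rewrite execSkip Ft|move=> _ _; rewrite execSkip mt; lia].
rewrite execS execS execS execZero.
set s8 := exec (hinc vl vv) t; set s9 := exec (hinc vl' vv) s8; set s10 := exec (hdec vn1 vv) s9.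
have l7 : hv t vl = l by rewrite Ft.
have u7 : hv t vl' = l' by rewrite Ft.
have w7 : hv t vv = v by rewrite Ft.
have bt : box t by rewrite box_boxz mt.
have m8 : hm s8 3 = incz (hm s 3) l v by rewrite hm_hinc // ?l7 ?w7 ?mt.
have ok8 : okc s8 by apply: okc_exec.
have ok9 : okc s9 by apply: okc_exec.
have b8 : box s8 by rewrite box_boxz m8; apply: boxz_incz.
have l8 : hv s8 vl' = l' by rewrite exec_mods.
have w8 : hv s8 vv = v by rewrite exec_mods.
have w9 : hv s9 vv = v by rewrite exec_mods.
have m9 : hm s9 3 = incz (incz (hm s 3) l v) l' v by rewrite hm_hinc // ?l8 ?w8 ?m8.
have b9 : box s9 by rewrite box_boxz m9; apply: boxz_incz => //; apply: boxz_incz.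
have m10 : hm s10 3 = decz (incz (incz (hm s 3) l v) l' v) del v.
  by rewrite hm_hdec // w9 (okn1 ok9) m9.
split; last by [].
apply: improves_viol => //.
  by rewrite box_boxz stE m10; apply: boxz_decz => //; rewrite -m9.
move=> lam g; rewrite stE m10; apply: pair_phi => //; lia.
Qed.

Lemma sum_body s : okc s -> boxz (hm s 3) ->
  hv (exec (HFor vv vn (HRd vz 3 vn1 vv ;; hadd vs vz vi)) (setv s vs 0)) vs =
  \sum_(v < n) hm s 3 del v.
Proof.
move=> ok b; have E := okn ok.
have := @exec_for_ind inp (fun i s' => hv s' vs = \sum_(v < i) hm s 3 del v) vv vn
  (HRd vz 3 vn1 vv ;; hadd vs vz vi) (setv s vs 0) isT isT.
have -> : hv (setv s vs 0) vn = n by [].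
apply.
- by rewrite big_ord0.
- move=> i s' iN Es Fv Fm.
  have s0 : hv s' 0 = T by rewrite Fv // (okT ok : hv (setv s vs 0) 0 = T).
  have sn1 : hv s' vn1 = del by rewrite Fv // (okn1 ok : hv (setv s vs 0) vn1 = del).
  have m3 : hm s' 3 = hm s 3 by rewrite Fm.
  rewrite execS execRd; set t := setv _ _ _.
  have tz : hv t vz = hm s 3 del i by rewrite -m3 -sn1.
  have ts : hv t vs = hv s' vs by [].
  have t0 : hv t 0 = T by [].
  clearbody t.
  have bsum : \sum_(v < i.+1) hm s 3 del v <= n * Q.*2.
    apply: (@leq_trans (\sum_(v < i.+1) Q.*2)).
      by apply: leq_sum => v _; apply: b => //; have := ltn_ord v; lia.
    by rewrite sum_nat_const card_ord leq_mul2r iN orbT.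
  rewrite big_ord_recr /= in bsum *.
  have bs2 := leq_trans bsum T_sum.
  have := @exec_hadd inp vs vz vi t isT isT isT isT isT.
  rewrite t0 ts tz Es => ->; first exact: (minn_idPr bs2).
  by apply: leq_trans bs2; apply: leq_addr.
- by [].
Qed.

Lemma bud_body s : okc s ->
  hv (exec (HFor vi vB (hadd vc vq vj)) (setv s vc 0)) vc = B * Q.
Proof.
move=> ok; have E := okB ok.
have := @exec_for_ind inp (fun i s' => hv s' vc = i * Q) vi vB
  (hadd vc vq vj) (setv s vc 0) isT isT.
have -> : hv (setv s vc 0) vB = B by [].
apply.
- by [].
- move=> i s' iN Es Fv Fm.
  have s0 : hv s' 0 = T by rewrite Fv // (okT ok : hv (setv s vc 0) 0 = T).
  have sn1 : hv s' vq = Q by rewrite Fv // (okq ok : hv (setv s vc 0) vq = Q).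
  set t := setv _ _ _.
  have tz : hv t vq = Q by [].
  have ts : hv t vc = hv s' vc by [].
  have t0 : hv t 0 = T by [].
  clearbody t.
  have bd : i.+1 * Q <= B * Q by rewrite leq_mul2r iN orbT.
  have := @exec_hadd inp vc vq vj t isT isT isT isT isT.
  by rewrite t0 ts tz Es => ->; lia.
- by [].
Qed.

Lemma dec_body s : okc s -> boxz (hm s 3) ->
  let s' := exec (HFor vv vn (hdec vn1 vv)) s in
  boxz (hm s' 3) /\ forall lam, good lam ->
   (phi lam (hm s' 3) <= phi lam (hm s 3) -
     2 * ((\sum_(v < n) hm s 3 del v)%N%:Z - (Q * tcost n e lam)%N%:Z) + n%:Z)%R.
Proof.
move=> ok b s'.
suff [] : [/\ boxz (hm s' 3), forall v, n <= v -> v < n -> hm s' 3 del v = hm s 3 del v &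
   forall lam, good lam ->
   (phi lam (hm s' 3) <= phi lam (hm s 3) -
     2 * ((\sum_(v < n) hm s 3 del v)%N%:Z - (Q * \sum_(v < n) zs n e lam del v)%N%:Z) + n%:Z)%R].
  move=> b' _ H; split=> // lam g; have := H lam g.
  have -> // : tcost n e lam = \sum_(v < n) zs n e lam del v.
  by apply: eq_bigr => v _; rewrite /zs eqxx.
(* The clause that later entries are untouched lets the single decrements be summed in terms of the
   original potentials. *)
have := @exec_for_ind inp (fun i s' => [/\ boxz (hm s' 3),
   forall v, i <= v -> v < n -> hm s' 3 del v = hm s 3 del v &
   forall lam, good lam ->
   (phi lam (hm s' 3) <= phi lam (hm s 3) -
     2 * ((\sum_(v < i) hm s 3 del v)%N%:Z - (Q * \sum_(v < i) zs n e lam del v)%N%:Z) + i%:Z)%R])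
  vv vn (hdec vn1 vv) s isT isT.
rewrite (okn ok); apply.
- by split=> // lam _; rewrite !big_ord0 muln0 subrr mulr0 subr0 addr0.
- move=> i t iN [bt Et Pt] Fv Fm.
  have tn1 : hv (setv t vv i) vn1 = del by rewrite stE /= Fv // (okn1 ok).
  have tv : hv (setv t vv i) vv = i by [].
  rewrite hm_hdec // tn1 tv hm_setv; split.
  + exact: boxz_decz.
  + move=> v iv vn'; rewrite /decz upd2E eqxx /= ifF ?Et //; lia.
  + move=> lam g; have := Pt lam g; have := @phi_dec n e Q lam (hm t 3) del i (ltnSn _) iN.
    rewrite -/(decz _ _ _) Et // !big_ord_recr /= mulnDr.
    by move: (\sum_(_ < _) _) (\sum_(_ < _) _) => a c; lia.
- by [].
Qed.

Lemma sweeps_sum : sweeps [::] Sum (fun Z => \sum_(v < n) Z del v <= B * Q + n).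
Proof.
move=> s ok b o1 _; rewrite /Sum execS execZero execS.
have E1 := sum_body ok b.
set s1 := exec _ _ in E1 *.
have ok1 : okc s1 by apply: okc_exec => //; apply: okc_setv.
have m1 : hm s1 3 = hm s 3 by rewrite exec_amods.
have o1' : hv s1 vo = hv s vo by rewrite exec_mods.
clearbody s1.
rewrite execS execZero execS; have E2 := bud_body ok1.
set s2 := exec _ _ in E2 *.
have ok2 : okc s2 by apply: okc_exec => //; apply: okc_setv.
have m2 : hm s2 3 = hm s 3 by rewrite exec_amods.
have o2' : hv s2 vo = hv s vo by rewrite exec_mods.
have S2 : hv s2 vs = hv s1 vs by rewrite exec_mods.
clearbody s2.
rewrite execS; have E3 := @exec_hadd inp vc vn vi s2 isT isT isT isT isT.
set s3 := exec _ _ in E3 *.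
have ok3 : okc s3 by apply: okc_exec.
have m3 : hm s3 3 = hm s 3 by rewrite exec_amods.
have o3' : hv s3 vo = hv s vo by rewrite exec_mods.
have S3 : hv s3 vs = hv s1 vs by rewrite exec_mods.
clearbody s3; rewrite (okT ok2) E2 (okn ok2) in E3.
have {}E3 : hv s3 vc = B * Q + n by rewrite E3; lia.
rewrite execS exec_Inc; last by rewrite E3 (okT ok3); lia.
set s4 := setv s3 vc _.
have ok4 : okc s4 by apply: okc_setv.
have E4 : hv s4 vc = B * Q + n + 1 by rewrite addn1 -E3.
have m4 : hm s4 3 = hm s 3 by [].
have o4' : hv s4 vo = hv s vo by [].
have S4 : hv s4 vs = hv s1 vs by [].
clearbody s4; rewrite execLt E4 S4 E1; case: ltnP => viol.
  by rewrite execSkip; split; [apply: improves_same|rewrite m4; move: viol; lia].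
have b4 : boxz (hm s4 3) by rewrite m4.
rewrite execS execZero; have [b5 P5] := dec_body ok4 b4.
set s5 := exec _ s4 in b5 P5 *; clearbody s5.
split; last by [].
apply: improves_viol => //.
move=> lam g; have := P5 lam g; rewrite stE m4.
have [_ _ _ lB] := g; have : Q * tcost n e lam <= B * Q by rewrite mulnC leq_mul2r lB orbT.
by move: viol; move: (\sum_(_ < _) _) => a; lia.
Qed.

(** All extensions of [lab] have the same exact value at the coordinate of a label already given.
    Setting it to this value removes a nonnegative term from every squared distance. *)
Lemma proj_spec s : okc s -> boxz (hm s 3) ->
  let s' := exec Proj s in
  [/\ boxz (hm s' 3),
    forall v, v < n -> lab v != 0 -> hm s' 3 (lab v) v = if lab v == del then Q.*2 else 0 &
    forall lam, good lam -> (phi lam (hm s' 3) <= phi lam (hm s 3))%R].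
Proof.
move=> ok b s'.
have := @exec_for_ind inp (fun i s' => [/\ boxz (hm s' 3),
   forall v, v < i -> lab v != 0 -> hm s' 3 (lab v) v = if lab v == del then Q.*2 else 0 &
   forall lam, good lam -> (phi lam (hm s' 3) <= phi lam (hm s 3))%R])
  vv vn (HRd va 2 vv v0 ;; hif va (HLt va vn1 (HWr 3 va vv v0) (HWr 3 vn1 vv vq2)))
  s isT isT.
rewrite (okn ok); apply.
- by split.
- move=> i t iN [bt Et Pt] Fv Fm.
  rewrite execS execRd execIf; set u := setv _ va _.
  have u0 : hv u v0 = 0 := etrans (Fv v0 isT) (ok0 ok).
  have ua : hv u va = lab i.
    by have -> : hv u va = hm t 2 i (hv t v0) by []; rewrite Fm // Fv // (ok0 ok) (oklab ok).
  have un1 : hv u vn1 = del := etrans (Fv vn1 isT) (okn1 ok).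
  have uq2 : hv u vq2 = Q.*2 := etrans (Fv vq2 isT) (okq2 ok).
  have uv : hv u vv = i by [].
  have um : hm u 3 = hm t 3 by [].
  clearbody u; rewrite u0 ua; case: ltnP => l0; last first.
    rewrite um; split=> // v; rewrite ltnS leq_eqVlt => /orP[/eqP -> |]; last exact: Et.
    by case: (lab i) l0.
  have new Z' a x : Z' = upd2 (hm t 3) a i x -> x = (if lab i == del then Q.*2 else 0) -> a = lab i ->
    [/\ boxz Z',
      forall v : nat, v < i.+1 -> lab v != 0 -> Z' (lab v) v = (if lab v == del then Q.*2 else 0)
    & forall lam, good lam -> (phi lam Z' <= phi lam (hm s 3))%R].
    move=> -> Ex Ea; split.
    + by apply: boxz_upd => //; rewrite Ex; case: ifP.
    + move=> v; rewrite ltnS leq_eqVlt => /orP[/eqP -> _|vi' v0']; first by rewrite upd2E Ea !eqxx Ex.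
      by rewrite upd2E [v == i]ltn_eqF // andbF Et.
    + move=> lam g; apply: le_trans (Pt lam g).
      have al : a < n.+2 by rewrite Ea ltnS; apply: labr.
      rewrite phi_upd //; have [lr lx lv lB] := g.
      have Elam : lam i = lab i by rewrite lx // -lt0n.
      have -> : Q * zs n e lam a i = x.
        rewrite Ex Ea /zs; case: (eqVneq (lab i) del) => [E|nd].
          by rewrite /cost Elam E eqxx muln2.
        rewrite Elam eqxx andbT; have /prp_cases[E|E|->] := labr iN; last by rewrite muln0.
          by rewrite E in l0.
        by rewrite E eqxx in nd.
      by rewrite subrr expr0n /= addr0 lerBlDr lerDl sqr_ge0.
  rewrite execLt ua un1; case: ltnP => l1; rewrite execWr hm_setm /=.
    rewrite ua uv u0 um; apply: new => //.
    by case: eqP => // E; rewrite E ltnn in l1.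
  have E1 : lab i = del by apply/eqP; rewrite eqn_leq l1 andbT; apply: labr.
  rewrite un1 uv uq2 um; apply: new => //; by rewrite E1 eqxx.
- by [].
Qed.
Lemma sweep_spec s : okc s -> box s ->
  let s' := exec Sweep s in
  [/\ okc s', box s' &
   (hv s' vfd = 1 /\ feas n e lab B) \/
   (hv s' vfd = hv s vfd /\
    forall lam, good lam -> (phi lam (hm s' 3) + 1 <= phi lam (hm s 3))%R)].
Proof.
move=> ok b s'; rewrite /s' /Sweep execS.
have T0 : 0 < T by lia.
have o1 : hv (exec (hone vo) s) vo = 1 by apply: exec_hone; rewrite ?(okT ok).
set s1 := exec _ s in o1 *.
have ok1 : okc s1 by apply: okc_exec.
have m1 : hm s1 3 = hm s 3 by rewrite exec_amods.
have f1 : hv s1 vfd = hv s vfd by rewrite exec_mods.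
clearbody s1; rewrite execS.
have [|b2 c2 d2] := proj_spec ok1; first by rewrite m1.
set s2 := exec Proj s1 in b2 c2 d2 *.
have ok2 : okc s2 by apply: okc_exec.
have f2 : hv s2 vfd = hv s vfd by rewrite exec_mods.
have o2 : hv s2 vo = 1 by rewrite exec_mods.
clearbody s2.
have PA : sweeps [::] Arc (fun Z => forall l, l < n.+1 -> forall u, u < n -> forall v, v < n ->
    e u v -> Z l v <= Z l u + Z del v + 1).
  apply: sweeps_for => // [t okt|l ln]; first by rewrite (okn1 okt).
  apply: sweeps_for => // [t okt|u un]; first by rewrite (okn okt).
  apply: sweeps_for => // [t okt|v vn']; first by rewrite (okn okt).
  exact: sweeps_arc.
have PP : sweeps [::] Pair (fun Z => forall l, l < n.+1 -> forall l', l' < n.+1 -> forall v, v < n ->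
    l < l' -> Q.*2 + Z del v <= Z l v + Z l' v + 1).
  apply: sweeps_for => // [t okt|l ln]; first by rewrite (okn1 okt).
  apply: sweeps_for => // [t okt|u un]; first by rewrite (okn1 okt).
  apply: sweeps_for => // [t okt|v vn']; first by rewrite (okn okt).
  exact: sweeps_pair.
have kA : keeps Arc by []. have kP : keeps Pair by [].
have PS := @sweeps_seq [::] _ _ _ _ kA isT PA (@sweeps_seq [::] _ _ _ _ kP isT PP sweeps_sum).
have [|R3 C3] := PS s2 ok2 b2 _ isT; first by rewrite o2.
rewrite (_ : exec _ s2 = exec (hif vo (hone vfd)) (exec (Arc;; Pair;; Sum) s2)); last first.
  by rewrite !execS.
set s3 := exec (Arc;; Pair;; Sum) s2 in R3 C3 *.
have ok3 : okc s3 by apply: okc_exec.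
have f3 : hv s3 vfd = hv s vfd by rewrite exec_mods.
clearbody s3; have [a3 e3 b3 d3] := R3.
rewrite execIf (ok0 ok3); case: ltnP => o3; last first.
  split=> //; right; split=> // lam g; have := d3 lam g; have := d2 lam g; rewrite m1 o2.
  have -> : hv s3 vo = 0 by lia.
  by rewrite subn0; lia.
have {}o3 : hv s3 vo = 1 by rewrite o2 in a3; lia.
split.
- by apply: okc_exec.
- by move=> l v ln vn; rewrite exec_amods //; apply: b3.
left; split; first by apply: exec_hone; rewrite // (okT ok3).
(* Since no correction was made, the array is still the one left by [Proj], so the fixed coordinates
   and the checked constraints hold for the same potentials. *)
have [CA [CP CS]] := C3 o3; rewrite e3 // in CA CP CS.
apply: (rounding (Z := hm s2 3) (Q := Q)) => //; split=> //.
- by move=> l u v ln un vn euv; apply: CA.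
- by move=> l l' v ll ln vn; apply: CP => //; lia.
Qed.

Lemma zero_spec s : okc s -> box (exec (HFor vl vn2 (HFor vv vn (HWr 3 vl vv v0))) s).
Proof.
move=> ok.
suff H : forall l, l < n.+2 -> forall v, v < n ->
    hm (exec (HFor vl vn2 (HFor vv vn (HWr 3 vl vv v0))) s) 3 l v = 0.
  by move=> l v ln vn; rewrite H.
have := @exec_for_ind inp (fun i s' => forall l, l < i -> forall v, v < n -> hm s' 3 l v = 0)
  vl vn2 (HFor vv vn (HWr 3 vl vv v0)) s isT isT.
rewrite (okn2 ok); apply; [by []| |by []].
move=> i s1 iN H1 F1 _; set s2 := setv s1 vl i.
have l2 : hv s2 vl = i by [].
have n2 : hv s2 vn = n := etrans (F1 vn isT) (okn ok).
have z2 : hv s2 v0 = 0 := etrans (F1 v0 isT) (ok0 ok).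
have m2 : hm s2 3 = hm s1 3 by [].
clearbody s2.
have := @exec_for_ind inp (fun j s' => (forall l, l < i -> forall v, v < n -> hm s' 3 l v = 0)
   /\ forall v, v < j -> hm s' 3 i v = 0) vv vn (HWr 3 vl vv v0) s2 isT isT.
rewrite n2; case.
- by rewrite m2.
- move=> j s3 jn [A1 A2] F3 _.
  have l3 : hv s3 vl = i := etrans (F3 vl isT) l2.
  have z3 : hv s3 v0 = 0 := etrans (F3 v0 isT) z2.
  set t := setv s3 vv j.
  have tl : hv t vl = i := l3.
  have tz : hv t v0 = 0 := z3.
  have tv : hv t vv = j by [].
  have tm : hm t 3 = hm s3 3 by [].
  clearbody t; rewrite execWr hm_setm /= tl tz tv tm; split.
    by move=> l li v vn; rewrite upd2E; case: ifP => // _; apply: A1.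
  move=> v; rewrite ltnS leq_eqVlt upd2E eqxx /= => /orP[->//|vj].
  by case: ifP => // _; apply: A2.
- by [].
by move=> A1 A2 l; rewrite ltnS leq_eqVlt => /orP[/eqP -> v vn|li v vn]; [apply: A2|apply: A1].
Qed.

Theorem oracle_spec s : okc s ->
  (0 < hv (exec Oracle s) vfd) <-> feas n e lab B.
Proof.
move=> ok; rewrite /Oracle execS execZero execS.
set s1 := setv s vfd 0.
have ok1 : okc s1 by apply: okc_setv.
have f1 : hv s1 vfd = 0 by [].
clearbody s1.
have b2 := zero_spec ok1; set s2 := exec _ s1 in b2 *.
have ok2 : okc s2 by apply: okc_exec.
have f2 : hv s2 vfd = 0 by rewrite exec_mods.
clearbody s2.
(* The squared distance starts at most at [N0], which is less than the number of sweeps: if no sweep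
   succeeds, a labelling of cost at most [B] would end at negative distance. *)
pose N0 := n.+2 * (n * (Q.*2 * Q.*2)).
pose I (j : nat) (s' : hst) := [/\ okc s', box s' &
   (hv s' vfd = 1 /\ feas n e lab B) \/
   (hv s' vfd = 0 /\
    forall lam, good lam -> (phi lam (hm s' 3) + j%:Z <= N0%:Z)%R)].
have I0 : I 0 s2.
  split=> //; right; split=> // lam g; rewrite addr0; exact: phi_le.
have IS j s' : I j s' -> I j.+1 (exec Sweep s').
  case=> ok' b' H; have [ok3 b3 H3] := sweep_spec ok' b'; split=> //.
  case: H3 => [|[E3 P3]]; first by left.
  case: H => [[E F]|[E P]]; first by left; rewrite E3.
  right; split; first by rewrite E3.
  by move=> lam g; have := P lam g; have := P3 lam g; lia.
have Iset j s' x i : x \notin [:: vT; v0; vn; vn1; vn2; vq2; vq; vB; vfd] -> I j s' -> I j (setv s' x i).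
  move=> nx [ok' b' H]; split.
  - apply: okc_setv => //; apply: contra nx.
    by rewrite !inE; do !case/orP=> [->|]; rewrite ?orbT //; move=> ->; rewrite ?orbT.
  - exact: b'.
  - have -> : hv (setv s' x i) vfd = hv s' vfd; last by [].
    by rewrite hv_setv; case: eqP => // E; rewrite -E in nx.
have [okf _ [[E F]|[E P]]] : I (T * T) (exec (HFor vi1 vT (HFor vi2 vT Sweep)) s2).
- have := @exec_for_ind inp (fun i s' => I (i * T) s') vi1 vT (HFor vi2 vT Sweep) s2 isT isT.
  rewrite (okT ok2); apply; [by []| |by move=> i s' j; apply: Iset].
  move=> i s' iT Ii F _.
  have {Ii} : I (i * T + 0) (setv s' vi1 i) by rewrite addn0; apply: Iset.
  have : hv (setv s' vi1 i) vT = T := etrans (F vT isT) (okT ok2).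
  move: (setv s' vi1 i) => s3 T3 I3.
  have := @exec_for_ind inp (fun j s' => I (i * T + j) s') vi2 vT Sweep s3 isT isT I3.
  rewrite T3 mulSn addnC; apply; last by move=> ? ? ?; apply: Iset.
  by move=> j s4 _ I4 _ _; rewrite addnS; apply: IS; apply: Iset.
- by rewrite E.
- rewrite E; split=> // -[lam [lr lx lv lB]].
  have g : good lam by [].
  by have := P lam g; have := phi_ge0 n e Q lam (hm (exec (HFor vi1 vT (HFor vi2 vT Sweep)) s2) 3); rewrite /N0; lia.
Qed.
End Oracle.

(** * One step of the branching process *)

Notation vV := 28 (only parsing).
Notation vU := 29 (only parsing).
Notation vchg := 30 (only parsing).
Notation vA := 31 (only parsing).
Notation vC := 32 (only parsing).
Notation vb := 33 (only parsing).
Notation vok := 34 (only parsing).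
Notation vtw := 35 (only parsing).
Notation vW := 36 (only parsing).
Notation vst := 37 (only parsing).

(* A step raises the bound if it is infeasible; otherwise it gives a border vertex the label of a
   neighbour if this stays feasible; otherwise it deletes a border vertex with two neighbouring
   labels, or branches on a border vertex as told by the next bit, and raises the bound. *)
Definition Scan body := HFor vV vn (HFor vU vn
  (HLt v0 vchg HSkip (HRd vA 0 vU vV ;; hif vA (HRd vA 2 vV v0 ;;
    HLt v0 vA HSkip (HRd vC 2 vU v0 ;; hif vC (HLt vC vn1 body HSkip)))))).

Definition Try := HWr 2 vV v0 vC ;; Oracle ;; HLt v0 vfd (HInc vchg) (HWr 2 vV v0 v0).

Definition Two := HZero vtw ;; HFor vW vn (HRd vA 0 vW vV ;; hif vA (HRd vA 2 vW v0 ;;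
  hif vA (HLt vA vn1 (HLt vA vC (hone vtw) (HLt vC vA (hone vtw) HSkip)) HSkip))).

Definition Act := HInc vchg ;; Two ;;
  HLt v0 vtw (HWr 2 vV v0 vn1)
    (HLt v0 vb (HWr 2 vV v0 vC) (HWr 2 vV v0 vn1) ;; HInc vB).

Definition Step := HLt vB vk1 (Oracle ;;
  HLt v0 vfd
    (HZero vchg ;; Scan Try ;; HLt v0 vchg HSkip
      (Scan Act ;; HLt v0 vchg HSkip (hone vok)))
    (HInc vB)) HSkip.

Section Step.
Variables (inp : nat -> option bool) (n : nat) (e : rel nat) (Q T k : nat).
Hypothesis e_sym : forall u v, e u v = e v u.
Hypothesis e_irr : forall v, e v v = false.
Hypothesis k_le : k <= n.
Hypothesis Q_large : 6 * n + 3 < Q.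
Hypothesis T_six : 6 * Q + 2 <= T.
Hypothesis T_sum : n * Q.*2 <= T.
Hypothesis T_bud : (n.*2.+1) * Q + n + 1 <= T.
Hypothesis T_iter : n.+2 * (n * (Q.*2 * Q.*2)) < T * T.
Local Notation exec := (exec inp).
Local Notation del := (del n).
Local Notation prp := (prp n).
Local Notation feas := (feas n e).

Record gctx (s : hst) : Prop := Gctx {
  gT : hv s vT = T; g0 : hv s v0 = 0; gn : hv s vn = n; gn1 : hv s vn1 = n.+1;
  gn2 : hv s vn2 = n.+2; gk1 : hv s vk1 = k.*2.+1; gq2 : hv s vq2 = Q.*2; gq : hv s vq = Q;
  gadj : forall u v, u < n -> v < n -> (0 < hm s 0 u v) = e u v }.

Definition gvars := [:: vT; v0; vn; vn1; vn2; vk1; vq2; vq].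

Definition gkeeps (p : hl) : bool :=
  all (fun y => y \notin mods p) gvars && (0 \notin amods p).

Lemma gctx_exec p s : gkeeps p -> gctx s -> gctx (exec p s).
Proof.
case/andP=> /allP kv k0 [*]; split; rewrite ?exec_mods ?kv //.
by move=> u v un vn; rewrite exec_amods //; auto.
Qed.

Lemma gctx_setv x i s : x \notin gvars -> gctx s -> gctx (setv s x i).
Proof.
rewrite !inE !negb_or => nx [*].
by split; rewrite ?stE //; case: eqP => // E; rewrite -E in nx.
Qed.

Definition labs (s : hst) (v : nat) := hm s 2 v 0.
Definition eqlab (lab lab' : nat -> nat) := forall v, v < n -> lab v = lab' v.

Lemma eqlab_rng lab lab' : eqlab lab lab' -> rng n lab -> rng n lab'.
Proof. by move=> E r v vn; rewrite -E // r. Qed.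

Lemma oracle_ok s lab B : gctx s -> rng n lab -> eqlab (labs s) lab -> hv s vB = B ->
  B <= k.*2 -> (0 < hv (exec Oracle s) vfd) <-> feas lab B.
Proof.
move=> [*].
have h1 : B * Q + n + 1 <= T.
  by apply: leq_trans T_bud; rewrite !addn1 ltnS leq_add2r leq_mul2r; lia.
have h2 : 4 * n + B + 1 < Q by lia.
by apply: (@oracle_spec inp n e Q B T lab) => //; split.
Qed.

Definition border (lab : nat -> nat) u v := [/\ lab v = 0, e u v & prp (lab u)].

(* The scan finds the first pair in this order, so a run depends only on the branching bits. *)
Definition before (u' v' u v : nat) := v' < v \/ v' = v /\ u' < u.

(** Shared by both scans. [Fl] is what is learnt about a pair that the body declines, [Dn] what
    results from the pair it accepts. A nonzero [vchg] turns all later rounds into no-ops, so the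
    accepted pair is the first one. *)
Lemma scan_spec body lab (I0 : hst -> Prop) (Fl : nat -> nat -> Prop)
    (Dn : nat -> nat -> hst -> Prop) s :
  gkeeps (Scan body) -> vU \notin mods body -> vV \notin mods body ->
  rng n lab -> gctx s -> hv s vchg = 0 -> eqlab (labs s) lab -> I0 s ->
  (forall s x i, x \in [:: vV; vU; vA; vC] -> I0 s -> I0 (setv s x i)) ->
  (forall u v s x i, x \in [:: vV; vU] -> Dn u v s -> Dn u v (setv s x i)) ->
  (forall s u v, gctx s -> hv s vchg = 0 -> eqlab (labs s) lab -> I0 s ->
     u < n -> v < n -> border lab u v ->
     hv s vU = u -> hv s vV = v -> hv s vC = lab u ->
     (hv (exec body s) vchg = 0 /\ eqlab (labs (exec body s)) lab /\ I0 (exec body s) /\ Fl u v)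
     \/ (0 < hv (exec body s) vchg /\ Dn u v (exec body s))) ->
  let s' := exec (Scan body) s in
  (hv s' vchg = 0 /\ eqlab (labs s') lab /\ I0 s' /\
    forall u v, u < n -> v < n -> border lab u v -> Fl u v)
  \/ (0 < hv s' vchg /\ exists u v, [/\ u < n, v < n, border lab u v, Dn u v s' &
    forall u' v', u' < n -> v' < n -> before u' v' u v -> border lab u' v' -> Fl u' v']).
Proof.
move=> kp nU nV labr g c0 E i0 I0set Dnset H s'.
pose Dn' t := exists u v, [/\ u < n, v < n, border lab u v, Dn u v t &
    forall u' v', u' < n -> v' < n -> before u' v' u v -> border lab u' v' -> Fl u' v'].
have Dn'set t x i : x \in [:: vV; vU] -> Dn' t -> Dn' (setv t x i).
  by move=> xin [u [v [h1 h2 h3 h4 h5]]]; exists u, v; split=> //; apply: Dnset.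
pose I (P : nat -> nat -> Prop) t := gctx t /\
  ((hv t vchg = 0 /\ eqlab (labs t) lab /\ I0 t /\
    forall u v, u < n -> v < n -> P u v -> border lab u v -> Fl u v)
  \/ (0 < hv t vchg /\ Dn' t)).
have Iset P t x i : x \in [:: vV; vU] -> I P t -> I P (setv t x i).
  move=> xin [gt Ht]; split.
    by apply: gctx_setv => //; move: xin; rewrite !inE; case/orP=> /eqP ->.
  have cE : hv (setv t x i) vchg = hv t vchg.
    by rewrite hv_setv; move: xin; rewrite !inE; case/orP=> /eqP ->.
  rewrite cE; case: Ht => [[a [b [c d]]]|[a b]]; [left|right; split=> //].
    by do !split=> //; apply: I0set => //; move: xin; rewrite !inE; case/orP=> ->; rewrite ?orbT.
  exact: Dn'set.
suff [] : I (fun u v => v < n) s'.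
  by move=> _ [[a [b [c d]]]|]; [left; do !split=> //; move=> u v un vn; apply: d|right].
rewrite /s' /Scan.
set inner := HLt v0 vchg _ _.
have kin : gkeeps inner.
  by move: kp; rewrite /gkeeps /Scan -/inner /= !inE /=.
have := @exec_for_ind inp (fun i t => I (fun u v => v < i) t) vV vn (HFor vU vn inner) s.
rewrite (gn g); apply.
- by rewrite /inner /= !(inE, mem_cat) (negPf nV).
- by case/andP: kp => /allP kv _; exact: (kv vn isT).
- split=> //; left; do !split=> //.
- move=> i t iN It F _.
  have {It} : I (fun u v => v < i \/ v = i /\ u < 0) (setv t vV i).
    apply: Iset => //; have [gt Ht] := It; split=> //.
    by case: Ht => [[a [b [c d]]]|]; [left; do !split=> //; move=> u v un vn [vi|[]//]; apply: d | right].
  have : hv (setv t vV i) vV = i by [].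
  move: (setv t vV i) => t1 tV It1.
  have := @exec_for_ind inp (fun j t => I (fun u v => v < i \/ v = i /\ u < j) t) vU vn inner t1.
  have gt1 := proj1 It1; rewrite (gn gt1) => A.
  suff : I (fun u v => v < i \/ v = i /\ u < n) (exec (HFor vU vn inner) t1).
    case=> g2 H2; split=> //; case: H2 => [[a [b [c d]]]|]; [left; do !split=> //|by right].
    by move=> u v un vn vi; apply: d => //; move: vi; rewrite ltnS leq_eqVlt => /orP[/eqP|]; [right|left].
  apply: A => //.
  + by rewrite /inner /= !(inE, mem_cat) (negPf nU).
  + case/andP: kp => /allP kv _; have := kv vn isT.
    by rewrite [X in _ \notin X](_ : _ = vV :: vU :: mods inner) // inE negb_or => /andP[_].
  + move=> j t2 jn It2 F2 _.
    have {}It2 : I (fun u v => v < i \/ v = i /\ u < j) (setv t2 vU j) by apply: Iset.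
    have tV2 : hv (setv t2 vU j) vV = i.
      by rewrite hv_setv /= F2 // /inner /= !(inE, mem_cat) (negPf nV).
    have tU2 : hv (setv t2 vU j) vU = j by [].
    move: (setv t2 vU j) It2 tV2 tU2 => t3 [g3 H3] V3 U3.
    split; first exact: gctx_exec.
    case: H3 => [[a [b [c d]]]|[a b]]; last first.
      by right; rewrite /inner execLt (g0 g3) a execSkip.
    rewrite /inner execLt (g0 g3) a ltnn execS execRd U3 V3.
    have skip t4 : hv t4 vchg = 0 -> eqlab (labs t4) lab -> I0 t4 -> ~ border lab j i ->
       (hv t4 vchg = 0 /\ eqlab (labs t4) lab /\ I0 t4 /\
        forall u v, u < n -> v < n -> v < i \/ v = i /\ u < j.+1 -> border lab u v -> Fl u v)
       \/ (0 < hv t4 vchg /\ Dn' t4).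
      move=> a4 b4 c4 nb; left; do !split=> //.
      move=> u v un vn [vi|[vi]]; first by apply: d => //; left.
      rewrite ltnS leq_eqVlt => /orP[/eqP uj|uj]; last by apply: d => //; right.
      by rewrite vi uj => /nb.
    set t4 := setv t3 vA _.
    have g4 : gctx t4 by apply: gctx_setv.
    have a4 : hv t4 vA = hm t3 0 j i by [].
    have c4 : hv t4 vchg = 0 by [].
    have b4 : eqlab (labs t4) lab by [].
    have i4 : I0 t4 by apply: I0set.
    have U4 : hv t4 vU = j by []. have V4 : hv t4 vV = i by [].
    clearbody t4; rewrite execIf (g0 g4) a4 (gadj g3) //.
    case: ifP => eji; last by apply: skip => //; case=> _; rewrite eji.
    rewrite execS execRd V4 (g0 g4).
    set t5 := setv t4 vA _.
    have g5 : gctx t5 by apply: gctx_setv.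
    have a5 : hv t5 vA = lab i by rewrite -b4.
    have c5 : hv t5 vchg = 0 by [].
    have b5 : eqlab (labs t5) lab by [].
    have i5 : I0 t5 by apply: I0set.
    have U5 : hv t5 vU = j by []. have V5 : hv t5 vV = i by [].
    clearbody t5; rewrite execLt (g0 g5) a5; case: ltnP => l0.
      by rewrite execSkip; apply: skip => //; case=> El; rewrite El in l0.
    rewrite execS execRd U5 (g0 g5).
    set t6 := setv t5 vC _.
    have g6 : gctx t6 by apply: gctx_setv.
    have a6 : hv t6 vC = lab j by rewrite -b5.
    have c6 : hv t6 vchg = 0 by [].
    have b6 : eqlab (labs t6) lab by [].
    have i6 : I0 t6 by apply: I0set.
    have U6 : hv t6 vU = j by []. have V6 : hv t6 vV = i by [].
    clearbody t6; rewrite execIf (g0 g6) a6; case: ltnP => lj; last first.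
      by apply: skip => //; case=> _ _; rewrite /prp; lia.
    rewrite execLt a6 (gn1 g6); case: ltnP => lj2; last first.
      by rewrite execSkip; apply: skip => //; case=> _ _; rewrite /prp; lia.
    have bo : border lab j i by split=> //; rewrite /prp; lia.
    case: (H t6 j i) => // [[a7 [b7 [c7 d7]]]|[a7 d7]]; last first.
      right; split=> //; exists j, i; split=> // u' v' un' vn' bf; apply: d => //.
    left; do !split=> //.
    move=> u v un vn [vi|[vi]]; first by apply: d => //; left.
    rewrite ltnS leq_eqVlt => /orP[/eqP uj|uj]; last by apply: d => //; right.
    by rewrite vi uj.
  + by move=> ? ? ?; apply: Iset.
- by move=> ? ? ?; apply: Iset.
Qed.

(** * The step as a relation on labellings and bounds *)

Definition maximal lab B := forall u v, u < n -> v < n -> border lab u v ->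
  ~ feas (upd lab v (lab u)) B.

Definition first (P : nat -> nat -> Prop) u v :=
  [/\ u < n, v < n, P u v & forall u' v', u' < n -> v' < n -> before u' v' u v -> ~ P u' v'].

Lemma first_uniq (P P' : nat -> nat -> Prop) u v u' v' :
  (forall u v, u < n -> v < n -> P u v -> P' u v) ->
  (forall u v, u < n -> v < n -> P' u v -> P u v) ->
  first P u v -> first P' u' v' -> u = u' /\ v = v'.
Proof.
move=> PP P'P [un vn p f] [un' vn' p' f'].
have [h1 h2] : ~ before u' v' u v /\ ~ before u v u' v'.
  by split=> b; [apply: (f u' v') => //; apply: P'P|apply: (f' u v) => //; apply: PP].
rewrite /before in h1 h2; have [lt|gt|E] := ltngtP v v'; [by case: h2; left|by case: h1; left|].
by split=> //; have [lt|gt|//] := ltngtP u u'; [case: h2|case: h1]; right.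
Qed.

Definition settable lab B u v := border lab u v /\ feas (upd lab v (lab u)) B.

(** A specification of [Step] free of program states, so that runs on different bits can be
    compared. The bit occurs only in [StepBranch]. *)
Inductive stepR (b : bool) (lab : nat -> nat) (B ok : nat) (lab' : nat -> nat) (B' ok' : nat) : Prop :=
  | StepInc of ~ feas lab B & eqlab lab' lab & B' = B.+1 & ok' = ok
  | StepSet u v of feas lab B & first (settable lab B) u v
      & eqlab lab' (upd lab v (lab u)) & B' = B & ok' = ok
  | StepTwo u v of feas lab B & maximal lab B & first (border lab) u v & nb2 n e lab v
      & eqlab lab' (upd lab v del) & B' = B & ok' = ok
  | StepBranch u v of feas lab B & maximal lab B & first (border lab) u v & ~~ nb2 n e lab v
      & eqlab lab' (upd lab v (if b then lab u else del)) & B' = B.+1 & ok' = ok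
  | StepOk of feas lab B & (forall u v, u < n -> v < n -> ~ border lab u v)
      & eqlab lab' lab & B' = B & ok' = 1.

Lemma feas_eqlab lab lab' B : eqlab lab lab' -> feas lab B -> feas lab' B.
Proof.
by move=> E [lam [r x v c]]; exists lam; split=> // w wn; rewrite -E // => /x ->.
Qed.

Lemma eqlab_sym lab lab' : eqlab lab lab' -> eqlab lab' lab.
Proof. by move=> E v vn; rewrite E. Qed.

Lemma eqlab_trans l1 l2 l3 : eqlab l1 l2 -> eqlab l2 l3 -> eqlab l1 l3.
Proof. by move=> E E' v vn; rewrite E ?E'. Qed.

Lemma eqlab_upd lab lab' v l : eqlab lab lab' -> eqlab (upd lab v l) (upd lab' v l).
Proof. by move=> E w wn; rewrite !updE; case: eqP => // _; apply: E. Qed.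

Lemma border_eq lab lab' u v : eqlab lab lab' -> u < n -> v < n ->
  border lab u v -> border lab' u v.
Proof. by move=> E un vn [a b c]; split; rewrite -?E. Qed.

Lemma settable_eq lab lab' B u v : eqlab lab lab' -> u < n -> v < n ->
  settable lab B u v -> settable lab' B u v.
Proof.
move=> E un vn [b f]; split; first exact: border_eq b.
by apply: feas_eqlab f; rewrite -E //; apply: eqlab_upd.
Qed.

Lemma nb2_eq lab lab' v : eqlab lab lab' -> nb2 n e lab v = nb2 n e lab' v.
Proof.
by move=> E; apply/idP/idP; apply: nb2_sub => u un _; rewrite E.
Qed.

(** The cases exclude each other, and within a case [first] selects the same pair. Only a branching
    reads the bit, and it raises the bound; therefore the bits have to agree only if [B < B1]. *)
Lemma step_det b b' lab lab' B ok lab1 B1 ok1 lab2 B2 ok2 :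
  eqlab lab lab' -> stepR b lab B ok lab1 B1 ok1 -> stepR b' lab' B ok lab2 B2 ok2 ->
  (B < B1 -> b = b') -> [/\ eqlab lab1 lab2, B1 = B2 & ok1 = ok2].
Proof.
move=> E S1 S2; have E' := eqlab_sym E.
have ft := @feas_eqlab _ _ B E; have ft' := @feas_eqlab _ _ B E'.
have bo u v : u < n -> v < n -> border lab u v -> border lab' u v by move=> *; apply: border_eq E _ _ _.
have bo' u v : u < n -> v < n -> border lab' u v -> border lab u v by move=> *; apply: border_eq E' _ _ _.
have se u v : u < n -> v < n -> settable lab B u v -> settable lab' B u v by move=> *; apply: settable_eq E _ _ _.
have se' u v : u < n -> v < n -> settable lab' B u v -> settable lab B u v by move=> *; apply: settable_eq E' _ _ _.
case: S1 => [f1 e1 -> ->|u v f1 s1 e1 -> ->|u v f1 m1 s1 t1 e1 -> ->|u v f1 m1 s1 t1 e1 -> ->|f1 s1 e1 -> ->];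
case: S2 => [f2 e2 -> ->|u' v' f2 s2 e2 -> ->|u' v' f2 m2 s2 t2 e2 -> ->|u' v' f2 m2 s2 t2 e2 -> ->|f2 s2 e2 -> ->] bb;
  try by [case: f1; auto | case: f2; auto].
- by split=> //; apply: eqlab_trans e1 (eqlab_trans E (eqlab_sym e2)).
- have [uu vv] := first_uniq se se' s1 s2; rewrite -uu -vv in e2.
  have [un _ _ _] := s1.
  split=> //; apply: eqlab_trans e1 (eqlab_trans _ (eqlab_sym e2)).
  by rewrite (E u un); apply: eqlab_upd.
- by case: s1 => un vn /(se _ _ un vn)[b1 g1] _; case: (m2 _ _ un vn b1).
- by case: s1 => un vn /(se _ _ un vn)[b1 g1] _; case: (m2 _ _ un vn b1).
- by case: s1 => un vn /(se _ _ un vn)[b1 g1] _; case: (s2 _ _ un vn b1).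
- by case: s2 => un vn /(se' _ _ un vn)[b1 g1] _; case: (m1 _ _ un vn b1).
- have [uu vv] := first_uniq bo bo' s1 s2; rewrite -vv in e2.
  by split=> //; apply: eqlab_trans e1 (eqlab_trans _ (eqlab_sym e2)); apply: eqlab_upd.
- have [uu vv] := first_uniq bo bo' s1 s2.
  by move: t2; rewrite -vv -(nb2_eq v E) t1.
- by case: s1 => un vn /(bo _ _ un vn) b1 _; case: (s2 _ _ un vn b1).
- by case: s2 => un vn /(se' _ _ un vn)[b1 g1] _; case: (m1 _ _ un vn b1).
- have [uu vv] := first_uniq bo bo' s1 s2.
  by move: t1; rewrite vv (nb2_eq v' E) t2.
- have [uu vv] := first_uniq bo bo' s1 s2; rewrite -uu -vv -bb // in e2.
  have [un _ _ _] := s1.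
  split=> //; apply: eqlab_trans e1 (eqlab_trans _ (eqlab_sym e2)).
  by rewrite (E u un); apply: eqlab_upd.
- by case: s1 => un vn /(bo _ _ un vn) b1 _; case: (s2 _ _ un vn b1).
- by case: s2 => un vn /(se' _ _ un vn)[b1 g1] _; case: (s1 _ _ un vn b1).
- by case: s2 => un vn /(bo' _ _ un vn) b1 _; case: (s1 _ _ un vn b1).
- by case: s2 => un vn /(bo' _ _ un vn) b1 _; case: (s1 _ _ un vn b1).
- by split=> //; apply: eqlab_trans e1 (eqlab_trans E (eqlab_sym e2)).
Qed.

Lemma labs_setm s v l lab : eqlab (labs s) lab -> eqlab (labs (setm s 2 v 0 l)) (upd lab v l).
Proof.
move=> E w wn; rewrite /labs hm_setm /= /upd2 !updE.
by case: (eqVneq w v) => [_|wv]; rewrite ?updE //=; apply: E.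
Qed.

Lemma labs_eq s s' : hm s' 2 = hm s 2 -> labs s' = labs s.
Proof. by move=> E; rewrite /labs E. Qed.

Lemma rng_upd lab v l : rng n lab -> l <= n.+1 -> rng n (upd lab v l).
Proof. by move=> r le w wn; rewrite updE; case: eqP => // _; apply: r. Qed.

Lemma T_pos : 0 < T. Proof. lia. Qed.

Lemma try_spec lab B b ok s u v : rng n lab -> B <= k.*2 ->
  gctx s -> hv s vchg = 0 -> eqlab (labs s) lab ->
  [/\ hv s vB = B, (0 < hv s vb) = b & hv s vok = ok] ->
  u < n -> v < n -> border lab u v -> hv s vV = v -> hv s vC = lab u ->
  let s' := exec Try s in
  (hv s' vchg = 0 /\ eqlab (labs s') lab /\ [/\ hv s' vB = B, (0 < hv s' vb) = b & hv s' vok = ok] /\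
     ~ feas (upd lab v (lab u)) B) \/
  (0 < hv s' vchg /\
    [/\ feas (upd lab v (lab u)) B, eqlab (labs s') (upd lab v (lab u)), hv s' vB = B & hv s' vok = ok]).
Proof.
move=> labr Bk g c0 E [EB Eb Eok] un vn bo EV EC s'; rewrite /s' /Try execS execWr EV EC (g0 g).
set s1 := setm _ _ _ _ _.
have g1 : gctx s1 by case: g => *; split.
have F1 q : hv s1 q = hv s q by [].
have E1 : eqlab (labs s1) (upd lab v (lab u)) by apply: labs_setm.
clearbody s1; rewrite execS.
have O := @oracle_ok s1 _ B g1 (@rng_upd lab v (lab u) labr (labr u un)) E1 (etrans (F1 _) EB) Bk.
set s2 := exec Oracle s1 in O *.
have g2 : gctx s2 by apply: gctx_exec.
have F2 q : q \in [:: vchg; vB; vb; vok; vV] -> hv s2 q = hv s q.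
  move=> qin; rewrite exec_mods ?F1 //.
  by move: qin; rewrite !inE => /or4P[/eqP ->|/eqP ->|/eqP ->|/orP[] /eqP ->].
have E2 : eqlab (labs s2) (upd lab v (lab u)) by rewrite (@labs_eq s1) // exec_amods.
clearbody s2; rewrite execLt (g0 g2); case: ltnP => fd.
  right; rewrite exec_Inc; last by rewrite F2 // c0 (gT g2) T_pos.
  split=> //; split=> //.
  - by apply/O.
  - by rewrite -EB -F2.
  - by rewrite -Eok -F2.
have nf : ~ feas (upd lab v (lab u)) B by move=> /O; lia.
left; rewrite execWr F2 // EV (g0 g2); do !split=> //=.
- by rewrite F2.
- move=> w wn; have := labs_setm v 0 E2 wn => ->; rewrite !updE.
  by case: eqP => // ->; have [-> _ _] := bo.
- by rewrite F2.
- by rewrite F2.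
- by rewrite F2.
Qed.

(** It suffices to compare all neighbouring labels with the one label [lab u]: of two different
    labels at least one differs from it. *)
Lemma two_spec lab s u v : gctx s -> eqlab (labs s) lab ->
  u < n -> v < n -> border lab u v -> hv s vV = v -> hv s vC = lab u ->
  (0 < hv (exec Two s) vtw) = nb2 n e lab v.
Proof.
move=> g E un vn bo EV EC; rewrite /Two execS execZero.
set s1 := setv s vtw 0.
have g1 : gctx s1 by apply: gctx_setv.
have V1 : hv s1 vV = v by []. have C1 : hv s1 vC = lab u by [].
have E1 : eqlab (labs s1) lab by [].
have t1 : hv s1 vtw = 0 by [].
clearbody s1.
have [v0' euv pu] := bo.
pose D w := [&& e w v, prp (lab w) & lab w != lab u].
set body := (HRd vA 0 vW vV ;; _).
have := @exec_for_ind inp (fun i t => (0 < hv t vtw) <-> exists2 w, w < i & D w)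
  vW 3 body s1 isT isT.
rewrite (gn g1) => H.
have {H} R : (0 < hv (exec (HFor vW 3 body) s1) vtw) <-> exists2 w, w < n & D w.
  apply: H; [by rewrite t1; split=> // -[w]| |by []].
  move=> i s2 iN I2 F2 M2.
  set s3 := setv s2 vW i.
  have F3 q : q \notin vW :: mods body -> hv s3 q = hv s1 q.
    move=> qn; rewrite hv_setv ifF ?F2 //.
    by move: qn; rewrite inE negb_or => /andP[/negPf].
  have z3 : hv s3 v0 = 0 by rewrite F3 // (g0 g1).
  have T3 : hv s3 0 = T by rewrite F3 // (gT g1).
  have n3 : hv s3 vn1 = n.+1 by rewrite F3 // (gn1 g1).
  have V3 : hv s3 vV = v by rewrite F3.
  have C3 : hv s3 vC = lab u by rewrite F3.
  have W3 : hv s3 vW = i by [].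
  have A3 : hm s3 0 = hm s1 0 by rewrite hm_setv M2.
  have L3 : labs s3 i = lab i by rewrite -E1 // /labs hm_setv M2.
  have {}I3 : (0 < hv s3 vtw) <-> exists2 w, w < i & D w := I2.
  clearbody s3.
  have ext t : (hv t vtw = hv s3 vtw) -> ~~ D i -> (0 < hv t vtw) <-> exists2 w, w < i.+1 & D w.
    move=> -> nD; rewrite I3; split=> -[w wi Dw]; exists w => //; first by rewrite ltnW.
    by move: wi; rewrite ltnS leq_eqVlt => /orP[/eqP wi|//]; rewrite -wi Dw in nD.
  have one t : hv t 0 = T -> D i -> (0 < hv (exec (hone vtw) t) vtw) <-> exists2 w, w < i.+1 & D w.
    by move=> tT Di; rewrite exec_hone ?tT ?T_pos //; split=> // _; exists i.
  rewrite /body execS execRd W3 V3 A3; set s4 := setv s3 vA _.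
  have a4 : hv s4 vA = hm s1 0 i v by [].
  have z4 : hv s4 v0 = 0 by []. have W4 : hv s4 vW = i by [].
  have t4 : hv s4 vtw = hv s3 vtw by [].
  have n4 : hv s4 vn1 = n.+1 by []. have C4 : hv s4 vC = lab u by [].
  have L4 : labs s4 i = lab i by []. have T4 : hv s4 0 = T by [].
  clearbody s4; rewrite execIf z4 a4 (gadj g1) //; case: ifP => eiv; last first.
    by apply: (ext s4 t4); rewrite /D eiv.
  rewrite execS execRd W4 z4; set s5 := setv s4 vA _.
  have a5 : hv s5 vA = lab i by rewrite -L4.
  have z5 : hv s5 v0 = 0 by [].
  have t5 : hv s5 vtw = hv s3 vtw by [].
  have n5 : hv s5 vn1 = n.+1 by []. have C5 : hv s5 vC = lab u by [].
  have T5 : hv s5 0 = T by [].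
  clearbody s5; rewrite execIf z5 a5; case: (ltnP 0 (lab i)) => l0; last first.
    by apply: (ext s5 t5); rewrite /D eiv /prp; lia.
  rewrite execLt a5 n5; case: (ltnP (lab i) n.+1) => l1; last first.
    by rewrite execSkip; apply: (ext s5 t5); rewrite /D eiv /prp; lia.
  have Di : D i = (lab i != lab u) by rewrite /D eiv /prp; lia.
  rewrite execLt a5 C5; case: (ltnP (lab i) (lab u)) => l2; first by apply: (one s5 T5); rewrite Di; lia.
  rewrite execLt a5 C5; case: (ltnP (lab u) (lab i)) => l3; first by apply: (one s5 T5); rewrite Di; lia.
  by rewrite execSkip; apply: (ext s5 t5); rewrite Di; lia.
apply/idP/nb2P => [/R[w wn /and3P[ew pw ne]]|[x [w [[xn wn] ex ew [px pw] ne]]]]; last apply/R.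
  by exists w, u.
case: (eqVneq (lab x) (lab u)) => [E'|ne'].
  by exists w => //; rewrite /D ew pw -E' eq_sym.
by exists x => //; rewrite /D ex px.
Qed.

Lemma act_spec lab B b ok s u v : B < T ->
  gctx s -> hv s vchg = 0 -> eqlab (labs s) lab ->
  [/\ hv s vB = B, (0 < hv s vb) = b & hv s vok = ok] ->
  u < n -> v < n -> border lab u v -> hv s vV = v -> hv s vC = lab u ->
  let s' := exec Act s in
  0 < hv s' vchg /\ (hv s' vok = ok /\
    ((nb2 n e lab v /\ eqlab (labs s') (upd lab v del) /\ hv s' vB = B) \/
     (~~ nb2 n e lab v /\ eqlab (labs s') (upd lab v (if b then lab u else del)) /\ hv s' vB = B.+1))).
Proof.
move=> BT g c0 E [EB Eb Eok] un vn bo EV EC s'.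
rewrite /s' /Act execS exec_Inc; last by rewrite c0 (gT g) T_pos.
set s1 := setv s vchg _.
have g1 : gctx s1 by apply: gctx_setv.
have c1 : hv s1 vchg = 1 by rewrite hv_setv /= c0.
have V1 : hv s1 vV = v by []. have C1 : hv s1 vC = lab u by [].
have E1 : eqlab (labs s1) lab by []. have B1 : hv s1 vB = B by [].
have b1 : (0 < hv s1 vb) = b by []. have k1 : hv s1 vok = ok by [].
clearbody s1; rewrite execS; have tw := two_spec g1 E1 un vn bo V1 C1.
set s2 := exec Two s1 in tw *.
have g2 : gctx s2 by apply: gctx_exec.
have c2 : hv s2 vchg = 1 by rewrite exec_mods.
have V2 : hv s2 vV = v by rewrite exec_mods.
have C2 : hv s2 vC = lab u by rewrite exec_mods.
have E2 : eqlab (labs s2) lab by rewrite (@labs_eq s1) // exec_amods.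
have B2 : hv s2 vB = B by rewrite exec_mods.
have b2 : (0 < hv s2 vb) = b by rewrite exec_mods.
have k2 : hv s2 vok = ok by rewrite exec_mods.
clearbody s2; rewrite execLt (g0 g2) tw; case: ifP => two.
  rewrite execWr V2 (g0 g2) (gn1 g2) hv_setm c2; split=> //; split=> //.
  by left; split=> //; split; [apply: labs_setm|].
rewrite execS execLt (g0 g2) b2.
have -> : (if b then exec (HWr 2 vV v0 vC) s2 else exec (HWr 2 vV v0 vn1) s2) =
  setm s2 2 v 0 (if b then lab u else del).
  by case: b {Eb b1 b2}; rewrite execWr V2 (g0 g2) ?C2 ?(gn1 g2).
set s3 := setm _ _ _ _ _.
have E3 : eqlab (labs s3) (upd lab v (if b then lab u else del)) by apply: labs_setm.
have c3 : hv s3 vchg = 1 by []. have B3 : hv s3 vB = B by []. have k3 : hv s3 vok = ok by [].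
have T3 : hv s3 0 = T := gT g2.
clearbody s3; rewrite exec_Inc ?B3 ?T3 //; split; first by rewrite hv_setv /= c3.
by split=> //; right; split=> //; rewrite two.
Qed.

Lemma step_spec lab B b ok s : rng n lab -> B <= k.*2 ->
  gctx s -> eqlab (labs s) lab -> hv s vB = B -> (0 < hv s vb) = b -> hv s vok = ok ->
  let s' := exec Step s in
  gctx s' /\ stepR b lab B ok (labs s') (hv s' vB) (hv s' vok).
Proof.
move=> labr Bk g E EB Eb Eok s'; split; first exact: gctx_exec.
have BT : B < T by move: T_bud; nia.
rewrite /s' /Step execLt EB (gk1 g) ltnS Bk execS.
have O := @oracle_ok s _ B g labr E EB Bk.
set s1 := exec Oracle s in O *.
have g1 : gctx s1 by apply: gctx_exec.
have E1 : eqlab (labs s1) lab by rewrite (@labs_eq s) // exec_amods.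
have B1 : hv s1 vB = B by rewrite exec_mods.
have b1 : (0 < hv s1 vb) = b by rewrite exec_mods.
have k1 : hv s1 vok = ok by rewrite exec_mods.
clearbody s1; rewrite execLt (g0 g1); case: ltnP => fd; last first.
  rewrite exec_Inc ?B1 ?(gT g1) //; apply: StepInc => //.
  by move=> /O; lia.
have fe : feas lab B by apply/O.
rewrite execS execZero; set s2 := setv s1 vchg 0.
have g2 : gctx s2 by apply: gctx_setv.
have E2 : eqlab (labs s2) lab by [].
have c2 : hv s2 vchg = 0 by [].
have i2 : [/\ hv s2 vB = B, (0 < hv s2 vb) = b & hv s2 vok = ok] by [].
clearbody s2; rewrite execS.
have I0set (t : hst) x i : x \in [:: vV; vU; vA; vC] ->
   [/\ hv t vB = B, (0 < hv t vb) = b & hv t vok = ok] ->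
   [/\ hv (setv t x i) vB = B, (0 < hv (setv t x i) vb) = b & hv (setv t x i) vok = ok].
  by rewrite !hv_setv !inE => /or4P[] /eqP ->.
have H1 := @scan_spec Try lab (fun t => [/\ hv t vB = B, (0 < hv t vb) = b & hv t vok = ok])
  (fun u v => ~ feas (upd lab v (lab u)) B)
  (fun u v t => [/\ feas (upd lab v (lab u)) B, eqlab (labs t) (upd lab v (lab u)), hv t vB = B & hv t vok = ok])
  s2 isT isT isT labr g2 c2 E2 i2 I0set.
case: H1.
- move=> u v t x i xin [f1 f2 f3 f4]; split=> //.
  + by move: xin; rewrite hv_setv !inE => /orP[] /eqP ->.
  + by move: xin; rewrite hv_setv !inE => /orP[] /eqP ->.
- by move=> t u v gt ct Et it un vn bo Ut Vt Ct; apply: try_spec.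
- set s3 := exec (Scan Try) s2; move=> [c3 [E3 [i3 mx]]].
  have g3 : gctx s3 by apply: gctx_exec.
  clearbody s3; rewrite execLt (g0 g3) c3 ltnn execS.
  have H2 := @scan_spec Act lab (fun t => [/\ hv t vB = B, (0 < hv t vb) = b & hv t vok = ok])
    (fun u v => False)
    (fun u v t => hv t vok = ok /\
     ((nb2 n e lab v /\ eqlab (labs t) (upd lab v del) /\ hv t vB = B) \/
     (~~ nb2 n e lab v /\ eqlab (labs t) (upd lab v (if b then lab u else del)) /\ hv t vB = B.+1)))
    s3 isT isT isT labr g3 c3 E3 i3 I0set.
  case: H2.
  + move=> u v t x i xin [f1 f2]; split=> //.
      by move: xin; rewrite hv_setv !inE => /orP[] /eqP ->.
    by move: xin; rewrite hv_setv !inE => /orP[] /eqP ->.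
  + move=> t u v gt ct Et it un vn bo Ut Vt Ct; right. exact: (act_spec BT gt ct Et it un vn bo Vt Ct).
  + set s4 := exec (Scan Act) s3; move=> [c4 [E4 [[B4 b4 k4] nb]]].
    have g4 : gctx s4 by apply: gctx_exec.
    clearbody s4; rewrite execLt (g0 g4) c4 ltnn.
    have k5 : hv (exec (hone vok) s4) vok = 1 by apply: exec_hone; rewrite ?(gT g4) ?T_pos.
    have B5 : hv (exec (hone vok) s4) vB = B by rewrite exec_mods.
    have E5 : eqlab (labs (exec (hone vok) s4)) lab by rewrite (@labs_eq s4) // exec_amods.
    by apply: StepOk => // u v un vn bo; apply: (nb u v un vn bo).
  + set s4 := exec (Scan Act) s3; move=> [c4 [u [v [un vn bo [k4 H] fst]]]].
    have g4 : gctx s4 by apply: gctx_exec.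
    clearbody s4; rewrite execLt (g0 g4) c4 execSkip.
    have mx' : maximal lab B by move=> u' v' un' vn' bo'; apply: mx.
    have fi : first (border lab) u v by split=> // u' v' un' vn' bf /(fst _ _ un' vn' bf).
    case: H => [[two [E4 B4]]|[two [E4 B4]]].
      by apply: (@StepTwo _ _ _ _ _ _ _ u v).
    by apply: (@StepBranch _ _ _ _ _ _ _ u v).
- set s3 := exec (Scan Try) s2; move=> [c3 [u [v [un vn bo [f1 f2 f3 f4] fst]]]].
  have g3 : gctx s3 by apply: gctx_exec.
  clearbody s3; rewrite execLt (g0 g3) c3 execSkip.
  apply: (@StepSet _ _ _ _ _ _ _ u v) => //; split=> // u' v' un' vn' bf [bo' fe'].
  exact: (fst _ _ un' vn' bf bo').
Qed.
End Step.

From mathcomp Require Import boolp classical_sets reals ereal exp.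

(** * A run of the branching process *)

Notation vacc := 38 (only parsing).
Notation vcont := 39 (only parsing).
Notation vcy := 40 (only parsing).
Notation vI := 41 (only parsing).
Notation vD := 42 (only parsing).

Definition Reset := HFor vV vn (HRd vA 1 vV v0 ;; HWr 2 vV v0 vA) ;;
  HZero vB ;; hadd vB vh vi ;; HZero vok.
Definition Turn := HRd vb 4 vB v0 ;; Step.
Definition Run := Reset ;; HFor vst vT Turn.

Section Run.
Variables (inp : nat -> option bool) (n : nat) (e : rel nat) (Q T k : nat).
Hypothesis e_sym : forall u v, e u v = e v u.
Hypothesis e_irr : forall v, e v v = false.
Hypothesis k_le : k <= n.
Hypothesis Q_large : 6 * n + 3 < Q.
Hypothesis T_six : 6 * Q + 2 <= T.
Hypothesis T_sum : n * Q.*2 <= T.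
Hypothesis T_bud : (n.*2.+1) * Q + n + 1 <= T.
Hypothesis T_iter : n.+2 * (n * (Q.*2 * Q.*2)) < T * T.
Local Notation exec := (exec inp).
Local Notation del := (del n).
Local Notation prp := (prp n).
Local Notation feas := (feas n e).
Local Notation isol := (isol n e).
Local Notation gctx := (gctx n e Q T k).
Local Notation eqlab := (eqlab n).
Local Notation border := (border n e).
Local Notation stepR := (stepR n e).
Local Notation first := (first n).
Local Notation maximal := (maximal n e).

(** Beyond [2k] the program idles; this case makes runs of every length possible. *)
Definition stepX (bt : nat -> bool) lab B ok lab' B' ok' : Prop :=
  (B <= k.*2 /\ stepR (bt B) lab B ok lab' B' ok') \/
  [/\ k.*2 < B, eqlab lab' lab, B' = B & ok' = ok].

Lemma stepX_mono bt lab B ok lab' B' ok' : stepX bt lab B ok lab' B' ok' -> B <= B'.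
Proof.
case=> [[_ [_ _ -> _|u v _ _ _ -> _|u v _ _ _ _ _ -> _|u v _ _ _ _ _ -> _|_ _ _ -> _]]|[_ _ -> _]] //.
Qed.

Lemma stepX_rng bt lab B ok lab' B' ok' : stepX bt lab B ok lab' B' ok' -> rng n lab -> rng n lab'.
Proof.
have R l v : rng n lab -> l <= n.+1 -> eqlab lab' (upd lab v l) -> rng n lab'.
  by move=> r le E; apply: eqlab_rng (eqlab_sym E) _; apply: rng_upd.
move=> S r; case: S => [[_ [_ E _ _|u v _ [un _ _ _] E _ _|u v _ _ _ _ E _ _|u v _ _ [un _ _ _] _ E _ _|_ _ E _ _]]|[_ E _ _]].
- exact: eqlab_rng (eqlab_sym E) r.
- by apply: R E => //; apply: r.
- by apply: R E.
- by apply: R E => //; case: ifP => // _; apply: r.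
- exact: eqlab_rng (eqlab_sym E) r.
- exact: eqlab_rng (eqlab_sym E) r.
Qed.

Lemma stepX_det bt bt' lab lab' B ok lab1 B1 ok1 lab2 B2 ok2 :
  eqlab lab lab' -> stepX bt lab B ok lab1 B1 ok1 -> stepX bt' lab' B ok lab2 B2 ok2 ->
  (B < B1 -> bt B = bt' B) -> [/\ eqlab lab1 lab2, B1 = B2 & ok1 = ok2].
Proof.
move=> E [[l1 S1]|[l1 E1 -> ->]] [[l2 S2]|[l2 E2 -> ->]]; try lia.
  exact: step_det E S1 S2.
by move=> _; split=> //; apply: eqlab_trans E1 (eqlab_trans E (eqlab_sym E2)).
Qed.

Fixpoint trace (bt : nat -> bool) lab0 h0 (j : nat) lab B ok : Prop :=
  match j with
  | 0 => [/\ eqlab lab lab0, B = h0 & ok = 0]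
  | j'.+1 => exists lab1 B1 ok1, trace bt lab0 h0 j' lab1 B1 ok1 /\
      stepX bt lab1 B1 ok1 lab B ok
  end.

Lemma trace_ge bt lab0 h0 j lab B ok : trace bt lab0 h0 j lab B ok -> h0 <= B.
Proof.
elim: j lab B ok => [|j IH] lab B ok /=; first by case=> _ ->.
by case=> lab1 [B1 [ok1 [/IH h /stepX_mono]]]; apply: leq_trans.
Qed.

(** A bit influences a run only in a step that raises the bound past its position, so the state
    reached at bound [B] is determined by the bits from [h0] to below [B]. *)
Lemma trace_det bt bt' lab0 h0 j lab B ok lab' B' ok' :
  trace bt lab0 h0 j lab B ok -> trace bt' lab0 h0 j lab' B' ok' ->
  (forall i, h0 <= i < B -> bt i = bt' i) ->
  [/\ eqlab lab lab', B = B' & ok = ok'].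
Proof.
elim: j lab B ok lab' B' ok' => [|j IH] lab B ok lab' B' ok' /=.
  by case=> E -> -> [E' -> ->] _; split=> //; apply: eqlab_trans E (eqlab_sym E').
case=> lab1 [B1 [ok1 [t1 s1]]] [lab2 [B2 [ok2 [t2 s2]]]] agr.
have m1 := stepX_mono s1; have g1 := trace_ge t1.
have [|E BB okk] := IH _ _ _ _ _ _ t1 t2.
  by move=> i /andP[i1 i2]; apply: agr; lia.
rewrite -BB -okk in s2; apply: stepX_det E s1 s2 _ => lt.
by apply: agr; rewrite g1.
Qed.

Lemma isol_eqlab lab lab' : eqlab lab lab' -> isol lab k -> isol lab' k.
Proof.
move=> E [nu [r x i s]]; exists nu; split=> // v vn; rewrite -E // => h; exact: x.
Qed.

Lemma isol_ext lab lab' : ext n lab lab' -> isol lab' k -> isol lab k.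
Proof.
by move=> x [nu [r x' i s]]; exists nu; split=> // v vn h; rewrite x' ?x.
Qed.

Lemma no_border lab : (forall u v, u < n -> v < n -> ~ border lab u v) ->
  forall u v, u < n -> v < n -> lab v = 0 -> e u v -> ~~ prp (lab u).
Proof. by move=> H u v un vn v0' euv; apply/negP => pu; apply: (H u v). Qed.

(** Steps only fill undecided vertices, so a solution for a later labelling is one for [lab0]. The
    flag is set only when no border is left at a bound at most [2k], where [feas_final] applies. *)
Lemma trace_sound bt lab0 h0 j lab B ok : rng n lab0 -> trace bt lab0 h0 j lab B ok ->
  [/\ rng n lab, isol lab k -> isol lab0 k & 0 < ok -> isol lab0 k].
Proof.
move=> r0; elim: j lab B ok => [|j IH] lab B ok /=.
  by case=> E _ ->; split=> //; [exact: eqlab_rng (eqlab_sym E) r0|exact: isol_eqlab].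
case=> lab1 [B1 [ok1 [/IH[r1 i1 o1] s1]]]; split; first exact: stepX_rng s1 r1.
- move=> is1; apply: i1.
  have U v l : lab1 v = 0 -> eqlab lab (upd lab1 v l) -> isol lab1 k.
    by move=> v0' E; apply: isol_ext (isol_eqlab E is1); apply: ext_upd.
  case: s1 => [[_ [_ E _ _|u v _ [_ _ [[h _ _] _] _] E _ _|u v _ _ [_ _ [h _ _] _] _ E _ _|u v _ _ [_ _ [h _ _] _] _ E _ _|_ _ E _ _]]|[_ E _ _]];
    try exact: isol_eqlab E is1; exact: U E.
- case: s1 => [[le [_ _ _ ->|u v _ _ _ _ ->|u v _ _ _ _ _ _ ->|u v _ _ _ _ _ _ ->|f nb E _ _]]|[_ _ _ ->]] //.
  move=> _; apply: i1; apply: feas_final => //; first exact: no_border.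
  exact: feas_le f.
Qed.

(* If the bits follow a solution, each step that is not final labels a vertex or raises the bound,
   so the sum decreases and [ok] is set before the steps run out. *)
Definition pinv h0 (j : nat) lab B (ok : nat) : Prop :=
  [/\ rng n lab, isol lab k, forall B', B' < B -> ~ feas lab B', h0 <= B &
    0 < ok \/ \sum_(v < n) (lab v == 0) + (k.*2.+1 - B) + j <= n + k.*2.+1].

Lemma pinv_eqlab h0 j lab lab' B ok : eqlab lab lab' -> pinv h0 j lab B ok -> pinv h0 j lab' B ok.
Proof.
move=> E [r i f h d]; split=> //.
- exact: eqlab_rng E r.
- exact: isol_eqlab E i.
- by move=> B' lt fe; apply: (f B' lt); apply: feas_eqlab fe; apply: eqlab_sym.
- case: d => d; [by left|right].
  by rewrite (eq_bigr (fun v : 'I_n => (lab v == 0) : nat)) // => v _; rewrite E.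
Qed.

Lemma free_upd lab v l : v < n -> lab v = 0 -> l != 0 ->
  \sum_(w < n) (upd lab v l w == 0) + 1 = \sum_(w < n) (lab w == 0).
Proof.
move=> vn h l0; rewrite (bigD1 (Ordinal vn)) //= [in RHS](bigD1 (Ordinal vn)) //=.
rewrite updE eqxx (negPf l0) h eqxx add0n addnC; congr (_ + _).
apply: eq_bigr => w /eqP ne; rewrite updE; case: (eqVneq (w : nat) v) => [E|//].
by case: ne; apply: val_inj.
Qed.

(** The solution survives by [persistency], by [isol_del] or by the choice of the bit. Minimality of
    the bound survives because extending a labelling cannot lower the least cost; at a branching,
    maximality and [branching] rule out the old bound for both choices. *)
Lemma pinv_step h0 bt j lab B ok lab' B' ok' : pinv h0 j lab B ok ->
  stepX bt lab B ok lab' B' ok' ->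
  (forall u v, first (border lab) u v -> isol (upd lab v (if bt B then lab u else del)) k) ->
  pinv h0 j.+1 lab' B' ok'.
Proof.
move=> [r i f h d] s ch.
have Bk : B <= k.*2.
  rewrite leqNgt; apply/negP => lt; exact: (f _ lt (isol_feas i)).
have nf v l : lab v = 0 -> forall B', B' < B -> ~ feas (upd lab v l) B'.
  by move=> v0' B2 lt fe; apply: (f _ lt); apply: feas_ext fe; apply: ext_upd.
case: s => [[_ s]|[lt _ _ _]]; last by lia.
have r' : rng n lab' by apply: (@stepX_rng bt lab B ok lab' B' ok') => //; left.
case: s => [nfe E -> ->|u v fe [un vn [[h1 h2 h3] fe'] _] E -> ->|u v fe mx [un vn [h1 h2 h3] _] t E -> ->|u v fe mx fi t E -> ->|fe nb E -> ->].
- apply: pinv_eqlab (eqlab_sym E) _; split=> //.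
  + by move=> B2; rewrite ltnS leq_eqVlt => /orP[/eqP -> //|]; apply: f.
  + exact: leq_trans h _.
  + by case: d => d; [left|right; lia].
- apply: pinv_eqlab (eqlab_sym E) _; split=> //.
  + by apply: rng_upd => //; apply: r.
  + exact: (persistency e_sym h1 h3 vn i f fe').
  + exact: nf.
  + have l0 : lab u != 0 by rewrite (prp_neq h3).
    by case: d => d; [left|right]; have := free_upd vn h1 l0; lia.
- apply: pinv_eqlab (eqlab_sym E) _; split=> //.
  + exact: rng_upd.
  + exact: isol_del.
  + exact: nf.
  + by case: d => d; [left|right]; have := @free_upd lab v del vn h1 isT; lia.
- have is' := ch u v fi; have [un vn [h1 h2 h3] _] := fi.
  apply: pinv_eqlab (eqlab_sym E) _; split=> //.
  + by apply: rng_upd => //; case: ifP => // _; apply: r.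
  + move=> B2; rewrite ltnS leq_eqVlt => /orP[/eqP ->|]; last exact: nf.
    case: ifP => _; first by apply: mx.
    apply: (@branching n e lab v u B) => //.
    by move=> u' v' un' vn' a b c; apply: mx.
  + exact: leq_trans h _.
  + have l0 : (if bt B then lab u else del) != 0 by case: ifP; rewrite ?(prp_neq h3).
    by case: d => d; [left|right]; have := free_upd vn h1 l0; lia.
- by apply: pinv_eqlab (eqlab_sym E) _; split=> //; left.
Qed.

(** The bits are fixed along the run. At a branching with bound [B1] the bit there is set to the
    answer that keeps a solution; the earlier steps depend only on bits below [B1] and are not
    disturbed. After [N] steps the measure in [pinv] is exhausted, so the flag must be set. *)
Lemma trace_complete lab0 h0 N :
  (forall bt j, exists lab B ok, trace bt lab0 h0 j lab B ok) ->
  rng n lab0 -> isol lab0 k -> (forall B', B' < h0 -> ~ feas lab0 B') -> n + k.*2.+1 < N ->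
  exists bt, forall bt' lab B ok, (forall i, h0 <= i <= k.*2 -> bt i = bt' i) ->
    trace bt' lab0 h0 N lab B ok -> 0 < ok.
Proof.
move=> tot r0 i0 f0 NT.
have claim j : exists bt lab B ok, trace bt lab0 h0 j lab B ok /\ pinv h0 j lab B ok.
  elim: j => [|j [bt [lab [B [ok [t p]]]]]].
    exists (fun=> false), lab0, h0, 0; split=> //; split=> //; right.
    rewrite addn0; apply: leq_add; last exact: leq_subr.
    rewrite -[X in _ <= X]card_ord -sum1_card; apply: leq_sum => v _; exact: leq_b1.
  have [lab' [B' [ok' [lab1 [B1 [ok1 [t1 s1]]]]]]] := tot bt j.+1.
  have [//|E1 EB Eo] := trace_det t t1.
  have p1 : pinv h0 j lab1 B1 ok1 by rewrite -EB -Eo; apply: pinv_eqlab p.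
  have [b Hb] : exists b, forall u v, first (border lab1) u v ->
      isol (upd lab1 v (if b then lab1 u else del)) k.
    have [[[u v] fi]|nfi] := pselect (exists uv : nat * nat, first (border lab1) uv.1 uv.2); last first.
      by exists false => u v fi; case: nfi; exists (u, v).
    have [un vn [h1 h2 h3] _] := fi; have [_ i1 _ _ _] := p1.
    have uq u' v' : first (border lab1) u' v' -> u' = u /\ v' = v.
      by move=> fi'; apply: (first_uniq (P := border lab1) (P' := border lab1)) fi' fi.
    case: (isol_branch un vn h1 h2 h3 i1) => is1; [exists false|exists true];
      by move=> u' v' /uq[eu ev]; rewrite ?eu ev.
  pose bt' := fun i => if i == B1 then b else bt i.
  have [lab2 [B2 [ok2 [lab3 [B3 [ok3 [t3 s3]]]]]]] := tot bt' j.+1.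
  have [|E3 EB3 Eo3] := trace_det t1 t3.
    by move=> i /andP[_ lt]; rewrite /bt' ltn_eqF.
  have p3 : pinv h0 j lab3 B3 ok3 by rewrite -EB3 -Eo3; apply: pinv_eqlab p1.
  exists bt', lab2, B2, ok2; split; first by exists lab3, B3, ok3.
  apply: pinv_step p3 s3 _ => u v fi; rewrite -EB3 /bt' eqxx.
  have fi1 : first (border lab1) u v.
    case: fi => un vn bo H; split=> //; first exact: border_eq (eqlab_sym E3) un vn bo.
    by move=> u' v' un' vn' bf bo'; apply: (H u' v') => //; apply: border_eq E3 un' vn' bo'.
  have [un vn _ _] := fi.
  have := Hb u v fi1; apply: isol_eqlab; rewrite (E3 u un); exact: eqlab_upd.
have [bt [lab [B [ok [t [r i f h d]]]]]] := claim N.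
exists bt => bt' lab' B' ok' agr t'.
have Bk : B <= k.*2.
  rewrite leqNgt; apply/negP => lt; exact: (f _ lt (isol_feas i)).
have [|_ _ <-] := trace_det t t'.
  by move=> q /andP[q1 q2]; apply: agr; lia.
by case: d => // d; lia.
Qed.
End Run.

(** * Enumeration of the branching bits *)

Lemma bits_lt L (b : nat -> nat) : (forall i, b i <= 1) -> \sum_(d < L) b d * 2 ^ d < 2 ^ L.
Proof.
move=> b1; elim: L => [|L IH]; first by rewrite big_ord0.
rewrite big_ord_recr /= expnS mul2n -addnn -addSn leq_add //.
by have := leq_mul (b1 L) (leqnn (2 ^ L)); rewrite mul1n.
Qed.

Lemma bits_inj L (b b' : nat -> nat) : (forall i, b i <= 1) -> (forall i, b' i <= 1) ->
  \sum_(d < L) b d * 2 ^ d = \sum_(d < L) b' d * 2 ^ d -> forall d, d < L -> b d = b' d.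
Proof.
move=> b1 b1'; elim: L => [|L IH] //; rewrite !big_ord_recr /=.
have lt := bits_lt L b1; have lt' := bits_lt L b1'.
move: lt lt' IH; move: (\sum_(i < L) _) (\sum_(i < L) _) => x y lt lt' IH E d.
have EL : b L = b' L.
  move: (b1 L) (b1' L) E; case: (b L) => [|[|//]] _; case: (b' L) => [|[|//]] _; lia.
rewrite ltnS leq_eqVlt => /orP[/eqP -> //|]; apply: IH.
by move: E; rewrite EL; lia.
Qed.

Lemma sum_upd_nat N (F : nat -> nat -> nat) (f : nat -> nat) j y : j < N ->
  \sum_(i < N) F i (upd f j y i) + F j (f j) = \sum_(i < N) F i (f i) + F j y.
Proof.
move=> jN; rewrite (bigD1 (Ordinal jN)) //= [in RHS](bigD1 (Ordinal jN)) //= updE eqxx.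
rewrite (eq_bigr (fun i : 'I_N => F i (f i))); first by lia.
by move=> i /eqP ne; rewrite updE; case: eqP => // E; case: ne; apply: val_inj.
Qed.

(* A binary counter on the bits at positions [h0] to [2k], the only bounds at which a run can
   branch. *)
Definition Incr := hone vcy ;; HFor vI vk1 (HLt vI vh HSkip (hif vcy (HRd vD 4 vI v0 ;;
    HLt v0 vD (HWr 4 vI v0 v0) (HWr 4 vI v0 v1 ;; HZero vcy)))) ;;
  HLt v0 vcy (HZero vcont) HSkip.

Definition Body := Run ;; HLt v0 vok (hone vacc ;; HZero vcont) Incr.

Section Outer.
Variables (inp : nat -> option bool) (n : nat) (e : rel nat) (Q T k : nat).
Hypothesis e_sym : forall u v, e u v = e v u.
Hypothesis e_irr : forall v, e v v = false.
Hypothesis k_le : k <= n.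
Hypothesis Q_large : 6 * n + 3 < Q.
Hypothesis T_six : 6 * Q + 2 <= T.
Hypothesis T_sum : n * Q.*2 <= T.
Hypothesis T_bud : (n.*2.+1) * Q + n + 1 <= T.
Hypothesis T_iter : n.+2 * (n * (Q.*2 * Q.*2)) < T * T.
Variables (lab0 : nat -> nat) (h0 : nat).
Hypothesis lab0_rng : rng n lab0.
Hypothesis h0_le : h0 <= k.*2.+1.
Hypothesis h0_low : forall B', B' < h0 -> ~ feas n e lab0 B'.
Local Notation exec := (exec inp).
Local Notation gctx := (gctx n e Q T k).
Local Notation eqlab := (eqlab n).
Local Notation isol := (isol n e).
Local Notation trace := (trace n e k).

Definition bitb (s : hst) (i : nat) : bool := 0 < hm s 4 i 0.

Lemma turn_spec t : gctx t -> rng n (labs t) -> let t' := exec Turn t in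
  gctx t' /\ stepX n e k (bitb t) (labs t) (hv t vB) (hv t vok) (labs t') (hv t' vB) (hv t' vok).
Proof.
move=> g r t'; rewrite /t' /Turn execS execRd (g0 g).
set t1 := setv _ _ _.
have g1 : gctx t1 by apply: gctx_setv.
have b1 : (0 < hv t1 vb) = bitb t (hv t vB) by [].
have L1 : labs t1 = labs t by []. have B1 : hv t1 vB = hv t vB by [].
have k1 : hv t1 vok = hv t vok by [].
clearbody t1; have [le|lt] := leqP (hv t vB) k.*2.
  have E1 : eqlab (labs t1) (labs t) by rewrite L1.
  have [g2 S] := @step_spec inp n e Q T k e_sym e_irr k_le Q_large T_six T_sum T_bud T_iter
    (labs t) (hv t vB) (bitb t (hv t vB)) (hv t vok) t1 r le g1 E1 B1 b1 k1.
  by split=> //; left.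
rewrite /Step execLt B1 (gk1 g1) ltnS leqNgt lt /= execSkip L1 B1 k1.
by split=> //; right.
Qed.

Record pctx (s : hst) : Prop := Pctx {
  pg : gctx s; plab : forall v, v < n -> hm s 1 v 0 = lab0 v;
  ph : hv s vh = h0; p1 : hv s v1 = 1 }.

Lemma reset_spec s : pctx s -> let s' := exec Reset s in
  [/\ gctx s', eqlab (labs s') lab0, hv s' vB = h0, hv s' vok = 0 & hm s' 4 = hm s 4].
Proof.
move=> [g pl hh one] s'; rewrite /s' /Reset execS.
have L1 : eqlab (labs (exec (HFor vV vn (HRd vA 1 vV v0 ;; HWr 2 vV v0 vA)) s)) lab0.
  have := @exec_for_ind inp (fun i t => forall v, v < i -> labs t v = lab0 v) vV vn
    (HRd vA 1 vV v0 ;; HWr 2 vV v0 vA) s isT isT.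
  rewrite (gn g); apply; [by []| |by []].
  move=> i t iN I1 F M; set t1 := setv t vV i.
  have V1 : hv t1 vV = i by [].
  have z1 : hv t1 v0 = 0 := etrans (F v0 isT) (g0 g).
  have M1 : hm t1 1 = hm s 1 := M 1 isT.
  have {}I1 : forall v, v < i -> labs t1 v = lab0 v := I1.
  clearbody t1; rewrite execS execRd V1 z1 M1 pl //; set t2 := setv t1 vA _.
  have V2 : hv t2 vV = i by []. have z2 : hv t2 v0 = 0 by [].
  have A2 : hv t2 vA = lab0 i by [].
  have {}I1 : forall v, v < i -> labs t2 v = lab0 v := I1.
  clearbody t2; rewrite execWr V2 z2 A2 => v.
  rewrite /labs hm_setm /= upd2E andbT ltnS leq_eqVlt => /orP[E|vlt]; first by rewrite E (eqP E).
  by rewrite ltn_eqF //; apply: I1.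
set s1 := exec _ s in L1 *.
have g1 : gctx s1 by apply: gctx_exec.
have h1 : hv s1 vh = h0 by rewrite exec_mods.
have m1 : hm s1 4 = hm s 4 by rewrite exec_amods.
clearbody s1; rewrite execS execZero execS; set s2 := setv s1 vB 0.
have g2 : gctx s2 by apply: gctx_setv.
have h2 : hv s2 vh = h0 by []. have B2 : hv s2 vB = 0 by [].
have L2 : eqlab (labs s2) lab0 by []. have m2 : hm s2 4 = hm s 4 by [].
clearbody s2; have B3 := @exec_hadd inp vB vh vi s2 isT isT isT isT isT.
rewrite B2 h2 (gT g2) in B3; move/(_ isT): B3; rewrite (minn_idPr _); last by nia.
set s3 := exec _ s2 => B3.
have g3 : gctx s3 by apply: gctx_exec.
have L3 : eqlab (labs s3) lab0 by rewrite (@labs_eq s2) // exec_amods.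
have m3 : hm s3 4 = hm s 4 by rewrite exec_amods.
clearbody s3; rewrite execZero; split=> //; exact: gctx_setv.
Qed.

Lemma run_trace s : pctx s ->
  exists lab B, trace (bitb s) lab0 h0 T lab B (hv (exec Run s) vok).
Proof.
move=> p; have := reset_spec p; rewrite /Run execS.
set s1 := exec Reset s; move=> [g1 L1 B1 k1 m1]; clearbody s1.
have := @exec_for_ind inp (fun j t => [/\ gctx t, rng n (labs t) &
  trace (bitb s) lab0 h0 j (labs t) (hv t vB) (hv t vok)]) vst vT Turn s1 isT isT.
rewrite (gT g1) => H.
have [] := H _ _ _; last by move=> g2 r2 t2; exists (labs (exec (HFor vst vT Turn) s1)), (hv (exec (HFor vst vT Turn) s1) vB).
- by split=> //; apply: eqlab_rng (eqlab_sym L1) lab0_rng.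
- move=> i t iT [gt rt tr] F M.
  have g2 : gctx (setv t vst i) by apply: gctx_setv.
  have [g3 S] := turn_spec g2 rt; split=> //; first exact: stepX_rng S rt.
  exists (labs t), (hv t vB), (hv t vok); split=> //.
  have -> // : bitb s = bitb (setv t vst i).
  by rewrite /bitb hm_setv -m1 M.
- by move=> i t j [gt rt tr]; split=> //; apply: gctx_setv.
Qed.

(** The program itself provides the next step of the relation: it is executed on a state whose array
    4 holds the bits [bt]. *)
Lemma trace_total s : pctx s -> forall bt j, exists lab B ok, trace bt lab0 h0 j lab B ok.
Proof.
move=> [g pl hh one] bt j.
pose s0 := HS (hv s) (upd (hm s) 4 (fun i _ => bt i)).
have p0 : pctx s0 by split=> //; case: g => *; split.
have [g1 L1 B1 k1 m1] := reset_spec p0.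
have b0 : bitb s0 = bt by apply: funext => i; rewrite /bitb /= updE eqxx; case: (bt i).
suff [t [gt rt mt tr]] : exists t, [/\ gctx t, rng n (labs t), bitb t = bt &
   trace bt lab0 h0 j (labs t) (hv t vB) (hv t vok)].
  by exists (labs t), (hv t vB), (hv t vok).
elim: j => [|j [t [gt rt mt tr]]].
  exists (exec Reset s0); split=> //; first exact: eqlab_rng (eqlab_sym L1) lab0_rng.
  by rewrite /bitb m1 -/(bitb s0).
have [g2 S] := turn_spec gt rt; exists (exec Turn t); split=> //.
- exact: stepX_rng S rt.
- by rewrite /bitb exec_amods.
- by exists (labs t), (hv t vB), (hv t vok); rewrite -{2}mt.
Qed.

Lemma run_sound s : pctx s -> 0 < hv (exec Run s) vok -> isol lab0 k.
Proof.
by move=> p; have [lab [B /(trace_sound e_sym lab0_rng)[_ _]]] := run_trace p.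
Qed.

Local Notation L := (k.*2.+1 - h0).
Definition bval (s : hst) := \sum_(d < L) hm s 4 (h0 + d) 0 * 2 ^ d.
Definition bits01 (s : hst) := forall i, hm s 4 i 0 <= 1.

(** [j] is the binary code of the bits from [trace_complete]. By [bits_inj] a counter with this
    value holds exactly these bits in the range from [h0] to [2k]. *)
Lemma run_complete s : pctx s -> isol lab0 k ->
  exists2 j, j < 2 ^ L & forall s', pctx s' -> bits01 s' -> bval s' = j -> 0 < hv (exec Run s') vok.
Proof.
move=> p is0.
have [|bt H] := trace_complete e_sym k_le Q_large T_six T_sum T_bud T_iter (N := T) (trace_total p) lab0_rng is0 h0_low.
  by nia.
pose b i := (bt i : nat).
exists (\sum_(d < L) b (h0 + d) * 2 ^ d).
  by apply: (@bits_lt L (fun d => b (h0 + d))) => i; rewrite /b; case: (bt _).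
move=> s' p' b1 E; have [lab [B t]] := run_trace p'.
apply: H t => i /andP[i1 i2].
have := @bits_inj L (fun d => hm s' 4 (h0 + d) 0) (fun d => b (h0 + d)) (fun d => b1 _) _ E.
have b2 d : b (h0 + d) <= 1 by rewrite /b; case: (bt _).
move=> /(_ b2 (i - h0)); rewrite subnKC // /bitb => ->; last by lia.
by rewrite /b; case: (bt i).
Qed.

Lemma pctx_exec p s : gkeeps p -> 1 \notin amods p -> vh \notin mods p -> v1 \notin mods p ->
  pctx s -> pctx (exec p s).
Proof.
move=> kp m1 hp op [g pl hh one]; split; rewrite ?exec_mods //; first exact: gctx_exec.
by move=> v vn'; rewrite exec_amods // pl.
Qed.

Lemma incr_spec s : pctx s -> bits01 s -> let s' := exec Incr s in
  [/\ pctx s', bits01 s', hv s' vacc = hv s vacc &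
    (bval s' = (bval s).+1 /\ hv s' vcont = hv s vcont) \/
    ((bval s).+1 = 2 ^ L /\ hv s' vcont = 0)].
Proof.
move=> p b01 s'.
have ps' : pctx s' by apply: pctx_exec.
have as' : hv s' vacc = hv s vacc by rewrite /s' exec_mods.
rewrite /s' /Incr execS in ps' as' *; have g := pg p.
have T0 : 0 < T by lia.
have c1 : hv (exec (hone vcy) s) vcy = 1 by apply: exec_hone; rewrite ?(gT g).
set s1 := exec (hone vcy) s in c1 ps' as' *.
have p1' : pctx s1 by apply: pctx_exec.
have m1 : hm s1 4 = hm s 4 by rewrite exec_amods.
have t1 : hv s1 vcont = hv s vcont by rewrite exec_mods.
have val1 : bval s1 = bval s by rewrite /bval m1.
clearbody s1; rewrite execS in ps' as' *.
set body := HLt vI vh _ _ in ps' as' *.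
(* Carry invariant: counter plus carry times the current weight is the old value plus 1. For
   [i < h0] the truncated difference keeps the weight at 1. *)
have := @exec_for_ind inp (fun i t => [/\ bits01 t, hv t vcy <= 1 &
   bval t + hv t vcy * 2 ^ (i - h0) = (bval s).+1]) vI vk1 body s1 isT isT.
have g1 := pg p1'; rewrite (gk1 g1) => H.
have {H} [] := H _ _ _.
- by split; rewrite ?c1 //; [move=> i; rewrite m1|rewrite val1 sub0n; lia].
- move=> i t iL [bt ct vt] F M; set t1' := setv t vI i.
  have I2 : hv t1' vI = i by [].
  have z2 : hv t1' v0 = 0 := etrans (F v0 isT) (g0 g1).
  have o2 : hv t1' v1 = 1 := etrans (F v1 isT) (p1 p1').
  have h2 : hv t1' vh = h0 := etrans (F vh isT) (ph p1').
  have c2 : hv t1' vcy <= 1 := ct. have b2 : bits01 t1' := bt.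
  have e2 : bval t1' + hv t1' vcy * 2 ^ (i - h0) = (bval s).+1 := vt.
  clearbody t1'; clear t bt ct vt F M; move: t1' I2 z2 o2 h2 c2 b2 e2 => t It zt ot ht ct bt vt.
  rewrite /body execLt It ht; case: (ltnP i h0) => ih.
    rewrite execSkip; split=> //; rewrite -vt; congr (_ + _ * 2 ^ _); lia.
  rewrite execIf zt; case: (ltnP 0 (hv t vcy)) => c0; last first.
    by split=> //; rewrite -vt; have -> : hv t vcy = 0 by lia.
  have {}ct : hv t vcy = 1 by lia.
  have dL : i - h0 < L by lia.
  have VU (x : nat) (t' : hst) : hm t' 4 = upd2 (hm t 4) i 0 x ->
     bval t' + hm t 4 i 0 * 2 ^ (i - h0) = bval t + x * 2 ^ (i - h0).
    move=> E; rewrite /bval.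
    have := @sum_upd_nat L (fun d y => y * 2 ^ d) (fun d => hm t 4 (h0 + d) 0) (i - h0) x dL.
    rewrite /= subnKC // => <-; congr (_ + _); apply: eq_bigr => d _.
    rewrite E upd2E andbT updE; congr (_ * _).
    have -> : (h0 + d == i) = (d == i - h0 :> nat) by lia.
    by [].
  have BU (x : nat) (t' : hst) : x <= 1 -> hm t' 4 = upd2 (hm t 4) i 0 x -> bits01 t'.
    by move=> x1 E q; rewrite E upd2E; case: ifP.
  have e2 : 2 ^ (i.+1 - h0) = 2 * 2 ^ (i - h0) by rewrite subSn // expnS.
  rewrite execS execRd It zt; set t2 := setv t vD _.
  have I2 : hv t2 vI = i by []. have z2 : hv t2 v0 = 0 by []. have o2 : hv t2 v1 = 1 by [].
  have D2 : hv t2 vD = hm t 4 i 0 by []. have m2 : hm t2 4 = hm t 4 by [].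
  have c2 : hv t2 vcy = 1 by [].
  clearbody t2; rewrite execLt z2 D2; case: (ltnP 0 (hm t 4 i 0)) => d0.
    have d1 : hm t 4 i 0 = 1 by have := bt i; lia.
    rewrite execWr I2 z2; set t3 := setm _ _ _ _ _.
    have m3 : hm t3 4 = upd2 (hm t 4) i 0 0 by rewrite hm_setm /= m2.
    have c3 : hv t3 vcy = 1 by [].
    clearbody t3; have := VU 0 t3 m3; rewrite d1 ct in vt * => vt3.
    by split; [exact: BU m3|rewrite c3|rewrite c3 e2; lia].
  have d1 : hm t 4 i 0 = 0 by lia.
  rewrite execS execWr execZero I2 z2 o2; set t3 := setv _ _ _.
  have m3 : hm t3 4 = upd2 (hm t 4) i 0 1 by rewrite hm_setv hm_setm /= m2.
  have c3 : hv t3 vcy = 0 by [].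
  clearbody t3; have := VU 1 t3 m3; rewrite d1 ct in vt * => vt3.
  by split; [exact: BU m3|rewrite c3|rewrite c3; lia].
- by [].
set s2 := exec (HFor vI vk1 body) s1 in ps' as' *.
have p2 : pctx s2 by apply: pctx_exec.
have t2 : hv s2 vcont = hv s vcont by rewrite exec_mods.
clearbody s2 => b2 c2 v2; rewrite execLt (g0 (pg p2)) in ps' as' *.
case: (ltnP 0 (hv s2 vcy)) ps' as' => c0 ps' as'.
  rewrite execZero; split=> //; right; split=> //.
  have c3 : hv s2 vcy = 1 by lia.
  rewrite c3 mul1n in v2; apply/eqP; rewrite eqn_leq -{2}v2 leq_addl andbT.
  exact: (@bits_lt L (fun d => hm s 4 (h0 + d) 0)).
rewrite execSkip; split=> //; left; split=> //.
by move: v2; have -> : hv s2 vcy = 0; [lia | rewrite mul0n addn0].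
Qed.

(** Induction on the number [r] of counter values left. If a solution exists, a successful value
    [js] is fixed beforehand, and the counter cannot pass it without acceptance; so an overflow
    without acceptance refutes every solution. *)
Theorem outer_loop s : pctx s -> bits01 s -> bval s = 0 -> hv s vacc = 0 -> 0 < hv s vcont ->
  exists J, [/\ 0 < J <= 2 ^ L, forall j, j < J -> 0 < hv (iter j (exec Body) s) vcont,
    hv (iter J (exec Body) s) vcont = 0 &
    0 < hv (iter J (exec Body) s) vacc <-> isol lab0 k].
Proof.
move=> p b01 v0' a0 c0.
have T0 : 0 < T by lia.
have [js Hjs] : exists js, isol lab0 k -> js < 2 ^ L /\
   forall s', pctx s' -> bits01 s' -> bval s' = js -> 0 < hv (exec Run s') vok.
  have [is0|ni] := pselect (isol lab0 k); last by exists 0.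
  by have [j h1 h2] := run_complete p is0; exists j.
suff H r j t : r + j = 2 ^ L -> 0 < r -> pctx t -> bits01 t -> bval t = j -> hv t vacc = 0 ->
   0 < hv t vcont -> (isol lab0 k -> j <= js) ->
   exists J, [/\ 0 < J <= r, forall j, j < J -> 0 < hv (iter j (exec Body) t) vcont,
    hv (iter J (exec Body) t) vcont = 0 &
    0 < hv (iter J (exec Body) t) vacc <-> isol lab0 k].
  by apply: (H _ 0) => //; rewrite ?addn0 ?expn_gt0.
elim: r j t => // r IH j t E _ pt bt vt at_ ct jjs.
have EB : exec Body t = exec (HLt v0 vok (hone vacc ;; HZero vcont) Incr) (exec Run t).
  by rewrite /Body execS.
have snd := run_sound pt.
have cmp : isol lab0 k -> j = js -> 0 < hv (exec Run t) vok.
  by move=> /Hjs[_ H] ej; apply: H; rewrite ?vt.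
set t1 := exec Run t in EB snd cmp.
have pt1 : pctx t1 by apply: pctx_exec.
have bt1 : bits01 t1 by move=> i; rewrite exec_amods.
have vt1 : bval t1 = j by rewrite -vt /bval exec_amods.
have at1 : hv t1 vacc = 0 by rewrite exec_mods.
have ct1 : 0 < hv t1 vcont by rewrite exec_mods.
clearbody t1; rewrite execLt (g0 (pg pt1)) in EB.
case: (ltnP 0 (hv t1 vok)) EB => ok EB.
  exists 1; rewrite /= EB execS execZero; split=> //; first by case.
  rewrite hv_setv /= exec_hone ?(gT (pg pt1)) //; split=> // _; exact: snd.
have [pt2 bt2 at2 H] := incr_spec pt1 bt1.
rewrite -EB at1 vt1 in pt2 bt2 at2 H.
case: H => [[vt2 ct2]|[ov ct2]].
  have r0 : 0 < r.
    have := @bits_lt L (fun d => hm (exec Body t) 4 (h0 + d) 0) (fun _ => bt2 _).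
    rewrite -/(bval (exec Body t)) vt2; lia.
  have [||is0|J [J1 J2 J3 J4]] := IH j.+1 (exec Body t) _ r0 pt2 bt2 vt2 at2.
  - by lia.
  - by rewrite ct2.
  - rewrite ltn_neqAle jjs // andbT; apply/eqP => ej.
    by have := cmp is0 ej; lia.
  exists J.+1; rewrite !iterSr; split=> //; first by case/andP: J1.
  by case=> // i; rewrite iterSr; apply: J2.
exists 1; rewrite /=; split=> //; first by case.
rewrite at2; split=> // is0; have [h1 _] := Hjs is0.
have ej : j = js by have := jjs is0; lia.
by have := cmp is0 ej; lia.
Qed.
End Outer.

(** * Reading the instance *)

Notation vstop := 43 (only parsing).
Notation vidx := 44 (only parsing).
Notation vk := 45 (only parsing).
Notation vpw := 46 (only parsing).
Notation vt := 47 (only parsing).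

Definition PSize := HFor vi vm (HLt v0 vstop HSkip (HIn vi (HInc vn) (HInc vstop))).

Definition PVars := hadd vn1 vn vj ;; HInc vn1 ;; hadd vn2 vn1 vj ;; HInc vn2 ;;
  hadd vidx vn1 vj ;; hone v1 ;;
  hadd vq vm vj ;; hadd vq vm vj ;; hadd vq vm vj ;; hadd vq vm vj ;;
  hadd vq vm vj ;; hadd vq vm vj ;; hadd vq vm vj ;; hadd vq vm vj ;;
  hadd vq2 vq vj ;; hadd vq2 vq vj.

Definition PAdj := HFor vu vn (HFor vv vn (HIn vidx (HWr 0 vu vv v1) HSkip ;; HInc vidx)).

Definition PLab := HFor vv vn (HInc vt ;; HIn vidx (HWr 1 vv v0 vt) HSkip ;; HInc vidx).

(* The budget is read with saturation at [T] and then capped at [n]. *)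
Definition PBud := hone vpw ;;
  HFor vi vm (HIn vidx (hadd vk vpw vj) HSkip ;; HZero vt ;; hadd vt vpw vj ;;
    hadd vpw vt vj ;; HInc vidx) ;;
  HLt vn vk (HZero vk ;; hadd vk vn vj) HSkip ;;
  hadd vk1 vk vj ;; hadd vk1 vk vj ;; HInc vk1.

(* Computes the least feasible bound [h0], capped at [2k + 1]. *)
Definition PLow := Reset ;; HFor vst vk1 (Oracle ;; HLt v0 vfd HSkip (HInc vB)) ;;
  hadd vh vB vj ;; hone vcont.

Definition Init := PSize ;; PVars ;; PAdj ;; PLab ;; PBud ;; PLow.

(** A symbolic store: the known values of variables as a list, on which the effect of straight-line
    programs is computed. *)
Definition vals (l : seq (nat * nat)) (s : hst) := all (fun q => hv s q.1 == q.2) l.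

Arguments vals : simpl never.

Fixpoint look (l : seq (nat * nat)) (x : nat) : option nat :=
  if l is (y, a) :: l' then if y == x then Some a else look l' x else None.

Lemma vget x l s a : vals l s -> look l x = Some a -> hv s x = a.
Proof.
by rewrite /vals; elim: l => //= -[y b] l IH /andP[/= /eqP Eq v]; case: eqP => [<- [<-]|_]; [|exact: IH].
Qed.

Arguments vget x [l s a].

Lemma vals_sub l l' s : vals l s -> all (fun q => look l q.1 == Some q.2) l' -> vals l' s.
Proof. by move=> v /allP a; apply/allP => q /a /eqP /(vget _ v) ->. Qed.

Lemma vals_cat l l' s : vals l s -> vals l' s -> vals (l ++ l') s.
Proof. by rewrite /vals all_cat => -> ->. Qed.

Lemma vals_frame inp p l s : vals l s -> vals [seq q <- l | q.1 \notin mods p] (exec inp p s).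
Proof.
move=> /allP v; apply/allP => q; rewrite mem_filter => /andP[qm ql].
by rewrite exec_mods // v.
Qed.

Lemma vals_step inp p x c l s : vals l s -> hv (exec inp p s) x = c ->
  vals ((x, c) :: [seq q <- l | q.1 \notin mods p]) (exec inp p s).
Proof. by move=> v E; rewrite /vals /= E eqxx; exact: vals_frame. Qed.

Lemma vals_hadd inp x y t a b T l s : vals l s -> 
  look l 0 = Some T -> look l x = Some a -> look l y = Some b ->
  [&& x != t, y != t, y != x, x != 0 & t != 0] -> a + b <= T ->
  vals ((x, a + b) :: [seq q <- l | q.1 \notin mods (hadd x y t)]) (exec inp (hadd x y t) s).
Proof.
move=> v l0 lx ly /and5P[h1 h2 h3 h4 h5] le; apply: vals_step => //.
have := exec_hadd inp h1 h2 h3 h4 h5.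
move=> ->; rewrite (vget 0 v l0) (vget x v lx) ?(vget y v ly); first exact/minn_idPr.
by lia.
Qed.

Lemma vals_inc inp x a T l s : vals l s -> look l 0 = Some T -> look l x = Some a -> a < T ->
  vals ((x, a.+1) :: [seq q <- l | q.1 \notin mods (HInc x)]) (exec inp (HInc x) s).
Proof.
move=> v l0 lx le; apply: vals_step => //.
by rewrite execInc (vget 0 v l0) (vget x v lx) le hv_setv eqxx.
Qed.

Lemma vals_hone inp x T l s : vals l s -> look l 0 = Some T -> 0 < T -> x != 0 ->
  vals ((x, 1) :: [seq q <- l | q.1 \notin mods (hone x)]) (exec inp (hone x) s).
Proof. by move=> v l0 T0 x0; apply: vals_step => //; rewrite exec_hone // (vget 0 v l0). Qed.

Lemma pair_lt n u v : u < n -> v < n -> u * n + v < n * n.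
Proof.
move=> un vn; apply: (@leq_trans (u.+1 * n)); first by rewrite mulSnr ltn_add2l.
by rewrite leq_mul2r un orbT.
Qed.

Lemma pair_eq n u v i j : v < n -> j < n -> (u * n + v == i * n + j) = (u == i) && (v == j).
Proof.
move=> vn jn; have n0 : 0 < n by lia.
apply/eqP/andP => [E|[/eqP-> /eqP->]] //.
have := congr1 (divn^~ n) E; rewrite /= !divnMDl // !divn_small // !addn0 => ui.
by rewrite ui in E *; split=> //; apply/eqP; lia.
Qed.

(** Cutting at [T] commutes with addition, so sums of saturated values need only one further cut. *)
Lemma minn_add T a b : minn T (minn T a + minn T b) = minn T (a + b).
Proof. by lia. Qed.

Section Sizes.
Variables n m : nat.
Hypothesis m_gt : n.+1 < m.
(* [m] is the length of the input. *)
Let Q := 8 * m.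
Let T := 64 * (m * m).

Lemma Q_large_m : 6 * n + 3 < Q. Proof. by rewrite /Q; lia. Qed.
Lemma six_Q_le : 6 * Q + 2 <= T. Proof. by rewrite /Q /T; nia. Qed.
Lemma sum_le : n * Q.*2 <= T. Proof. by rewrite /Q /T; nia. Qed.
Lemma budget_le : (n.*2.+1) * Q + n + 1 <= T. Proof. by rewrite /Q /T; nia. Qed.
Lemma sweeps_le : n.+2 * (n * (Q.*2 * Q.*2)) < T * T.
Proof.
have h : n.+2 * n < m * m * 16 by nia.
have -> : n.+2 * (n * (Q.*2 * Q.*2)) = n.+2 * n * (256 * (m * m)) by rewrite /Q -!muln2; ring.
have -> : T * T = m * m * 16 * (256 * (m * m)) by rewrite /T; ring.
by rewrite ltn_pmul2r //; nia.
Qed.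
Lemma T_big : n.+1 + n * n + n + m + m + 200 <= T. Proof. by rewrite /T; nia. Qed.

End Sizes.

Section Init.
Variables (inp : nat -> option bool) (n m : nat) (e : rel nat) (tm : nat -> bool) (bud : nat).
Hypothesis m_gt : n.+1 < m.
Let Q := 8 * m.
Let T := 64 * (m * m).
Hypothesis inp1 : forall i, i < n -> inp i = Some true.
Hypothesis inp0 : inp n = Some false.
Hypothesis inpA : forall u v, u < n -> v < n -> (inp (n.+1 + (u * n + v)) == Some true) = e u v.
Hypothesis inpT : forall v, v < n -> (inp (n.+1 + n * n + v) == Some true) = tm v.
Hypothesis inpB : forall i, i < m -> (inp (n.+1 + n * n + n + i) == Some true) = odd (bud %/ 2 ^ i).
Hypothesis bud_lt : bud < 2 ^ m.
Hypothesis e_sym : forall u v, e u v = e v u.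
Hypothesis e_irr : forall v, e v v = false.
Local Notation exec := (exec inp).
Let k := minn bud n.
Definition labT v := if tm v then v.+1 else 0.

Lemma size_spec s : vals [:: (0, T); (vm, m); (v0, 0); (vn, 0); (vstop, 0)] s ->
  hv (exec PSize s) vn = n.
Proof.
move=> v; have tb := T_big m_gt.
have := @exec_for_ind inp (fun i t => hv t vn = minn i n /\ hv t vstop = (n < i)) vi vm
  (HLt v0 vstop HSkip (HIn vi (HInc vn) (HInc vstop))) s isT isT.
rewrite (vget vm v erefl) => H; have [] := H _ _ _.
- by rewrite (vget vn v erefl) (vget vstop v erefl) min0n.
- move=> i s' im [E1 E2] F M; set t := setv s' vi i.
  have i1 : hv t vi = i by [].
  have {}E1 : hv t vn = minn i n by []. have {}E2 : hv t vstop = (n < i) by [].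
  have z1 : hv t v0 = 0 := etrans (F v0 isT) (vget v0 v erefl).
  have t1 : hv t 0 = T := etrans (F 0 isT) (vget 0 v erefl).
  clearbody t; rewrite execLt z1 E2; case: (ltnP n i) => ni /=.
    by rewrite execSkip E1 E2 ni; lia.
  rewrite execIn i1 !execInc t1 E1 E2 /=.
  have [lt|ge] := ltnP i n.
    rewrite inp1 //= (_ : i < T); last by lia.
    by rewrite !hv_setv /= E2; lia.
  have -> : i = n by lia.
  rewrite inp0 /= ltnn /= (_ : 0 < T); last by lia.
  by rewrite !hv_setv /= E1; lia.
- by [].
- by move=> -> _; rewrite (minn_idPr _) // ltnW // ltnW.
Qed.

Lemma vars_spec s :
  vals [:: (0, T); (vm, m); (v0, 0); (vn, n); (vn1, 0); (vn2, 0); (vidx, 0); (vq, 0); (vq2, 0)] s ->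
  vals [:: (0, T); (vm, m); (v0, 0); (vn, n); (vn1, n.+1); (vn2, n.+2); (vidx, n.+1);
          (v1, 1); (vq, Q); (vq2, Q.*2)] (exec PVars s).
Proof.
move=> v; have tb := T_big m_gt; have h6 : 128 * m <= T by rewrite /T; nia.
rewrite /PVars.
rewrite execS; have {}v := vals_hadd inp (x := vn1) (y := vn) (t := vj) v erefl erefl erefl isT ltac:(lia);
  move: (exec _ s) v => {}s /= v.
rewrite execS; have {}v := vals_inc inp (x := vn1) v erefl erefl ltac:(lia);
  move: (exec _ s) v => {}s /= v.
rewrite execS; have {}v := vals_hadd inp (x := vn2) (y := vn1) (t := vj) v erefl erefl erefl isT ltac:(lia);
  move: (exec _ s) v => {}s /= v.
rewrite execS; have {}v := vals_inc inp (x := vn2) v erefl erefl ltac:(lia);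
  move: (exec _ s) v => {}s /= v.
rewrite execS; have {}v := vals_hadd inp (x := vidx) (y := vn1) (t := vj) v erefl erefl erefl isT ltac:(lia);
  move: (exec _ s) v => {}s /= v.
rewrite execS; have {}v := vals_hone inp (x := v1) v erefl ltac:(lia) isT;
  move: (exec _ s) v => {}s /= v.
do 8 (rewrite execS; have {}v := vals_hadd inp (x := vq) (y := vm) (t := vj) v erefl erefl erefl isT ltac:(lia);
  move: (exec _ s) v => {}s /= v).
rewrite execS; have {}v := vals_hadd inp (x := vq2) (y := vq) (t := vj) v erefl erefl erefl isT ltac:(lia);
  move: (exec _ s) v => {}s /= v.
have {}v := vals_hadd inp (x := vq2) (y := vq) (t := vj) v erefl erefl erefl isT ltac:(lia);
  move: (exec _ s) v => {}s /= v.
rewrite /vals /= (vget 0 v erefl) (vget vm v erefl) (vget v0 v erefl) (vget vn v erefl) (vget vn1 v erefl) (vget vn2 v erefl) (vget vidx v erefl) (vget v1 v erefl) (vget vq v erefl) (vget vq2 v erefl) /Q; lia.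
Qed.

Lemma adj_spec s : vals [:: (0, T); (vn, n); (v0, 0); (vidx, n.+1); (v1, 1)] s ->
  (forall u v, hm s 0 u v = 0) ->
  hv (exec PAdj s) vidx = n.+1 + n * n /\
  forall u v, u < n -> v < n -> hm (exec PAdj s) 0 u v = e u v.
Proof.
move=> vs m0; have tb := T_big m_gt.
(* [c] is the number of matrix entries read so far in row-major order. *)
pose I c t := hv t vidx = n.+1 + c /\
  forall u v, u < n -> v < n -> hm t 0 u v = (u * n + v < c) && e u v.
set inner := HFor vv vn (HIn vidx (HWr 0 vu vv v1) HSkip ;; HInc vidx).
have := @exec_for_ind inp (fun i => I (i * n)) vu vn inner s isT isT.
rewrite (vget vn vs erefl) => H; have [] := H _ _ _.
- by split; [rewrite (vget vidx vs erefl) mul0n addn0 | move=> u v _ _; rewrite m0 mul0n].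
- move=> i s' iN Is F _; set t := setv s' vu i.
  have u1 : hv t vu = i by [].
  have {}Is : I (i * n) t by [].
  have a0 : hv t 0 = T := etrans (F 0 isT) (vget 0 vs erefl).
  have a1 : hv t vn = n := etrans (F vn isT) (vget vn vs erefl).
  have a2 : hv t v0 = 0 := etrans (F v0 isT) (vget v0 vs erefl).
  have a3 : hv t v1 = 1 := etrans (F v1 isT) (vget v1 vs erefl).
  clearbody t; clear s' F.
  have vt : vals [:: (0, T); (vn, n); (v0, 0); (v1, 1)] t by rewrite /vals /= a0 a1 a2 a3 !eqxx.
  have := @exec_for_ind inp (fun j => I (i * n + j)) vv vn
    (HIn vidx (HWr 0 vu vv v1) HSkip ;; HInc vidx) t isT isT.
  rewrite (vget vn vt erefl) mulSnr; apply; first by rewrite addn0.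
  + move=> j s' jN [Is1 Is2] F _; rewrite execS; set t' := setv s' vv j.
    have v1' : hv t' vv = j by [].
    have u1' : hv t' vu = i := etrans (F vu isT) u1.
    have o1' : hv t' v1 = 1 := etrans (F v1 isT) (vget v1 vt erefl).
    have T' : hv t' 0 = T := etrans (F 0 isT) (vget 0 vt erefl).
    have {}Is1 : hv t' vidx = n.+1 + (i * n + j) by [].
    have {}Is2 : forall u v, u < n -> v < n -> hm t' 0 u v = (u * n + v < i * n + j) && e u v by [].
    clearbody t'; clear s' F.
    have E3 u v : u < n -> v < n ->
      (u * n + v < i * n + j.+1) = (u * n + v < i * n + j) || (u == i) && (v == j).
      by move=> un vn'; rewrite addnS ltnS leq_eqVlt orbC pair_eq.
    have lt : n.+1 + (i * n + j) < T by have := pair_lt iN jN; lia.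
    rewrite execIn Is1 inpA //; case: ifP => eij.
      rewrite execWr exec_Inc !hv_setm ?Is1 ?T' // u1' v1' o1'; split.
        by rewrite hv_setv eqxx; lia.
      move=> u v un vn'; rewrite hm_setv hm_setm /= upd2E E3 //.
      by case: (boolP ((u == i) && (v == j))) => [/andP[/eqP-> /eqP->]|_]; rewrite ?eij ?orbT // orbF Is2.
    rewrite execSkip exec_Inc ?Is1 ?T' //; split; first by rewrite hv_setv eqxx; lia.
    move=> u v un vn'; rewrite hm_setv E3 // Is2 //.
    by case: (eqVneq u i) => [->|]; rewrite ?orbF //; case: (eqVneq v j) => [->|]; rewrite ?eij ?andbF ?orbF.
  + by move=> j s' x [].
- by move=> i s' j [].
- by move=> h1 h2; split=> // u v un vn'; rewrite h2 //; rewrite pair_lt.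
Qed.

Lemma lab_spec s : vals [:: (0, T); (vn, n); (v0, 0); (vidx, n.+1 + n * n); (vt, 0)] s ->
  (forall u v, hm s 1 u v = 0) ->
  hv (exec PLab s) vidx = n.+1 + n * n + n /\
  forall v, v < n -> hm (exec PLab s) 1 v 0 = labT v.
Proof.
move=> vs m0; have tb := T_big m_gt.
have := @exec_for_ind inp (fun i t => [/\ hv t vidx = n.+1 + n * n + i, hv t vt = i &
  forall v, v < n -> hm t 1 v 0 = if v < i then labT v else 0]) vv vn
  (HInc vt ;; HIn vidx (HWr 1 vv v0 vt) HSkip ;; HInc vidx) s isT isT.
rewrite (vget vn vs erefl) => H; have [] := H _ _ _.
- by split=> [||v _]; rewrite ?(vget vidx vs erefl) ?(vget vt vs erefl) ?addn0.
- move=> j s' jN [Is1 Is3 Is2] F _; rewrite execS; set t' := setv s' vv j.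
  have v1' : hv t' vv = j by [].
  have z1' : hv t' v0 = 0 := etrans (F v0 isT) (vget v0 vs erefl).
  have T' : hv t' 0 = T := etrans (F 0 isT) (vget 0 vs erefl).
  have {}Is1 : hv t' vidx = n.+1 + n * n + j by [].
  have {}Is3 : hv t' vt = j by [].
  have {}Is2 : forall v, v < n -> hm t' 1 v 0 = if v < j then labT v else 0 by [].
  clearbody t'; clear s' F.
  have lt : n.+1 + n * n + j < T by lia.
  have jT : j < T by lia.
  rewrite exec_Inc ?Is3 ?T' //; set t2 := setv _ _ _.
  have {}Is1 : hv t2 vidx = n.+1 + n * n + j by [].
  have {}v1' : hv t2 vv = j by []. have {}z1' : hv t2 v0 = 0 by [].
  have {}T' : hv t2 0 = T by []. have {}Is3 : hv t2 vt = j.+1 by [].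
  have {}Is2 : forall v, v < n -> hm t2 1 v 0 = if v < j then labT v else 0 by [].
  clearbody t2; rewrite execS execIn Is1 inpT //; case: ifP => tj.
    rewrite execWr exec_Inc !hv_setm ?Is1 ?T' // z1' v1' Is3; split=> //.
      by rewrite hv_setv eqxx; lia.
    move=> v vn'; rewrite hm_setv hm_setm /= upd2E andbT ltnS leq_eqVlt.
    by case: (eqVneq v j) => [->|_] /=; rewrite /labT ?tj ?Is2.
  rewrite execSkip exec_Inc ?Is1 ?T' //; split=> //; first by rewrite hv_setv eqxx; lia.
  move=> v vn'; rewrite hm_setv Is2 // ltnS [v <= j]leq_eqVlt.
  by case: (eqVneq v j) => [->|_] //; rewrite ltnn orTb /labT tj.
- by move=> i s' j [].
- by move=> h1 _ h2; split=> // v vn'; rewrite h2 // vn'.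
Qed.

(** Lowest digit first: after [i] digits [vk] holds the budget modulo [2 ^ i] and [vpw] the weight
    [2 ^ i], both cut at [T]. The loop runs past the end of the input, where blanks act as zero
    digits. As [T >= n], the final cap gives [minn bud n] in spite of the saturation. *)
Lemma bud_spec s :
  vals [:: (0, T); (vm, m); (v0, 0); (vn, n); (vidx, n.+1 + n * n + n); (vk, 0); (vk1, 0)] s ->
  hv (exec PBud s) vk1 = k.*2.+1.
Proof.
move=> vs; have tb := T_big m_gt; have T0 : 0 < T by lia.
rewrite /PBud execS; have {}vs := vals_hone inp (x := vpw) vs erefl T0 isT.
move: (exec _ s) vs => {}s /= vs.
set body := HIn vidx _ _ ;; _; set p := HLt vn vk _ _ ;; _.
have := @exec_for_ind inp (fun i t => [/\ hv t vidx = n.+1 + n * n + n + i,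
  hv t vk = minn T (bud %% 2 ^ i) & hv t vpw = minn T (2 ^ i)]) vi vm body s isT isT.
rewrite (vget vm vs erefl) => H; have [] := H _ _ _.
- split; rewrite ?(vget vidx vs erefl) ?(vget vk vs erefl) ?(vget vpw vs erefl) ?addn0 // ?modn1 ?minn0 //.
  by rewrite expn0; lia.
- move=> i s' im [E1 E2 E3] F _; set t := setv s' vi i.
  have tT : hv t 0 = T := etrans (F 0 isT) (vget 0 vs erefl).
  have {}E1 : hv t vidx = n.+1 + n * n + n + i by [].
  have {}E2 : hv t vk = minn T (bud %% 2 ^ i) by [].
  have {}E3 : hv t vpw = minn T (2 ^ i) by [].
  clearbody t; clear s' F; rewrite /body execS.
  have em : bud %% 2 ^ i.+1 = bud %% 2 ^ i + odd (bud %/ 2 ^ i) * 2 ^ i.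
    have h := divn_eq bud (2 ^ i); set q := bud %/ 2 ^ i in h *.
    have hr : bud %% 2 ^ i < 2 ^ i by rewrite ltn_mod expn_gt0.
    have E : bud = q./2 * 2 ^ i.+1 + (odd q * 2 ^ i + bud %% 2 ^ i).
      by rewrite {1}h -{1}(odd_double_half q) -mul2n expnS mulnDl -mulnA mulnCA; lia.
    rewrite {1}E modnMDl modn_small; first by rewrite addnC.
    by rewrite expnS; case: (odd q); lia.
  have K1 : hv (exec (HIn vidx (hadd vk vpw vj) HSkip) t) vk = minn T (bud %% 2 ^ i.+1).
    rewrite execIn E1 inpB // em; case: (odd _).
      by rewrite (exec_hadd inp (x := vk) (y := vpw) (t := vj)) ?tT ?E2 ?E3 ?minn_add ?geq_minl ?mul1n.
    by rewrite execSkip E2 mul0n addn0.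
  set t1 := exec _ t in K1 *.
  have T1 : hv t1 0 = T by rewrite exec_mods.
  have {}E1 : hv t1 vidx = n.+1 + n * n + n + i by rewrite exec_mods.
  have {}E3 : hv t1 vpw = minn T (2 ^ i) by rewrite exec_mods.
  clearbody t1; rewrite execS execZero; set t2 := setv _ _ _.
  have T2 : hv t2 0 = T by []. have {}E1 : hv t2 vidx = n.+1 + n * n + n + i by [].
  have {}E3 : hv t2 vpw = minn T (2 ^ i) by [].
  have K2 : hv t2 vk = minn T (bud %% 2 ^ i.+1) by []. have X2 : hv t2 vt = 0 by [].
  clearbody t2; rewrite execS.
  have X3 : hv (exec (hadd vt vpw vj) t2) vt = minn T (2 ^ i).
    by rewrite (exec_hadd inp (x := vt) (y := vpw) (t := vj)) ?T2 ?E3 ?X2 // add0n; apply/minn_idPr/geq_minl.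
  set t3 := exec _ t2 in X3 *.
  have T3 : hv t3 0 = T by rewrite exec_mods.
  have {}E1 : hv t3 vidx = n.+1 + n * n + n + i by rewrite exec_mods.
  have {}E3 : hv t3 vpw = minn T (2 ^ i) by rewrite exec_mods.
  have K3 : hv t3 vk = minn T (bud %% 2 ^ i.+1) by rewrite exec_mods.
  clearbody t3; rewrite execS.
  have P4 : hv (exec (hadd vpw vt vj) t3) vpw = minn T (2 ^ i.+1).
    rewrite (exec_hadd inp (x := vpw) (y := vt) (t := vj)) ?T3 ?E3 ?X3 ?geq_minl //.
    by rewrite minn_add expnS mul2n addnn.
  set t4 := exec _ t3 in P4 *.
  have T4 : hv t4 0 = T by rewrite exec_mods.
  have {}E1 : hv t4 vidx = n.+1 + n * n + n + i by rewrite exec_mods.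
  have K4 : hv t4 vk = minn T (bud %% 2 ^ i.+1) by rewrite exec_mods.
  clearbody t4; rewrite exec_Inc ?E1 ?T4; last by clear -im tb; lia.
  by split=> //; rewrite hv_setv /=; lia.
- by move=> i s' j [].
have vs1 := vals_frame inp (HFor vi vm body) vs.
move=> _ K _; rewrite execS; move: (exec _ s) vs1 K => {vs H}s vs K.
have {}K : hv s vk = minn T bud by rewrite K modn_small.
rewrite /p execS.
have K1 : hv (exec (HLt vn vk (HZero vk ;; hadd vk vn vj) HSkip) s) vk = k.
  rewrite execLt K (vget vn vs erefl); case: (ltnP n (minn T bud)) => lt.
    rewrite execS execZero; set t := setv s vk 0.
    have t0 : hv t 0 = T := vget 0 vs erefl. have tn : hv t vn = n := vget vn vs erefl.
    have tk : hv t vk = 0 by [].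
    clearbody t; rewrite (exec_hadd inp (x := vk) (y := vn) (t := vj)) ?t0 ?tn ?tk //.
    by rewrite /k; lia.
  by rewrite execSkip K /k; lia.
have {K1 K}vs := vals_step vs K1.
move: (exec _ s) vs => {}s /= vs; rewrite execS.
have le : k <= n by rewrite /k; lia.
have {}vs := vals_hadd inp (x := vk1) (y := vk) (t := vj) vs erefl erefl erefl isT ltac:(lia).
move: (exec _ s) vs => {}s /= vs; rewrite execS.
have {}vs := vals_hadd inp (x := vk1) (y := vk) (t := vj) vs erefl erefl erefl isT ltac:(lia).
move: (exec _ s) vs => {}s /= vs.
have {}vs := vals_inc inp (x := vk1) vs erefl erefl ltac:(lia).
by rewrite (vget vk1 vs erefl); lia.
Qed.

Local Notation gctx := (gctx n e Q T k).
Local Notation pctx := (pctx n e Q T k labT).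
Local Notation feas := (feas n e).

Lemma labT_rng : rng n labT.
Proof. by move=> v vn'; rewrite /labT; case: ifP => // _; apply: leqW. Qed.

Lemma low_spec s : pctx 0 s -> hv s vcont = 0 -> exists h0, let s' := exec PLow s in
  [/\ h0 <= k.*2.+1, forall B', B' < h0 -> ~ feas labT B', h0 <= k.*2 -> feas labT h0,
    pctx h0 s' & hv s' vcont = 1].
Proof.
move=> p c0; have tb := T_big m_gt; have kn : k <= n := geq_minr _ _.
rewrite /PLow execS.
have [g1 L1 B1 _ _] := reset_spec inp kn (Q_large_m m_gt) (six_Q_le m_gt) (sum_le m_gt) (budget_le m_gt) (sweeps_le m_gt) (leq0n _) p.
have p1 : pctx 0 (exec Reset s) by apply: pctx_exec.
move: (exec Reset s) g1 L1 B1 p1 => {p c0}s g L1 B1 p.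
rewrite execS; set body := Oracle ;; _.
(* The bound rises once in every round until it is feasible and then stays, so falling behind the
   round counter certifies feasibility. *)
have := @exec_for_ind inp (fun i t => [/\ pctx 0 t, hv t vB <= i,
  forall B', B' < hv t vB -> ~ feas labT B' & hv t vB < i -> feas labT (hv t vB)])
  vst vk1 body s isT isT.
rewrite (gk1 g) => H; have {H} [] := H _ _ _.
- by split; rewrite ?B1.
- move=> i s' iL [p' b1 b2 b3] F M; set t := setv s' vst i.
  have pt : pctx 0 t by case: p' => *; split=> //; apply: gctx_setv.
  have Lt : eqlab n (labs t) labT by move=> v vn'; rewrite -(L1 v vn') /labs hm_setv M.
  have {}b1 : hv t vB <= i by []. have {}b2 : forall B', B' < hv t vB -> ~ feas labT B' by [].
  have {}b3 : hv t vB < i -> feas labT (hv t vB) by [].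
  clearbody t; clear s' F M p'; rewrite /body execS.
  have := oracle_ok inp e_sym e_irr kn (Q_large_m m_gt) (six_Q_le m_gt) (sum_le m_gt) (budget_le m_gt) (sweeps_le m_gt) (pg pt) labT_rng Lt erefl.
  have pt1 : pctx 0 (exec Oracle t) by apply: pctx_exec.
  have Bt1 : hv (exec Oracle t) vB = hv t vB by rewrite exec_mods.
  move: (exec Oracle t) pt1 Bt1 => t1 pt1 Bt1 O.
  have {}O : 0 < hv t1 vfd <-> feas labT (hv t vB) by apply: O; lia.
  rewrite execLt (g0 (pg pt1)); case: (ltnP 0 (hv t1 vfd)) => fd.
    by rewrite execSkip Bt1; split=> // [|_]; [lia|apply/O].
  have nf : ~ feas labT (hv t vB) by move=> /O; lia.
  have Bi : hv t vB = i.
    by apply/eqP; rewrite eqn_leq b1 leqNgt; apply/negP => /b3.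
  rewrite exec_Inc Bt1 ?(gT (pg pt1)); last by lia.
  rewrite !hv_setv eqxx; split=> //.
  + by case: pt1 => *; split=> //; apply: gctx_setv.
  + by move=> B'; rewrite ltnS leq_eqVlt => /orP[/eqP->|/b2].
  + by rewrite Bi => h; lia.
- by move=> i s' j [p' *]; split=> //; case: p' => *; split=> //; apply: gctx_setv.
move: (exec (HFor _ _ _) s) => {p L1 B1 g}s p b1 b2 b3.
exists (hv s vB); cbv zeta; rewrite execS; set h := hv s vB in b1 b2 b3 *.
have H1 : hv (exec (hadd vh vB vj) s) vh = h.
  rewrite (exec_hadd inp (x := vh) (y := vB) (t := vj)) ?(ph p) ?(gT (pg p)) //.
  by apply/minn_idPr; rewrite -/h; lia.
have p2 : pctx h (exec (hadd vh vB vj) s).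
  split; rewrite ?H1 //; first by apply: gctx_exec (pg p).
    by move=> v vn'; rewrite exec_amods // (plab p).
  by rewrite exec_mods // (p1 p).
move: (exec _ s) p2 => t pt; split=> //; first by apply: pctx_exec.
by rewrite exec_hone // (gT (pg pt)); lia.
Qed.

Theorem init_spec s : (forall x, hv s x = if x == 0 then T else if x == vm then m else 0) ->
  (forall a x y, hm s a x y = 0) -> exists h0, let s' := exec Init s in
  [/\ h0 <= k.*2.+1, forall B', B' < h0 -> ~ feas labT B' & h0 <= k.*2 -> feas labT h0] /\
  [/\ pctx h0 s', bits01 s', bval k h0 s' = 0, hv s' vacc = 0 & hv s' vcont = 1].
Proof.
move=> hs ms; have tb := T_big m_gt.
have ac : hv (exec Init s) vacc = 0 by rewrite exec_mods // hs.
have b4 : hm (exec Init s) 4 = fun _ _ => 0.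
  by rewrite exec_amods //; apply: funext => x; apply: funext => y; rewrite ms.
pose zs := [:: vn1; vn2; vidx; vq; vq2; vt; vk; vk1; vh; vcont; vpw; vstop].
pose zs' := [:: vt; vk; vk1; vh; vcont].
pose l := [:: (0, T); (vm, m); (v0, 0); (vn, 0); (v1, 0)] ++ [seq (x, 0) | x <- zs].
have vs : vals l s by rewrite /vals /= !hs /= !eqxx.
suff [h0 [h1 h2 h3 p c]] : exists h0, [/\ h0 <= k.*2.+1, forall B', B' < h0 -> ~ feas labT B',
    h0 <= k.*2 -> feas labT h0, pctx h0 (exec Init s) & hv (exec Init s) vcont = 1].
  exists h0; cbv zeta; split=> //; split=> //; first by move=> i; rewrite b4.
  by rewrite /bval b4 big1.
rewrite /Init execS.
have E1 : hv (exec PSize s) vn = n.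
  by apply: size_spec; rewrite /vals /= !hs /= !eqxx.
have {E1}vs := vals_step vs E1.
have m0 : hm (exec PSize s) 0 = fun _ _ => 0.
  by rewrite exec_amods //; apply: funext => x; apply: funext => y; rewrite ms.
have m1 : hm (exec PSize s) 1 = fun _ _ => 0.
  by rewrite exec_amods //; apply: funext => x; apply: funext => y; rewrite ms.
move: (exec PSize s) vs m0 m1 => {hs ms ac b4}s /= vs m0 m1.
have {vs}vs : vals ([:: (0, T); (vm, m); (v0, 0); (vn, n); (vn1, n.+1); (vn2, n.+2);
    (vidx, n.+1); (v1, 1); (vq, Q); (vq2, Q.*2)] ++ [seq (x, 0) | x <- zs']) (exec PVars s).
  apply: vals_cat; first by apply: vars_spec; apply: vals_sub vs _; rewrite /= ?eqxx.
  by apply: vals_sub (vals_frame inp PVars vs) _; rewrite /= ?eqxx.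
rewrite execS.
have {}m0 : hm (exec PVars s) 0 = fun _ _ => 0 by rewrite exec_amods.
have {}m1 : hm (exec PVars s) 1 = fun _ _ => 0 by rewrite exec_amods.
move: (exec PVars s) vs m0 m1 => {}s /= vs m0 m1.
have [x2 a2] : hv (exec PAdj s) vidx = n.+1 + n * n /\
    forall u v, u < n -> v < n -> hm (exec PAdj s) 0 u v = e u v.
  by apply: adj_spec => [|u v]; rewrite ?m0 //; apply: vals_sub vs _; rewrite /= ?eqxx.
have {x2}vs := vals_step vs x2.
have {}m1 : hm (exec PAdj s) 1 = fun _ _ => 0 by rewrite exec_amods.
rewrite execS; move: (exec PAdj s) vs m1 a2 => {m0}s /= vs m1 a2.
have [x3 a3] : hv (exec PLab s) vidx = n.+1 + n * n + n /\
    forall v, v < n -> hm (exec PLab s) 1 v 0 = labT v.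
  by apply: lab_spec => [|u v]; rewrite ?m1 //; apply: vals_sub vs _; rewrite /= ?eqxx.
have {x3}vs := vals_step vs x3.
have {}a2 u v : u < n -> v < n -> hm (exec PLab s) 0 u v = e u v by rewrite exec_amods //; apply: a2.
rewrite execS; move: (exec PLab s) vs a2 a3 => {m1}s /= vs a2 a3.
have x4 : hv (exec PBud s) vk1 = k.*2.+1.
  by apply: bud_spec; apply: vals_sub vs _; rewrite /= ?eqxx.
have {x4}vs := vals_step vs x4.
have {}a2 u v : u < n -> v < n -> hm (exec PBud s) 0 u v = e u v by rewrite exec_amods //; apply: a2.
have {}a3 v : v < n -> hm (exec PBud s) 1 v 0 = labT v by rewrite exec_amods //; apply: a3.
rewrite execS; move: (exec PBud s) vs a2 a3 => {}s /= vs a2 a3.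
apply: low_spec; last by apply: (vget _ vs).
split; [split | exact: a3 | by apply: (vget _ vs) | by apply: (vget _ vs)];
  try by apply: (vget _ vs).
by move=> u v un vn'; rewrite a2 // lt0b.
Qed.
End Init.

(** * Labellings and the linear program *)

Section Bridge.
Variable I : NMC.
Hypothesis wf : nmc_wf I.
Let n := nv I.

Definition adjN (u v : nat) : bool :=
  if (insub u, insub v) is (Some a, Some b) then adj I a b else false.
Definition termN (v : nat) : bool := if insub v is Some a then a \in term I else false.

Lemma adjNE (a b : 'I_n) : adjN a b = adj I a b.
Proof. by rewrite /adjN !valK. Qed.

Lemma termNE (a : 'I_n) : termN a = (a \in term I).
Proof. by rewrite /termN valK. Qed.

Lemma adjN_sym u v : adjN u v = adjN v u.
Proof. by rewrite /adjN; case: (insub u) => [a|]; case: (insub v) => [b|] //; rewrite (proj1 wf). Qed.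

Lemma adjN_irr v : adjN v v = false.
Proof. by rewrite /adjN; case: (insub v) => [a|] //; apply/negbTE/(proj2 wf). Qed.

Local Notation lab0 := (labT termN).
Local Notation del := (del n).

(** Along a path without deleted vertices the label is constant, while distinct terminals carry
    distinct labels. *)
Lemma isol_yes k : isol n adjN lab0 k -> k <= budget I -> nmc_yes I.
Proof.
move=> [nu [r ex it ct]] kb.
have tn (t : 'I_n) : t \in term I -> nu t = t.+1.
  by move=> tt; rewrite ex ?/labT ?termNE ?tt.
exists [set a : 'I_n | nu a == del]; split.
- apply/pred0P => a /=; rewrite inE; apply/negP => /andP[/eqP ea ta].
  by have := ltn_ord a; move: ea; rewrite tn // /del /n; lia.
- apply: leq_trans (leq_trans ct kb).
  rewrite -sum1_card big_mkcond /=; apply: eq_leq.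
  by apply: eq_bigr => a _; rewrite inE; case: eqP.
move=> x s [p _ xt lt xl]; apply/negPn/negP => /hasPn H.
have Hx (a : 'I_n) : a \in x :: s -> nu a != del by move/H; rewrite inE.
suff : nu x = nu (last x s) by rewrite !tn // => -[] /val_inj E; rewrite -E eqxx in xl.
elim: s x p Hx {xt lt xl H} => //= y s IH x /andP[xy p] Hx.
rewrite -IH //; last by move=> a ai; apply: Hx; rewrite inE ai orbT.
apply: it => //; first by rewrite adjNE.
  by apply: Hx; rewrite mem_head.
by apply: Hx; rewrite !inE eqxx orbT.
Qed.

(** Outside [X] each component contains at most one terminal and takes its label, or 0 if there is
    none. The cap at [n] is harmless since [X] has at most [n] vertices. *)
Lemma yes_isol : nmc_yes I -> isol n adjN lab0 (minn (budget I) n).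
Proof.
move=> [X [dX cX HX]].
pose r (a b : 'I_n) := [&& adj I a b, a \notin X & b \notin X].
have rs : connect_sym r.
  by apply: sym_connect_sym => a b; rewrite /r (proj1 wf) [_ && (b \notin X)]andbC.
pose nuO (a : 'I_n) := if a \in X then del else
  if [pick t | (t \in term I) && connect r t a] is Some t then (t : nat).+1 else 0.
pose nu v := if insub v is Some a then nuO a else 0.
have nuE (a : 'I_n) : nu a = nuO a by rewrite /nu valK.
have nX (a : 'I_n) : (nu a == del) = (a \in X).
  rewrite nuE /nuO; case: ifP => aX; rewrite ?eqxx //.
  by case: pickP => [t _|_] //; have := ltn_ord t; rewrite /del /n; lia.
exists nu; split.
- move=> v vn'; have -> : v = Ordinal vn' by [].
  rewrite nuE /nuO; case: ifP => // _; case: pickP => // t _.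
  by have := ltn_ord t; rewrite /n; lia.
- move=> v vn'; have -> : v = Ordinal vn' by []; move: (Ordinal vn') => {vn'}t.
  rewrite /labT termNE; case: ifP => // tt _.
  have tX : t \notin X by apply/negP => tX; have := pred0P dX t; rewrite /= tX tt.
  rewrite nuE /nuO (negPf tX); case: pickP => [t'|/(_ t)]; last by rewrite tt connect0.
  case/andP=> tt' /connectP[p pp lp]; congr _.+1; congr val.
  case: (eqVneq t' t) => // ne; exfalso.
  have t'X : t' \notin X by apply/negP => tX'; have := pred0P dX t'; rewrite /= tX' tt'.
  (* Connectivity yields a walk, but the cut condition speaks of simple paths only. *)
  case/shortenP: pp lp => p' pp' up' _ lp.
  have /HX/hasP[a] : term_path I t' p'.
    by split; rewrite -?lp //; apply: sub_path pp' => a b /and3P[].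
  rewrite inE => /orP[/eqP->|]; first by rewrite (negPf t'X).
  elim: p' t' {t'X up' tt' lp ne} pp' => //= b p' IH t'.
  case/andP=> /and3P[_ _ bX] pp'; rewrite inE => /orP[/eqP-> bX'|ap aX]; first by rewrite bX' in bX.
  exact: IH pp' ap aX.
- move=> u v un vn'; have -> : u = Ordinal un by []. have -> : v = Ordinal vn' by [].
  move: (Ordinal un) (Ordinal vn') => {un vn'}u {}v; rewrite adjNE !nX !nuE /nuO => uv uX vX.
  rewrite (negPf uX) (negPf vX); congr (if _ is Some t then _ else _).
  apply: eq_pick => t /=; congr (_ && _).
  have ruv : connect r u v by apply: connect1; rewrite /r uv uX.
  by apply/idP/idP => c; apply: connect_trans c _ => //; rewrite rs.
- have -> : \sum_(v < n) (nu v == del) = #|X|.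
    rewrite -sum1_card [RHS]big_mkcond /=.
    by apply: eq_bigr => a _; rewrite nX; case: ifP.
  by rewrite leq_min cX -[n in _ <= n]card_ord max_card.
Qed.

Lemma bridge : nmc_yes I <-> isol n adjN lab0 (minn (budget I) n).
Proof. by split; [exact: yes_isol | move/isol_yes; apply; exact: geq_minl]. Qed.

(** * Feasible LP solutions from labellings *)

Section LP.
Variable R : realType.

Lemma LP_ge0 : (0 <= LP R I)%E.
Proof.
apply: le_ereal_inf_tmp => _ [d [d0 _] <-]; rewrite lee_fin.
by apply: sumr_ge0 => v /d0.
Qed.

(** Telescoping [zs_arc] along the path: the distance to the label of the first terminal is 0 at the
    start and 2 at the last terminal, so the vertices in between pay at least two half-units.
    Terminals pay nothing. *)
Lemma path_cost lam B : rng n lam -> ext n lab0 lam -> valid n adjN lam ->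
  tcost n adjN lam <= B -> forall x s, term_path I x s ->
  2 <= \sum_(v <- x :: s | v \notin term I) cost n adjN lam v.
Proof.
move=> r ex va _ x s [p _ xt lt xl].
have tn (t : 'I_n) : t \in term I -> lam t = t.+1.
  by move=> tt; rewrite ex ?/labT ?termNE ?tt.
have c0 (t : 'I_n) : t \in term I -> cost n adjN lam t = 0.
  move=> tt; rewrite /cost tn // ifF //; apply/negbTE; have := ltn_ord t.
  by rewrite /del /n; lia.
have -> : \sum_(v <- x :: s | v \notin term I) cost n adjN lam v =
   \sum_(v <- x :: s) cost n adjN lam v.
  rewrite [RHS](bigID (fun v => v \in term I)) /= [X in _ = X + _]big1 ?add0n // => v; exact: c0.
rewrite big_cons c0 // add0n.
have L l y : l < n.+1 -> path (adj I) y s -> zs n adjN lam l (last y s) <=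
   zs n adjN lam l y + \sum_(v <- s) cost n adjN lam v.
  move=> ln; elim: s y {p lt xl} => [|z s IH] y /=; first by rewrite big_nil addn0.
  case/andP=> yz p; rewrite big_cons addnA; apply: leq_trans (IH z p) _.
  rewrite leq_add2r; have := @zs_arc n adjN adjN_sym lam l y z r va ln (ltn_ord y) (ltn_ord z).
  by rewrite adjNE {3}/zs eqxx; apply.
have := L x.+1 x (ltn_ord x) p.
have pl : prp n x.+1 by rewrite /prp; have := ltn_ord x; rewrite /n; lia.
have ld : (x.+1 == del) = false by apply/negbTE; have := ltn_ord x; rewrite /del /n; lia.
rewrite {1 2}/zs ld pl !tn // eqxx /= add0n eqSS val_eqE eq_sym (negPf xl) /=.
by [].
Qed.

Lemma LP_le B : feas n adjN lab0 B -> (LP R I <= (B%:R / 2)%:E)%E.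
Proof.
move=> [lam [r ex va ct]].
pose d (a : 'I_n) : R := ((cost n adjN lam a)%:R / 2)%R.
apply: (@le_trans _ _ (\sum_(v | v \notin term I) d v)%:E).
  apply: ereal_inf_lbound; exists d => //; split=> [v _|x s tp].
    by rewrite /d divr_ge0.
  rewrite /d -mulr_suml -natr_sum ler_pdivlMr // mul1r ler_nat.
  exact: path_cost ct _ _ tp.
rewrite lee_fin /d -mulr_suml -natr_sum ler_pM2r ?invr_gt0 // ler_nat.
apply: leq_trans ct; rewrite /tcost [leqRHS](bigID (fun v => v \in term I)) /=.
exact: leq_addl.
Qed.

Lemma pexp_ge0 : (0 <= pexp R I)%R.
Proof. by rewrite /pexp fine_ge0 // le_max lexx orbT. Qed.

(** For [h0 <= 2k], [LP <= h0 / 2] gives [(2k - h0) / 2 <= p], and replacing the budget by the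
    smaller [k] only helps. The factor 2 comes from the positions [h0] to [2k] being one more than
    their difference. For [h0 = 2k + 1] there is a single run. *)
Lemma runs_le h0 : h0 <= (minn (budget I) n).*2.+1 ->
  (h0 <= (minn (budget I) n).*2 -> feas n adjN lab0 h0) ->
  ((2 ^ ((minn (budget I) n).*2.+1 - h0))%:R <= 2 * 4 `^ pexp R I :> R)%R.
Proof.
set k := minn _ _ => h1 hf.
have p0 := pexp_ge0.
have one : (1 <= 4 `^ pexp R I :> R)%R.
  by rewrite -[leLHS](powRr0 4%:R); apply: ler_powR; lra.
case: (leqP h0 k.*2) => [le|lt]; last first.
  have -> : k.*2.+1 - h0 = 0 by lia.
  by rewrite expn0; lra.
rewrite subSn // expnS natrM ler_pM2l //.
have lpE := LP_le (hf le); have lp0 := LP_ge0.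
have pe : ((k.*2 - h0)%:R / 2 <= pexp R I)%R.
  rewrite /pexp /pI; move: lpE lp0; case: (LP R I) => [x| |] //=.
  rewrite !lee_fin => xl x0; rewrite -EFinB -EFin_max /= le_max.
  have kb : (k%:R <= (budget I)%:R :> R)%R by rewrite ler_nat geq_minl.
  by apply/orP; left; rewrite natrB // -muln2 natrM; lra.
apply: le_trans (ler_powR _ pe); last by lra.
have -> : (4 = 2 `^ 2%:R :> R)%R by rewrite powR_mulrn //; lra.
rewrite -powRrM mulrCA divff ?mulr1; last by lra.
by rewrite powR_mulrn // natrX.
Qed.
End LP.
End Bridge.

(** * The machine *)

Lemma nth_allpairs (A B C : Type) (f : A -> B -> C) (x : A) (y : B) z s t i j :
  i < size s -> j < size t ->
  nth z [seq f a b | a <- s, b <- t] (i * size t + j) = f (nth x s i) (nth y t j).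
Proof.
elim: s i => // a s IH [|i] /= il jl; rewrite nth_cat size_map.
  by rewrite jl (nth_map y).
by rewrite mulSn -addnA ltnNge leq_addr /= addKn IH.
Qed.

Lemma tape_nth w j : (tape_of w j == Some true) = nth false w j.
Proof.
rewrite /tape_of; have [lt|le] := ltnP j (size w).
  by rewrite (nth_map false) //; case: (nth _ _ _).
by rewrite !nth_default ?size_map.
Qed.

Lemma tape_lt w j : j < size w -> tape_of w j = Some (nth false w j).
Proof. by move=> lt; rewrite /tape_of (nth_map false). Qed.

Lemma tape_pres w j : (tape_of w j != None) = (j < size w).
Proof.
have [lt|le] := ltnP j (size w); first by rewrite tape_lt.
by rewrite /tape_of nth_default ?size_map.
Qed.

(** * The encoded instance as seen on the tape *)

Section Encode.
Variable I : NMC.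
Local Notation n := (nv I).
Local Notation w := (encode I).

Lemma isizeE : isize I = n.+1 + n * n + n + (trunc_log 2 (budget I)).+1.
Proof.
rewrite /isize /encode !size_cat size_nseq size_allpairs !size_map size_iota -!enumT !size_enum_ord /=.
by lia.
Qed.

Lemma enc_ones i : i < n -> tape_of w i = Some true.
Proof.
move=> lt; rewrite tape_lt; last by rewrite -/(isize I) isizeE; lia.
by rewrite /encode nth_cat size_nseq lt nth_nseq lt.
Qed.

Lemma enc_zero : tape_of w n = Some false.
Proof.
rewrite tape_lt; last by rewrite -/(isize I) isizeE; lia.
by rewrite /encode nth_cat size_nseq ltnn subnn.
Qed.

Lemma enc_tail i : nth false w (n.+1 + i) = nth false
  ([seq adj I u v | u <- enum 'I_n, v <- enum 'I_n] ++
   [seq v \in term I | v <- enum 'I_n] ++ bin_nat (budget I)) i.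
Proof.
rewrite /encode nth_cat size_nseq ifF; last by lia.
by have -> : n.+1 + i - n = i.+1 by lia.
Qed.

Lemma enc_adj u v : u < n -> v < n -> (tape_of w (n.+1 + (u * n + v)) == Some true) = adjN I u v.
Proof.
move=> un vn'; rewrite tape_nth enc_tail nth_cat size_allpairs size_enum_ord pair_lt //.
have := @nth_allpairs _ _ _ (adj I) (Ordinal un) (Ordinal un) false (enum 'I_n) (enum 'I_n) u v.
rewrite size_enum_ord => -> //.
rewrite -[RHS]/(adjN I (Ordinal un) (Ordinal vn')) adjNE.
by congr (adj I _ _); [exact: (nth_ord_enum _ (Ordinal un))|exact: (nth_ord_enum _ (Ordinal vn'))].
Qed.

Lemma enc_term v : v < n -> (tape_of w (n.+1 + n * n + v) == Some true) = termN I v.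
Proof.
move=> vn'; rewrite tape_nth -addnA enc_tail nth_cat size_allpairs size_enum_ord ifF; last by lia.
rewrite addKn nth_cat size_map size_enum_ord vn' (nth_map (Ordinal vn')) ?size_enum_ord //.
rewrite -[RHS]/(termN I (Ordinal vn')) termNE.
by have := nth_ord_enum (Ordinal vn') (Ordinal vn') => /= ->.
Qed.

Lemma enc_bud i :
  (tape_of w (n.+1 + n * n + n + i) == Some true) = odd (budget I %/ 2 ^ i).
Proof.
rewrite tape_nth -!addnA enc_tail nth_cat size_allpairs size_enum_ord ifF; last by lia.
rewrite addKn nth_cat size_map size_enum_ord ifF; last by lia.
rewrite addKn /bin_nat; have [lt|ge] := ltnP i (trunc_log 2 (budget I)).+1.
  by rewrite (nth_map 0) ?size_iota // nth_iota.
rewrite nth_default ?size_map ?size_iota // divn_small //.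
by apply: leq_trans (trunc_log_ltn (budget I) (isT : 1 < 2)) _; rewrite leq_pexp2l.
Qed.

Lemma bud_small : budget I < 2 ^ isize I.
Proof.
apply: leq_trans (trunc_log_ltn (budget I) (isT : 1 < 2)) _.
by rewrite leq_pexp2l // isizeE; lia.
Qed.
End Encode.

(** Register 6 is the variable [vm] and finds the input length [m] by walking to the first blank.
    With [m] in register 1, two Horner steps turn 64 into [64 * m * m], which becomes the saturation
    bound in register 5; register 1 finally gets [T + 1]. *)
Definition linit := CSeq (CWhile (TPres 6) (CAct (AInc 6)))
  (CSeq (ladd 1 6) (CSeq (linc 64 2) (CSeq (lmuladd 0) (CSeq (lmuladd 0)
  (CSeq (lclr 1) (CSeq (ladd 5 2) (CSeq (ladd 1 2) (CAct (AInc 1))))))))).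

Definition hst0 m := HS (fun x => if x == 0 then 64 * (m * m) else if x == 1 then m else 0)
  (fun _ _ _ => 0).

Lemma linit_spec w K (m := size w) (T := 64 * (m * m)) (B := hbound T) : 1 < m -> 1 < K ->
  tr (tape_of w) B linit (200 * (B.+1 * B.+1)) (fun=> 0, fun=> false) (simrel K T (hst0 m)).
Proof.
move=> m1 K1; have T200 : 200 <= T by rewrite /T; nia.
have TB : T.+1 <= B by apply: PB.
have mT : 64 * m <= T by rewrite /T; nia.
apply: (@tr_le _ _ _ ((m * 3).+1 + (8 * B.+1 + (64 + (50 * (B.+1 * B.+1) + (50 * (B.+1 * B.+1) +
   ((3 * B).+1 + (8 * B.+1 + (8 * B.+1 + 1))))))))); last by nia.
apply: tr_seq; first apply: (tr_while (N := m) (t0 := 1)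
   (I := fun j s => [/\ j <= m, s.1 6 = j & frame [:: 6] (fun=> 0, fun=> false) s])) => [j s lt|s|].
- case=> jm E [Fw Fr]; rewrite /do_test E tape_pres; split=> //; apply: tr_act.
    by rewrite /= E; lia.
  have U r : (do_act (AInc 6) s).1 r = if r == 6 then (s.1 6).+1 else s.1 r by [].
  by split=> //; [rewrite U eqxx E|split=> // r; rewrite inE => r6; rewrite U (negPf r6) Fr // inE].
- by case=> _ E _; rewrite /do_test E tape_pres ltnn.
- by split.
move=> s1 [_ E6 [w1 F1]]; have G1 r : r != 6 -> s1.1 r = 0 by move=> r6; rewrite F1 // inE.
apply: tr_seq.
  by apply: tr_add; rewrite ?E6 ?G1 // add0n; lia.
move=> s2 [A1 A4 [w2 F2]]; rewrite G1 // E6 in A1; rewrite E6 in A4.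
have G2 r : r \notin [:: 1; 4; 6] -> s2.1 r = 0.
  by rewrite !inE !negb_or => /and3P[r1 r4 r6]; rewrite F2 ?G1 // !inE negb_or r1.
have H6 : s2.1 6 = m by rewrite F2.
apply: tr_seq; first by apply: tr_inc; rewrite G2 //; lia.
move=> s3 [A2 [w3 F3]]; rewrite G2 // add0n in A2.
have G3 r : r != 2 -> s3.1 r = s2.1 r by move=> r2; rewrite F3 // inE.
apply: tr_seq.
  by apply: tr_muladd; rewrite // ?A2 ?G3 ?A1 ?A4 ?G2 //; lia.
rewrite A2 !G3 // A1 [s2.1 0]G2 // addn0 => s4 [B2 B4 B3 [w4 F4]].
apply: tr_seq.
  by apply: tr_muladd; rewrite // ?B2 ?F4 ?G3 ?A1 ?G2 //; [lia | rewrite -mulnA -/T; lia].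
rewrite B2 !F4 // !G3 // A1 [s2.1 0]G2 // addn0 -mulnA -/T => s5 [C2 C4 C3 [w5 F5]].
have H5 r : r \notin [:: 1; 2; 3; 4; 6] -> s5.1 r = 0.
  rewrite !inE !negb_or => /and5P[r1 r2 r3 r4 r6].
  have r234 : r \notin [:: 2; 3; 4] by rewrite !inE !negb_or r2 r3.
  by rewrite F5 // F4 // G3 // G2 // !inE !negb_or r1 r4.
have H56 : s5.1 6 = m by rewrite F5 // F4 // G3.
have H51 : s5.1 1 = m by rewrite F5 // F4 // G3.
have H50 : s5.1 0 = 0 by apply: H5.
have H55 : s5.1 5 = 0 by apply: H5.
apply: tr_seq; first by apply: (tr_clr (m := B)); rewrite // H51; lia.
move=> s6 [D1 [w6 F6]].
have G6 r : r != 1 -> s6.1 r = s5.1 r by move=> r1; rewrite F6 // inE.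
have z6 : s6.1 0 = 0 by rewrite G6.
have t6 : s6.1 2 = T by rewrite G6.
have f6 : s6.1 5 = 0 by rewrite G6.
apply: tr_seq; first by apply: tr_add; rewrite // ?t6 ?f6 ?G6 //; lia.
rewrite f6 t6 add0n => s7 [E5 E4 [w7 F7]].
have z7 : s7.1 0 = 0 by rewrite F7.
have o7 : s7.1 1 = 0 by rewrite F7.
have t7 : s7.1 2 = T by rewrite F7.
apply: tr_seq; first by apply: tr_add; rewrite // ?o7 ?t7 ?E4 //; lia.
rewrite o7 t7 add0n => s8 [E1 E4' [w8 F8]].
have H8 r : 6 < r -> s8.1 r = 0.
  by move=> r6; rewrite F8 ?F7 ?G6 ?H5 // ?inE; lia.
apply: tr_act; first by rewrite /= E1; lia.
have V0 : s8.1 0 = 0 by rewrite F8.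
have V2 : s8.1 2 = T by rewrite F8.
have V3 : s8.1 3 <= B by rewrite F8 // F7 // G6.
have V5 : s8.1 5 = T by rewrite F8.
have V6 : s8.1 6 = m by rewrite F8 // F7 // G6.
split=> //=.
- by rewrite updE /= E1.
- move=> r r5; rewrite updE; case: eqP => [_|/eqP r1]; first by rewrite E1; lia.
  by case: r r5 r1 => [|[|[|[|[|//]]]]] //= _ _; lia.
- move=> x xK; rewrite updE /=; case: x xK => [|[|x]] //= _.
  by rewrite H8.
- by move=> x _; case: eqP => // _; case: eqP => // _; lia.
- by move=> a x y i *; rewrite w8 w7 w6 w5 w4 w3 w2 w1.
Qed.

(** Variables are shifted by 5 to become registers: 44 holds [vcont], and the answer is [vacc] in
    register 43. *)
Definition algo := CSeq linit (CSeq (hc Init) (CWhile (TLt 0 44) (hc Body))).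

Lemma algo_ok : cmd_ok 52 algo.
Proof. by []. Qed.

Lemma wf_Init : wfh 47 Init. Proof. by []. Qed.
Lemma wf_Body : wfh 47 Body. Proof. by []. Qed.

(** From [2 ^ 7 <= m ^ 7] the base is at most [m ^ 9], and [hbound] is a fourth power. *)
Lemma hbound_le m : 1 < m -> (hbound (64 * (m * m))).+1 <= m ^ 36.
Proof.
move=> m1; rewrite /hbound.
have h : (64 * (m * m)).+2 <= m ^ 9.
  have -> : m ^ 9 = m ^ 7 * (m * m) by rewrite !expnS expn0; lia.
  have : 2 ^ 7 <= m ^ 7 by rewrite leq_exp2r.
  by nia.
have -> : m ^ 36 = (m ^ 9) ^ 4 by rewrite -expnM.
by apply: leq_trans (_ : (64 * (m * m)).+2 ^ 4 <= _); [rewrite ltn_exp2r | rewrite leq_exp2r].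
Qed.

(** The number [J] of runs must stay a linear factor, since it carries the exponential part of the
    running time. *)
Lemma time_bound X a b J : 200 < X -> 0 < J ->
  (200 * (X * X) + (X ^ a + (J * (X ^ b).+2).+1)) * (X.*2 + 6) + 2 <= J * X ^ (a + b + 5).
Proof.
move=> X2 J0.
have ha : 0 < X ^ a by rewrite expn_gt0; lia.
have hb : 0 < X ^ b by rewrite expn_gt0; lia.
set P := X ^ a * X ^ b; set Y := J * P.
have h1 : X ^ a <= Y by rewrite /Y /P mulnCA leq_pmulr // muln_gt0 J0.
have h2 : J * X ^ b <= Y by rewrite /Y leq_mul2l leq_pmull // orbT.
have h3 : J <= Y by rewrite /Y leq_pmulr // muln_gt0 ha.
have Y0 : 0 < Y by lia.
have h4 : 200 * (X * X) + (X ^ a + (J * (X ^ b).+2).+1) <= X * X * X * Y.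
  have g1 : 201 * (X * X * Y) <= X * (X * X * Y) by rewrite leq_mul2r X2 orbT.
  have g2 : X * X <= X * X * Y by rewrite leq_pmulr.
  have g3 : 5 * Y <= X * X * Y by rewrite leq_mul2r; apply/orP; right; nia.
  have g4 : J * (X ^ b).+2 = J * X ^ b + 2 * J by rewrite -addn2 mulnDr [J * 2]mulnC.
  by rewrite g4 (_ : X * X * X * Y = X * (X * X * Y)); [lia | ring].
have -> : J * X ^ (a + b + 5) = X * X * X * Y * (X * X).
  by rewrite /Y /P !expnD !expnS expn0; ring.
set Z := X * X * X * Y in h4 *.
have Z0 : 0 < Z by rewrite /Z -!mulnA 3!muln_gt0 Y0; lia.
have g1 : Z * (X.*2 + 6 + 2) <= Z * (X * X) by rewrite leq_mul2l; apply/orP; right; nia.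
have := leq_mul h4 (leqnn (X.*2 + 6)); rewrite mulnDr in g1.
by lia.
Qed.

Lemma algo_ev I : nmc_wf I ->
  exists h0 J s', let m := isize I in let k := minn (budget I) (nv I) in
    let B := hbound (64 * (m * m)) in
  [/\ h0 <= k.*2.+1, h0 <= k.*2 -> feas (nv I) (adjN I) (labT (termN I)) h0,
      0 < J <= 2 ^ (k.*2.+1 - h0),
      exists2 N, N <= 200 * (B.+1 * B.+1) + (B.+1 ^ hexp Init + (J * (B.+1 ^ hexp Body).+2).+1) &
        ev (tape_of (encode I)) B algo (fun=> 0, fun=> false) N s' &
      0 < s'.1 43 <-> nmc_yes I].
Proof.
move=> wf; set m := isize I; set k := minn _ _; set n := nv I.
set T := 64 * (m * m); set B := hbound T; set inp := tape_of (encode I).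
have mn : n.+1 < m by rewrite /m isizeE; lia.
have T200 : 200 <= T by rewrite /T; nia.
have [|h0 [[h1 h2 h3] [p b01 v0' ac co]]] := @init_spec inp n m (adjN I) (termN I) (budget I) mn
  (@enc_ones I) (enc_zero I) (@enc_adj I) (@enc_term I) (fun i _ => enc_bud I i) (bud_small I)
  (adjN_sym wf) (adjN_irr wf) (hst0 m) (fun _ => erefl) _; first by [].
set s1 := exec inp Init (hst0 m) in p b01 v0' ac co.
have co' : 0 < hv s1 vcont by rewrite co.
have [J [J1 J2 J3 J4]] := outer_loop inp (adjN_sym wf) (adjN_irr wf) (geq_minr (budget I) n) (Q_large_m mn)
  (six_Q_le mn) (sum_le mn) (budget_le mn) (sweeps_le mn) (labT_rng _) h1 h2 p b01 v0' ac co'.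
suff [N [s' [le ev' R]]] : tr inp B algo (200 * (B.+1 * B.+1) + (B.+1 ^ hexp Init +
   (J * (B.+1 ^ hexp Body).+2).+1)) (fun=> 0, fun=> false)
   (simrel 47 T (iter J (exec inp Body) s1)).
  exists h0, J, s'; split=> //; first by exists N.
  by rewrite (relv R (x := vacc)) // J4; apply: iff_sym; apply: bridge.
apply: tr_seq; first by apply: (@linit_spec (encode I) 47); rewrite -/(isize I) -/m //; lia.
move=> s2 R2; apply: tr_seq; first refine (hl_sim inp T200 wf_Init R2).
rewrite -/s1 => s3 R3.
apply: (tr_while (I := fun j s => simrel 47 T (iter j (exec inp Body) s1) s)) => [j s jJ R|s R|//].
  rewrite /= (relv R (x := vcont)) // (rel0 R) J2 //; split=> //.
  exact: (hl_sim inp T200 wf_Body R).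
by rewrite /= (relv R (x := vcont)) // (rel0 R) J3.
Qed.

Local Open Scope ring_scope.

Theorem mainTheorem1 (R : realType) :
  exists (M : TM) (c : nat) (C : R),
    tm_acc M != tm_rej M /\
    forall I : NMC, nmc_wf I ->
      exists t : nat,
        t%:R <= C * (4 `^ pexp R I) * (isize I)%:R ^+ c /\
        let q := cstate M (tm_run M t (encode I)) in
        (q = tm_acc M \/ q = tm_rej M) /\ (q = tm_acc M <-> nmc_yes I).
Proof.
(* The factor 36 converts a power of [B + 1] into one of the input length by [hbound_le], the
   summand 5 comes from [time_bound], and the constant 2 from [runs_le]. *)
exists (machine 52 (code_of 0 algo) 43), (36 * (hexp Init + hexp Body + 5))%N, 2%:R; split=> // I wf.
have [h0 [J [s' [h1 h2 /andP[J0 J1] [N leN evN] acc]]]] := algo_ev wf.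
set m := isize I in leN evN; set B := hbound _ in leN evN.
have m1 : (1 < m)%N by rewrite /m isizeE; lia.
have T200 : (200 <= 64 * (m * m))%N by nia.
have B200 : (200 < B.+1)%N by have := PB (64 * (m * m)); rewrite -/B; lia.
have le := time_bound (hexp Init) (hexp Body) B200 J0.
exists (J * B.+1 ^ (hexp Init + hexp Body + 5))%N; split.
  apply: le_trans (_ : (2 ^ ((minn (budget I) (nv I)).*2.+1 - h0))%:R *
     (m ^ (36 * (hexp Init + hexp Body + 5)))%:R <= _).
    by rewrite -natrM ler_nat leq_mul // expnM leq_exp2r ?addn_gt0 ?orbT // hbound_le.
  by rewrite [(m ^ _)%:R]natrX ler_wpM2r ?exprn_ge0 // runs_le.
rewrite (machine_correct algo_ok _ evN) //; last first.
  by apply: leq_trans le; rewrite leq_add2r leq_mul // leq_add2r leq_double.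
cbv zeta; case: (posnP (s'.1 43)) => r0; rewrite r0 in acc * || rewrite gtn_eqF //.
  by split; [right | split=> // /acc].
by split; [left | split=> // _; apply/acc].
Qed.
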